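(* Let $s\ge 1$ be an integer and let $y_1=\Psi_h(y_0)$ be the map defined by the Euler--Maclaurin method of order $2s$ with stepsize $h$, $$y_1 = y_0+\frac{h}{2}\left( f(y_1)+f(y_0) \right) -\sum_{k=1}^{s-1} \frac{h^{2k}B_{2k}}{(2k)!} \left( D_{2k-1}f(y_1)- D_{2k-1}f(y_0) \right),$$ applied to $y'=f(y)$. Then $\Psi_h$ admits a $B$-series expansion and the method is conjugate-symplectic up to order $2s+2$; that is, when it is applied to a canonical Hamiltonian system, $f=J\nabla H$, there exist a global change of coordinates $\chi_h(y)=y+O(h^{2s})$ and a map $\widehat\Psi_h$ such that $$\Psi_h=\chi_h\circ\widehat\Psi_h\circ\chi_h^{-1}\qquad\text{and}\qquad \widehat\Psi_h'(y)^\top J\,\widehat\Psi_h'(y)=J+O(h^{2s+3}).$$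
   Context: Problem: the initial value problem $y'(t)=f(y(t))$, $y(t_0)=y_0\in\mathbb{R}^d$, with $f$ as smooth as needed. A canonical Hamiltonian system is the case $d=2m$, $f(y)=J\nabla H(y)$, where $H:\mathbb{R}^{2m}\to\mathbb{R}$ is the (smooth) Hamiltonian and $J=\begin{pmatrix} O & I\\ -I & O\end{pmatrix}$ with $I$ the $m\times m$ identity matrix. Lie derivatives: for a vector $z$, $D_jf(z)=\left.\frac{\mathrm{d}^j}{\mathrm{d}t^j}f(y(t))\right|_{y(t)=z}$, where $y(t)$ satisfies $y'(t)=f(y(t))$. Equivalently $D_0f=f$ and $D_jf(z)=(D_{j-1}f)'(z)\,f(z)$; for example $D_1f(z)=f'(z)f(z)$, with $f'$ the Jacobian matrix of $f$. $B_{2k}$ denotes the $2k$-th Bernoulli number, with $\frac{z}{e^z-1}=\sum_{k\ge 0}B_k\frac{z^k}{k!}$ (so $B_2=1/6$, $B_4=-1/30$, $B_6=1/42$). For $s=1$ the sum in the method is empty and the method is the trapezoidal method. The equation defining the method is implicit in $y_1$; for small $h$, $\Psi_h$ is its solution with $y_1=y_0+O(h)$. The method has order $p=2s$. Conjugate-symplecticity up to order $p+r$: a one-step method $y_1=\Phi_h(y_0)$ of order $p$ is conjugate-symplectic up to order $p+r$, with $r\ge 0$, if there is a global change of coordinates $\chi_h(y)=y+O(h^p)$ such that $\Phi_h=\chi_h\circ\widehat\Psi_h\circ\chi_h^{-1}$, where the map $\widehat\Psi_h$ satisfies $\widehat\Psi_h'(y)^\top J\,\widehat\Psi_h'(y)=J+O(h^{p+r+1})$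 (prime denotes the Jacobian with respect to $y$). Here $p=2s$ and $r=2$. $B$-series: a map $\Phi_h$ associated with $y'=f(y)$ admits a $B$-series expansion if its formal expansion in powers of $h$ has the form $\Phi_h(y)=a(\emptyset)\,y+\sum_{\tau}\frac{h^{|\tau|}}{\sigma(\tau)}a(\tau)F(\tau)(y)$, where $\tau$ ranges over the rooted trees, $|\tau|$ is the number of vertices, $\sigma(\tau)$ the symmetry coefficient, $F(\tau)$ the elementary differential of $f$ associated with $\tau$, and the real coefficients $a(\emptyset), a(\tau)$ do not depend on $f$. *)

(* Defs.v *)
From HB Require Import structures.
From mathcomp Require Import all_boot all_order all_algebra.
From mathcomp Require Import all_classical all_reals all_analysis.

Set Implicit Arguments.
Unset Strict Implicit.
Unset Printing Implicit Defensive.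

Import Order.TTheory GRing.Theory Num.Theory.
Import numFieldNormedType.Exports.

Local Open Scope classical_set_scope.
Local Open Scope ring_scope.

(** * Bernoulli numbers *)

(* [:: B_0; ...; B_n]; the recursion is the coefficient of z^n in
   ((e^z - 1) / z) * (\sum_k B_k z^k / k!) = 1, see [bernoulli_gen]. *)
Fixpoint bernoulli_tab (n : nat) : seq rat :=
  if n is n'.+1 then
    let t := bernoulli_tab n' in
    rcons t (- (n`!)%:R * \sum_(j < n) t`_j / (j`!)%:R / ((n.+1 - j)`!)%:R)
  else [:: 1].

Definition bernoulli (n : nat) : rat := (bernoulli_tab n)`_n.

Lemma size_bernoulli_tab n : size (bernoulli_tab n) = n.+1.
Proof. by elim: n => //= n IHn; rewrite size_rcons IHn. Qed.

Lemma nth_bernoulli_tab n j : (j <= n)%N -> (bernoulli_tab n)`_j = bernoulli j.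
Proof.
elim: n => [|n IHn]; first by rewrite leqn0 => /eqP ->.
rewrite leq_eqVlt => /predU1P[-> //|]; rewrite ltnS => le_jn.
by rewrite /= nth_rcons size_bernoulli_tab ltnS le_jn IHn.
Qed.

(* z / (e^z - 1) = \sum_k B_k z^k / k! *)
Lemma bernoulli_gen n :
  \sum_(j < n.+1) bernoulli j / (j`!)%:R / ((n.+1 - j)`!)%:R = (n == 0%N)%:R.
Proof.
have fn0 k : (k`!)%:R != 0 :> rat by rewrite pnatr_eq0 -lt0n fact_gt0.
case: n => [|n]; first by rewrite big_ord1 /bernoulli /= !divr1.
rewrite big_ord_recr /= subSnn divr1 {2}/bernoulli /= nth_rcons.
rewrite size_bernoulli_tab ltnn eqxx mulrAC mulNr divff // mulN1r.
apply/eqP; rewrite subr_eq0; apply/eqP/eq_bigr => j _.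
by rewrite nth_bernoulli_tab // -ltnS.
Qed.

(** * Rooted trees *)

(* A plane tree, given by the list of the subtrees of its root. *)
Inductive ptree : Type := PNode of seq ptree.

Definition children (t : ptree) : seq ptree := let: PNode ts := t in ts.

Fixpoint ptree_encode (t : ptree) : GenTree.tree void :=
  let: PNode ts := t in GenTree.Node 0 (map ptree_encode ts).

Fixpoint ptree_decode (t : GenTree.tree void) : ptree :=
  if t is GenTree.Node _ ts then PNode (map ptree_decode ts) else PNode [::].

Lemma ptree_encodeK : cancel ptree_encode ptree_decode.
Proof.
rewrite /cancel; fix IH 1 => -[ts] /=; congr PNode.
by elim: ts => //= t ts ->; rewrite IH.
Qed.

HB.instance Definition _ := Countable.copy ptree (can_type ptree_encodeK).

(* |t| *)
Fixpoint tree_order (t : ptree) : nat :=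
  let: PNode ts := t in (sumn (map tree_order ts)).+1.

(* A rooted tree is a plane tree up to reordering of the subtrees of each
   vertex; it is represented by its unique plane tree in which all these lists
   of subtrees are sorted (for the total order induced by [pickle]). *)
Fixpoint is_rooted (t : ptree) : bool :=
  let: PNode ts := t in
  sorted (fun u v => pickle u <= pickle v)%N ts && all is_rooted ts.

(* The symmetry coefficient of a rooted tree: two subtrees of the same vertex
   are isomorphic iff their sorted representatives are equal. *)
Fixpoint symmetry (t : ptree) : nat :=
  let: PNode ts := t in
  ((\prod_(u <- undup ts) (count_mem u ts)`!) *
   foldr (fun u n => symmetry u * n) 1 ts)%N.

(* The plane forests with n vertices, when n <= fuel. *)
Fixpoint forests (fuel n : nat) : seq (seq ptree) :=
  match n, fuel with
  | 0, _ => [:: [::]]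
  | _.+1, 0 => [::]
  | n'.+1, fuel'.+1 =>
      flatten [seq [seq PNode ts :: us | ts <- forests fuel' i,
                                         us <- forests fuel' (n' - i)]
              | i <- iota 0 n'.+1]
  end.

Definition rooted_trees (n : nat) : seq ptree :=
  if n is n'.+1 then [seq t <- map PNode (forests n' n') | is_rooted t]
  else [::].

Lemma forestsS k n :
  forests k.+1 n.+1 =
  flatten [seq [seq PNode ts :: us | ts <- forests k i, us <- forests k (n - i)]
          | i <- iota 0 n.+1].
Proof. by []. Qed.

Lemma forests_order k n ts :
  ts \in forests k n -> sumn (map tree_order ts) = n.
Proof.
elim: k n ts => [|k IHk] [|n] ts; try by case: ts.
rewrite forestsS => /flatten_mapP[i]; rewrite mem_iota add0n ltnS => /= le_in.
move=> /allpairsP[[us vs] /= [/IHk us_i /IHk vs_i ->]] /=.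
by rewrite us_i vs_i addSn subnKC.
Qed.

Lemma mem_forests k n ts :
  (n <= k)%N -> (ts \in forests k n) = (sumn (map tree_order ts) == n).
Proof.
move=> le_nk; apply/idP/eqP => [/forests_order //|].
elim: k n ts le_nk => [|k IHk] [|n] [|[us] vs] // le_nk [def_n].
have le_un : (sumn (map tree_order us) <= n)%N by rewrite -def_n leq_addr.
rewrite forestsS; apply/flatten_mapP.
exists (sumn (map tree_order us)); first by rewrite mem_iota add0n ltnS.
apply/allpairsP; exists (us, vs); split=> //=; apply: IHk => //.
- exact: leq_trans le_un le_nk.
- exact: leq_trans (leq_subr _ n) le_nk.
- by rewrite -def_n addKn.
Qed.

Lemma uniq_forests k n : uniq (forests k n).
Proof.
elim: k n => [|k IHk] [|n] //; rewrite forestsS.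
elim: iota (iota_uniq 0 n.+1) => //=.
move=> i l IHl /andP[il ul]; rewrite cat_uniq IHl // andbT; apply/andP; split.
  by apply: allpairs_uniq => // -[? ?] [? ?] _ _ /= [-> ->].
apply/hasPn => ts /flatten_mapP[j jl] /allpairsP[[us vs] /= [us_j _ ->]].
apply/negP => /allpairsP[[us' vs'] /= [us_i _ [eq_us _]]].
by case/negP: il; rewrite -(forests_order us_i) -eq_us (forests_order us_j).
Qed.

(* [rooted_trees n] lists the rooted trees with n vertices, without repetition. *)
Lemma mem_rooted_trees n t :
  (t \in rooted_trees n) = is_rooted t && (tree_order t == n).
Proof.
case: n t => [|n] [ts]; first by rewrite in_nil andbF.
by rewrite mem_filter mem_map ?mem_forests // => ? ? [].
Qed.

Lemma uniq_rooted_trees n : uniq (rooted_trees n).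
Proof.
case: n => // n; rewrite filter_uniq // map_inj_uniq ?uniq_forests //.
by move=> ? ? [].
Qed.

(** * Calculus in R^d *)

Section Calculus.
Context {R : realType}.

(* C^k and C^oo functions between finite-dimensional spaces. *)
Fixpoint Ck {V W : normedModType R} (k : nat) (f : V -> W) : Prop :=
  if k is k'.+1 then
    (forall x, differentiable f x) /\ forall v, Ck k' (fun x => 'D_v f x)
  else continuous f.

Definition smooth {V W : normedModType R} (f : V -> W) : Prop :=
  forall k, Ck k f.

(* The Jacobian matrix acting on column vectors; the library's [jacobian] is
   the transposed one, acting on row vectors. *)
Definition jac {n m : nat} (F : 'cV[R]_n -> 'cV[R]_m) (y : 'cV[R]_n) :
    'M[R]_(m, n) :=
  \matrix_(i, j) ('D_(delta_mx j 0) F y) i 0.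

Lemma mul_jac n m (F : 'cV[R]_n -> 'cV[R]_m) (y v : 'cV[R]_n) :
  differentiable F y -> jac F y *m v = 'd F y v.
Proof.
move=> dF; rewrite [in RHS](matrix_sum_delta v) linear_sum; apply/colP => i.
rewrite !mxE summxE; apply: eq_bigr => j _.
by rewrite big_ord1 linearZ !mxE -deriveE // mulrC.
Qed.

Definition gradient {n : nat} (H : 'cV[R]_n -> R) (y : 'cV[R]_n) : 'cV[R]_n :=
  \col_i 'D_(delta_mx i 0) H y.

Section AsymptoticsInStepsize.
Context {d : nat}.

(* All the estimates in powers of h are, for h -> 0, locally uniform in y. *)
Definition for_small_h (P : R -> 'cV[R]_d -> Prop) : Prop :=
  forall r : R, \forall h \near (0 : R), forall y, `|y| <= r -> P h y.

(* E h y = O(h^p) *)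
Definition is_bigO {V : normedModType R} (E : R -> 'cV[R]_d -> V) (p : nat) :
    Prop :=
  forall r : R, exists C : R, \forall h \near (0 : R),
    forall y, `|y| <= r -> `|E h y| <= C * `|h| ^+ p.

End AsymptoticsInStepsize.

(** * B-series *)

Section BSeries.
Context {d : nat}.
Implicit Types f : 'cV[R]_d -> 'cV[R]_d.

(* f^(k)(y)(v_1, ..., v_k) for vs = [:: v_1; ...; v_k] *)
Fixpoint multi_derive f (vs : seq 'cV[R]_d) : 'cV[R]_d -> 'cV[R]_d :=
  if vs is v :: vs' then fun y => 'D_v (multi_derive f vs') y else f.

(* F(t)(y) = f^(k)(y)(F(t_1)(y), ..., F(t_k)(y)) when t_1, ..., t_k are the
   subtrees of the root of t. *)
Fixpoint elementary_differential f (t : ptree) (y : 'cV[R]_d) : 'cV[R]_d :=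
  let: PNode ts := t in
  multi_derive f [seq elementary_differential f u y | u <- ts] y.

(* The expansion of Phi h y in powers of h, as h -> 0, is
   a(empty) y + \sum_t h^|t| / sigma(t) a(t) F(t)(y). *)
Definition is_Bseries f (Phi : R -> 'cV[R]_d -> 'cV[R]_d)
    (a_empty : R) (a : ptree -> R) : Prop :=
  forall N : nat, is_bigO (fun h y =>
    Phi h y - (a_empty *: y +
      \sum_(1 <= n < N.+1) \sum_(t <- rooted_trees n)
        (h ^+ n / (symmetry t)%:R * a t) *: elementary_differential f t y))
    N.+1.

End BSeries.

(** * The Euler-Maclaurin method *)

Fixpoint lie_derivative {d : nat} (f : 'cV[R]_d -> 'cV[R]_d) (j : nat) :
    'cV[R]_d -> 'cV[R]_d :=
  if j is j'.+1 then fun z => jac (lie_derivative f j') z *m f z else f.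

Definition EulerMaclaurin_eq {d : nat} (s : nat) (f : 'cV[R]_d -> 'cV[R]_d)
    (h : R) (y0 y1 : 'cV[R]_d) : Prop :=
  y1 = y0 + (h / 2) *: (f y1 + f y0)
     - \sum_(1 <= k < s)
         (h ^+ (2 * k) * ratr (bernoulli (2 * k)) / ((2 * k)`!)%:R) *:
         (lie_derivative f (2 * k - 1) y1 - lie_derivative f (2 * k - 1) y0).

(* The equation being implicit, the method only determines Psi h y for h small
   (locally uniformly in y), as the solution close to y; for the other values
   of h the total function Psi is arbitrary. *)
Definition is_EulerMaclaurin {d : nat} (s : nat) (f : 'cV[R]_d -> 'cV[R]_d)
    (Psi : R -> 'cV[R]_d -> 'cV[R]_d) : Prop :=
  for_small_h (fun h y => EulerMaclaurin_eq s f h y (Psi h y)) /\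
  is_bigO (fun h y => Psi h y - y) 1.

(** * Hamiltonian systems and conjugate-symplecticity *)

Definition Jmx (m : nat) : 'M[R]_(m + m) := block_mx 0 1%:M (- 1%:M) 0.

Definition hamiltonian_field {m : nat} (H : 'cV[R]_(m + m) -> R)
    (y : 'cV[R]_(m + m)) : 'cV[R]_(m + m) :=
  Jmx m *m gradient H y.

Definition diffeomorphism {n : nat} (chi chi' : 'cV[R]_n -> 'cV[R]_n) : Prop :=
  [/\ cancel chi chi', cancel chi' chi, smooth chi & smooth chi'].

(* For a map Psi of order p: conjugate-symplecticity up to order q = p + r. *)
Definition conjugate_symplectic {m : nat} (p q : nat)
    (Psi : R -> 'cV[R]_(m + m) -> 'cV[R]_(m + m)) : Prop :=
  exists chi chi' Psihat : R -> 'cV[R]_(m + m) -> 'cV[R]_(m + m),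
    [/\ forall h, diffeomorphism (chi h) (chi' h),
        is_bigO (fun h y => chi h y - y) p,
        forall h, Psi h = chi h \o Psihat h \o chi' h,
        for_small_h (fun h y => differentiable (Psihat h) y) &
        is_bigO (fun h y =>
          (jac (Psihat h) y)^T *m Jmx m *m jac (Psihat h) y - Jmx m) q.+1].

End Calculus.

(* Main.v *)
Require Import Defs.
From HB Require Import structures.
From mathcomp Require Import all_boot all_order all_algebra.
From mathcomp Require Import all_classical all_reals all_analysis.
From mathcomp Require Import ring lra zify.

Set Implicit Arguments.
Unset Strict Implicit.
Unset Printing Implicit Defensive.

Import Order.TTheory GRing.Theory Num.Theory.
Import numFieldNormedType.Exports.

Local Open Scope classical_set_scope.
Local Open Scope ring_scope.


(** The method is the equation P_h(y1) = P_(-h)(y0), where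
    P_h = \sum_(j < 2 s) B_j / j! h^j D^j id and D is the derivative along f
    ([EulerMaclaurin_hpoly]). For small h, P_h minus the identity is a
    contraction, and so approximate solutions of the equation are close to Psi
    ([implicit_close]). All expansions in h are obtained by constructing
    approximate solutions as compositions of truncated flows, along which functions
    expand in Lie series ([lie_series], [expands_flow]).

    B-series. Flows of vector fields w_K at times h^K are composed, where w_K is
    chosen so as to cancel the term of degree K in the residual ([em_fields]). The
    fields w_K and the coefficients of the resulting expansion of Psi are obtained
    from f by Lie derivatives along fields of the same kind. The derivative of an
    elementary differential along an elementary differential is a sum of elementary
    differentials, with coefficients that do not depend on f ([universal_lie]).

    Conjugate-symplecticity. Let b = B_(2s) / (2s)!. Up to O(h^(2s+3)), Psi is the
    flow of f composed before and after with half a step of the flow of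
    b D^(2s) f at time h^(2s+1) ([strang_residual]). The derivative of Psi
    is the same method for the variational equation A' = f'(y) A
    ([hpoly_tangent], [em_tangent]), and this can be applied to the quadratic form
    Q0 = A^T J A on tangent vectors. For a Hamiltonian f, Q0 is invariant
    under the flow of f. If E is the derivative along b D^(2s) f and B_j the
    j-th time derivative of A, then
    E Q0 = b (B_0^T J B_(2s+1) + B_(2s+1)^T J B_0), and integration by
    parts shows that this is a time derivative D Q1 ([lie_pairing_primitive]).
    Hence Q0 - h^(2s) Q1 is conserved by Psi up to O(h^(2s+3))
    ([almost_conserved]). The form Q1 is built from Y_j'^T J Y_k', where Y_j is
    the j-th time derivative of the solution, and is therefore the curl of a 1-form
    built from Y_j'^T J Y_k; writing this 1-form as J g, one has
    Q1 = A^T (g'^T J + J g') A. Thus Q0 - h^(2s) Q1 is, up to O(h^(4s)), the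
    pull-back of J by chi'_h(y) = y - h^(2s) g(y)
    ([modified_form_conserved]), and chi'_h o Psi_h o chi'_h^-1
    is symplectic up to O(h^(2s+3)).

    The change of coordinates has to be global. The map h^(2s) g is multiplied by a
    smooth cutoff function whose radius grows as h -> 0 so slowly that the product
    remains a contraction ([small_representative]); chi'_h is then a global
    diffeomorphism ([global_inverse]). *)

(** * Differential calculus of smooth maps *)

Section CkCalculus.
Context {R : realType}.

Lemma scaleRE (a b : R) : a *: b = a * b. Proof. by []. Qed.

Section AnyTarget.
Context {V W : normedModType R}.
Implicit Types (f g : V -> W) (k : nat).

Lemma Ck_continuous k f : Ck k f -> continuous f.
Proof.
by case: k => [|k] // [df _] x; apply: differentiable_continuous.
Qed.

Lemma Ck_pred k f : Ck k.+1 f -> Ck k f.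
Proof.
elim: k f => [|k IHk] f; first exact: Ck_continuous.
by move=> [df Df]; split=> // v; apply: IHk.
Qed.

Lemma smooth_differentiable f x : smooth f -> differentiable f x.
Proof. by move=> /(_ 1)[]. Qed.

Lemma smooth_continuous f : smooth f -> continuous f.
Proof. by move=> /(_ 0). Qed.

Lemma smooth_derive f v : smooth f -> smooth (fun x => 'D_v f x).
Proof. by move=> sf k; have [_] := sf k.+1; apply. Qed.

Lemma Ck_cst k (w : W) : Ck k (fun _ : V => w).
Proof.
elim: k w => [|k IHk] w; first exact: cst_continuous.
split=> [x|v]; first exact: differentiable_cst.
under eq_fun do rewrite derive_cst; exact: IHk.
Qed.

Lemma CkD k f g : Ck k f -> Ck k g -> Ck k (fun x => f x + g x).
Proof.
elim: k f g => [|k IHk] f g; first by move=> cf cg x; exact: (cvgD (cf x) (cg x)).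
move=> [df Df] [dg Dg]; split=> [x|v]; first exact: differentiableD (df x) (dg x).
rewrite (_ : (fun x => _) = (fun x => 'D_v f x + 'D_v g x)); first exact: IHk (Df v) (Dg v).
by apply: funext => x; rewrite (@deriveD _ _ _ f g) //; apply: diff_derivable.
Qed.

Lemma CkZ k f (c : R) : Ck k f -> Ck k (fun x => c *: f x).
Proof.
elim: k f => [|k IHk] f; first by move=> cf x; exact: (cvgZl_tmp (cf x)).
move=> [df Df]; split=> [x|v]; first by apply: differentiableZ; apply: df.
rewrite (_ : (fun x => _) = (fun x => c *: 'D_v f x)); first exact: IHk (Df v).
by apply: funext => x; rewrite (@deriveZ _ _ _ f) //; apply: diff_derivable.
Qed.

Lemma Ck_sum k (I : Type) (r : seq I) (P : pred I) (F : I -> V -> W) :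
  (forall i, P i -> Ck k (F i)) -> Ck k (fun x => \sum_(i <- r | P i) F i x).
Proof.
move=> CF; elim: r => [|i r IHr].
  by under eq_fun do rewrite big_nil; apply: Ck_cst.
under eq_fun do rewrite big_cons.
by case Pi: (P i) => //; apply: CkD => //; apply: CF.
Qed.

Lemma CkZl k (p : V -> R) (w : W) : Ck k p -> Ck k (fun x => p x *: w).
Proof.
elim: k p => [|k IHk] p; first by move=> cp x; exact: (cvgZr_tmp (cp x)).
move=> [dp Dp]; split=> [x|v]; first exact: differentiableZl.
rewrite (_ : (fun x => _) = (fun x => 'D_v p x *: w)); first exact: IHk (Dp v).
apply: funext => x; rewrite deriveE; last exact: differentiableZl.
by rewrite diffZl // -deriveE.
Qed.

Lemma Ck_linear k (f : {linear V -> W}) : continuous f -> Ck k f.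
Proof.
move=> cf; case: k => [|k] //; split=> [x|v]; first exact: linear_differentiable.
rewrite (_ : (fun x => _) = (fun=> f v)); first exact: Ck_cst.
apply: funext => x; rewrite deriveE; last exact: linear_differentiable.
by rewrite diff_lin.
Qed.

End AnyTarget.

Section ScalarTarget.
Context {V : normedModType R}.
Implicit Types (p q : V -> R).

Lemma CkM k p q : Ck k p -> Ck k q -> Ck k (fun x => p x * q x).
Proof.
elim: k p q => [|k IHk] p q; first by move=> cp cq x; exact: (cvgM (cp x) (cq x)).
move=> Cp Cq; have [dp Dp] := Cp; have [dq Dq] := Cq.
split=> [x|v]; first exact: differentiableM (dp x) (dq x).
rewrite (_ : (fun x => _) = (fun x => p x * 'D_v q x + q x * 'D_v p x)).
  exact: CkD (IHk _ _ (Ck_pred Cp) (Dq v)) (IHk _ _ (Ck_pred Cq) (Dp v)).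
by apply: funext => x; rewrite (@deriveM _ _ p q) //; apply: diff_derivable.
Qed.

Lemma Ck_prod k (I : Type) (r : seq I) (P : pred I) (F : I -> V -> R) :
  (forall i, P i -> Ck k (F i)) -> Ck k (fun x => \prod_(i <- r | P i) F i x).
Proof.
move=> CF; elim: r => [|i r IHr].
  by under eq_fun do rewrite big_nil; apply: Ck_cst.
under eq_fun do rewrite big_cons.
by case Pi: (P i) => //; apply: CkM => //; apply: CF.
Qed.

Lemma CkV k p : (forall x, p x != 0) -> Ck k p -> Ck k (fun x => (p x)^-1).
Proof.
move=> p0; elim: k => [|k IHk]; first by move=> cp x; apply: (cvgV (p0 x) (cp x)).
move=> Cp; have [dp Dp] := Cp.
split=> [x|v]; first exact: differentiableV (dp x) (p0 x).
have Cpi := IHk (Ck_pred Cp).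
rewrite (_ : (fun x => _) = (fun x => -1 * ((p x)^-1 * (p x)^-1 * 'D_v p x))).
  exact: CkM (Ck_cst _ _) (CkM (CkM Cpi Cpi) (Dp v)).
apply: funext => x; rewrite (@deriveV _ _ p) //; last exact: diff_derivable.
by rewrite scaleRE -exprVn mulN1r mulNr expr2.
Qed.

Lemma Ck_comp1 k (b : R -> R) p : Ck k b -> Ck k p -> Ck k (fun x => b (p x)).
Proof.
elim: k b => [|k IHk] b; first by move=> cb cp x; apply: continuous_comp (cp x) (cb (p x)).
move=> Cb Cp; have [db Db] := Cb; have [dp Dp] := Cp.
split=> [x|v]; first by apply: differentiable_comp.
have E : (fun x => 'D_v (fun x => b (p x)) x) = (fun x => 'D_1 b (p x) * 'D_v p x).
  apply: funext => x; rewrite deriveE; last exact: differentiable_comp.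
  rewrite (@diff_comp _ _ _ _ p b) //= (deriveE v (dp x)) (@deriveE _ R R b (p x) 1 (db (p x))).
  by rewrite -[X in 'd b _ X = _]mulr1 -scaleRE linearZ /= scaleRE mulrC.
by rewrite E; apply: CkM (Dp v); apply: IHk (Db 1) (Ck_pred Cp).
Qed.

End ScalarTarget.

Section MatrixTarget.
Context {V : normedModType R} {m n : nat}.
Implicit Types (f g : V -> 'M[R]_(m, n)).

Lemma differentiable_mxP f x :
  differentiable f x <-> (forall i j, differentiable (fun y => f y i j) x).
Proof.
split=> [df i j|df].
  apply: (@differentiable_comp _ _ _ _ f (fun M : 'M[R]_(m, n) => M i j)) => //.
  exact: differentiable_coord.
have -> : f = (fun y => \sum_i (\sum_j f y i j *: delta_mx i j)).
  by apply: funext => y; rewrite {1}(matrix_sum_delta (f y)).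
rewrite (_ : (fun y => _) = \sum_i (fun y => \sum_j f y i j *: delta_mx i j)).
  apply: differentiable_sum => i.
  rewrite (_ : (fun y => _) = \sum_j (fun y => f y i j *: delta_mx i j)).
    by apply: differentiable_sum => j; apply: differentiableZl.
  by apply: funext => y; rewrite fct_sumE.
by apply: funext => y; rewrite fct_sumE.
Qed.

Lemma derive_coord f x v i j : differentiable f x ->
  ('D_v f x) i j = 'D_v (fun y => f y i j) x.
Proof. by move=> df; rewrite derive_mx ?mxE//; apply: diff_derivable. Qed.

Lemma Ck_mxP k f : Ck k f <-> (forall i j, Ck k (fun y => f y i j)).
Proof.
elim: k f => [|k IHk] f.
  split=> [cf i j x|cf].
    apply: (@continuous_comp _ _ _ f (fun M : 'M[R]_(m, n) => M i j) x (cf x)).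
    exact: coord_continuous.
  have -> : f = (fun y => \sum_i (\sum_j f y i j *: delta_mx i j)).
    by apply: funext => y; rewrite {1}(matrix_sum_delta (f y)).
  apply: (@Ck_sum V 'M[R]_(m, n) 0%N _ _ _ (fun i y => \sum_j f y i j *: delta_mx i j)) => i _; apply: (@Ck_sum V 'M[R]_(m, n) 0%N) => j _.
  exact: (@CkZl V 'M[R]_(m, n) 0%N _ _ (cf i j)).
split=> [[df Df] i j|Cf].
  split=> [x|v]; first by have /differentiable_mxP := df x.
  by under eq_fun do rewrite -derive_coord //; have /IHk := Df v.
have df x : differentiable f x.
  by apply/differentiable_mxP => i j; have [] := Cf i j.
split=> // v; apply/IHk => i j; under eq_fun do rewrite derive_coord //.
by have [_ /(_ v)] := Cf i j.
Qed.

End MatrixTarget.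

Lemma Ck_mulmx k (V : normedModType R) m n l (f : V -> 'M[R]_(m, n))
    (g : V -> 'M[R]_(n, l)) :
  Ck k f -> Ck k g -> Ck k (fun x => f x *m g x).
Proof.
move=> /Ck_mxP Cf /Ck_mxP Cg; apply/Ck_mxP => i j.
under eq_fun do rewrite mxE; apply: Ck_sum => a _; exact: CkM.
Qed.

Lemma differentiable_mulmx (V : normedModType R) m n l (f : V -> 'M[R]_(m, n))
    (g : V -> 'M[R]_(n, l)) x : differentiable f x -> differentiable g x ->
  differentiable (fun x => f x *m g x) x.
Proof.
move=> /differentiable_mxP df /differentiable_mxP dg; apply/differentiable_mxP => i j.
under eq_fun do rewrite mxE.
rewrite (_ : (fun y => _) = \sum_a (fun y => f y i a * g y a j)).
  by apply: differentiable_sum => a; apply: differentiableM.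
by apply: funext => y; rewrite fct_sumE.
Qed.

Lemma derive_mulmx (V : normedModType R) m n l (f : V -> 'M[R]_(m, n))
    (g : V -> 'M[R]_(n, l)) x v : differentiable f x -> differentiable g x ->
  'D_v (fun x => f x *m g x) x = 'D_v f x *m g x + f x *m 'D_v g x.
Proof.
move=> df dg; have dfij i j : differentiable (fun y => f y i j) x.
  by have /differentiable_mxP := df.
have dgij i j : differentiable (fun y => g y i j) x.
  by have /differentiable_mxP := dg.
apply/matrixP => i j; rewrite derive_coord ?mxE; last exact: differentiable_mulmx.
under eq_fun do rewrite mxE.
rewrite (_ : (fun y => _) = \sum_a (fun y => f y i a * g y a j)); last first.
  by apply: funext => y; rewrite fct_sumE.
rewrite derive_sum => [|a]; last exact/diff_derivable/differentiableM.
rewrite -big_split /=; apply: eq_bigr => a _.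
rewrite (@deriveM _ _ (fun y => f y i a) (fun y => g y a j)); try exact: diff_derivable.
by rewrite !derive_coord // !scaleRE [LHS]addrC; congr (_ + _); exact: mulrC.
Qed.

Lemma Ck_trmx k (V : normedModType R) m n (f : V -> 'M[R]_(m, n)) :
  Ck k f -> Ck k (fun x => (f x)^T).
Proof.
by move=> /Ck_mxP Cf; apply/Ck_mxP => i j; under eq_fun do rewrite mxE.
Qed.

Lemma derive_trmx (V : normedModType R) m n (f : V -> 'M[R]_(m, n)) x v :
  differentiable f x -> 'D_v (fun x => (f x)^T) x = ('D_v f x)^T.
Proof.
move=> df; have dT : differentiable (fun x => (f x)^T) x.
  apply/differentiable_mxP => i j; under eq_fun do rewrite mxE.
  by have /differentiable_mxP := df.
apply/matrixP => i j; rewrite derive_coord // mxE derive_coord //.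
by under eq_fun do rewrite mxE.
Qed.

Lemma Ck_scale k (V : normedModType R) m n (p : V -> R) (f : V -> 'M[R]_(m, n)) :
  Ck k p -> Ck k f -> Ck k (fun x => p x *: f x).
Proof.
move=> Cp /Ck_mxP Cf; apply/Ck_mxP => i j.
by under eq_fun do rewrite mxE; apply: CkM.
Qed.

Lemma Ck_det k (V : normedModType R) n (f : V -> 'M[R]_n) :
  Ck k f -> Ck k (fun x => \det (f x)).
Proof.
move=> /Ck_mxP Cf; apply: Ck_sum => s _; apply: CkM (Ck_cst _ _) _.
by apply: Ck_prod.
Qed.

Lemma Ck_invmx k (V : normedModType R) n (f : V -> 'M[R]_n) :
  (forall x, f x \in unitmx) -> Ck k f -> Ck k (fun x => invmx (f x)).
Proof.
move=> uf Cf.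
have -> : (fun x => invmx (f x)) = (fun x => (\det (f x))^-1 *: \adj (f x)).
  by apply: funext => x; rewrite /invmx uf.
apply: Ck_scale; first by apply: CkV; [move=> x; rewrite -unitfE -unitmxE|exact: Ck_det].
apply/Ck_mxP => i j; under eq_fun do rewrite mxE /cofactor.
apply: CkM (Ck_cst _ _) _; apply: Ck_det; apply/Ck_mxP => a b.
by under eq_fun do rewrite !mxE; move: Cf => /Ck_mxP.
Qed.

Section MatrixSource.
Context {m n : nat} {W : normedModType R}.
Implicit Types (x v : 'M[R]_(m, n)) (g : 'M[R]_(m, n) -> W).

Lemma derive_sum_delta g x v : differentiable g x ->
  'D_v g x = \sum_i \sum_j v i j *: 'D_(delta_mx i j) g x.
Proof.
move=> dg; rewrite deriveE // {1}(matrix_sum_delta v) linear_sum.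
apply: eq_bigr => i _; rewrite linear_sum; apply: eq_bigr => j _.
by rewrite linearZ /= -deriveE.
Qed.

Lemma deriveZr g x c v : differentiable g x -> 'D_(c *: v) g x = c *: 'D_v g x.
Proof. by move=> dg; rewrite !deriveE // linearZ. Qed.

Lemma derive_sumr g x (I : Type) (r : seq I) (P : pred I) (v : I -> 'M[R]_(m, n)) :
  differentiable g x ->
  'D_(\sum_(i <- r | P i) v i) g x = \sum_(i <- r | P i) 'D_(v i) g x.
Proof.
move=> dg; rewrite deriveE // linear_sum; apply: eq_bigr => i _.
by rewrite deriveE.
Qed.

End MatrixSource.

Lemma Ck_comp k (V : normedModType R) m n m' n' (f : V -> 'M[R]_(m, n))
    (g : 'M[R]_(m, n) -> 'M[R]_(m', n')) :
  Ck k f -> Ck k g -> Ck k (fun x => g (f x)).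
Proof.
elim: k g => [|k IHk] g; first by move=> cf cg x; apply: continuous_comp (cf x) (cg (f x)).
move=> Cf Cg; have [df Df] := Cf; have [dg Dg] := Cg.
split=> [x|v]; first by apply: differentiable_comp.
rewrite (_ : (fun x => _) = (fun x =>
    \sum_i \sum_j ('D_v f x) i j *: 'D_(delta_mx i j) g (f x))); last first.
  apply: funext => x; rewrite deriveE; last exact: differentiable_comp.
  by rewrite (@diff_comp _ _ _ _ f g) //= -!deriveE // derive_sum_delta.
apply: Ck_sum => i _; apply: Ck_sum => j _; apply: Ck_scale.
  by have /Ck_mxP := Df v.
exact: IHk (Ck_pred Cf) (Dg _).
Qed.

End CkCalculus.

(** * Mean value inequalities, local bounds and the symmetry of second derivatives *)

Section MeanValue.
Context {R : realType}.

Lemma coord_le_norm m n (A : 'M[R]_(m, n)) i j : `|A i j| <= `|A|.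
Proof.
rewrite [leRHS]/Num.Def.normr /= mx_normrE.
exact: (le_bigmax _ (fun ij : 'I_m * 'I_n => `|A ij.1 ij.2|) (i, j)).
Qed.

Lemma norm_le_coord m n (A : 'M[R]_(m, n)) (C : R) :
  0 <= C -> (forall i j, `|A i j| <= C) -> `|A| <= C.
Proof.
move=> C0 AC; rewrite [leLHS]/Num.Def.normr /= mx_normrE.
by apply: bigmax_le => // -[i j] _; apply: AC.
Qed.

Lemma norm_mulmx m n p (A : 'M[R]_(m, n)) (B : 'M[R]_(n, p)) :
  `|A *m B| <= n%:R * `|A| * `|B|.
Proof.
apply: norm_le_coord => [|i j]; first by rewrite !mulr_ge0.
rewrite mxE (le_trans (ler_norm_sum _ _ _)) //.
apply: (@le_trans _ _ (\sum_(k < n) `|A| * `|B|)).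
  by apply: ler_sum => k _; rewrite normrM ler_pM ?coord_le_norm.
by rewrite sumr_const card_ord -[(_ * _) *+ n]mulr_natl mulrA.
Qed.

Lemma norm_trmx m n (A : 'M[R]_(m, n)) : `|A^T| = `|A|.
Proof.
have le p q (B : 'M[R]_(p, q)) : `|B^T| <= `|B|.
  by apply: norm_le_coord => // i j; rewrite mxE coord_le_norm.
by apply/eqP; rewrite eq_le le -{1}[A]trmxK le.
Qed.

(** Transported from row vectors along [vec_mx]. *)
Lemma closed_ball_compact m n (r : R) : compact [set x : 'M[R]_(m, n) | `|x| <= r].
Proof.
have cvec : continuous (@vec_mx R m n).
  apply: (@Ck_continuous R _ _ 0); apply/Ck_mxP => i j x.
  under eq_fun do rewrite mxE.
  exact: coord_continuous.
have -> : [set x : 'M[R]_(m, n) | `|x| <= r] = vec_mx @` [set x | `|x| <= r].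
  apply/seteqP; split=> [x /= xr|_ [x /= xr <-]].
    exists (mxvec x); last exact: mxvecK.
    apply: le_trans xr; apply: norm_le_coord => // i j.
    rewrite ord1; case/mxvec_indexP: j => a b; rewrite mxvecE; exact: coord_le_norm.
  apply: le_trans xr; apply: norm_le_coord => // i j.
  rewrite mxE; exact: coord_le_norm.
apply: continuous_compact; first exact: continuous_subspaceT.
apply: bounded_closed_compact.
  by exists r; split; [exact: num_real|move=> M /ltW rM x /= /le_trans ->].
apply: (@preimage_closed _ _ (fun x : 'rV[R]_(m * n) => `|x|) _ _ (@closed_le R r)).
by move=> x _; apply: norm_continuous.
Qed.

Lemma continuous_locally_bounded m n (W : normedModType R) (g : 'M[R]_(m, n) -> W) (r : R) :
  continuous g -> exists2 C, 0 < C & forall x, `|x| <= r -> `|g x| <= C.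
Proof.
move=> cg; have := @closed_ball_compact m n r.
move=> /(continuous_compact (continuous_subspaceT cg)) /compact_bounded [M [_ gM]].
exists (`|M| + 1) => [|x xr]; first exact: ltr_wpDl.
by apply: (gM (`|M| + 1)); [rewrite ltr_pwDr // ler_norm|exists x].
Qed.

Section Line.
Context {V W : normedModType R}.

Lemma is_derive_line (g : V -> W) a v (s : R) : differentiable g (a + s *: v) ->
  is_derive s 1 (fun t : R => g (a + t *: v)) ('D_v g (a + s *: v)).
Proof.
move=> dg.
have da : is_diff s (fun t : R => a + t *: v) (fun t : R => t *: v).
  have := @is_diffD R R V (cst a) ( *:%R ^~ v) 0 ( *:%R ^~ v) s
    (is_diff_cst a s) (is_diff_scalel s v).
  by rewrite add0r.
have dga : differentiable (g \o (fun t : R => a + t *: v)) s.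
  by apply: differentiable_comp.
apply: DeriveDef; first exact: diff_derivable.
rewrite deriveE // diff_comp //= diff_val.
by rewrite deriveE // scale1r.
Qed.

End Line.

Lemma is_derive_mxP m n (g : R -> 'M[R]_(m, n)) (s : R) (dg : 'M[R]_(m, n)) :
  is_derive s 1 g dg <-> (forall i j, is_derive s 1 (fun t => g t i j) (dg i j)).
Proof.
split=> [[dgs <-] i j|dgs].
  have dd := iffLR (derivable_mxP _ _ _) dgs.
  by apply: DeriveDef; rewrite ?derive_mx ?mxE.
have dd : derivable g s 1 by apply/derivable_mxP => i j; have [] := dgs i j.
apply: DeriveDef => //; rewrite derive_mx //; apply/matrixP => i j.
by rewrite mxE; have [] := dgs i j.
Qed.

Lemma mean_value_bound_real (phi dphi : R -> R) (t C : R) :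
  (forall s : R, `|s| <= `|t| -> is_derive s 1 phi (dphi s)) ->
  (forall s : R, `|s| <= `|t| -> `|dphi s| <= C) ->
  `|phi t - phi 0| <= C * `|t|.
Proof.
move=> dp pC; have cp s : `|s| <= `|t| -> {for s, continuous phi}.
  by move=> /dp[+ _] => /derivable1_diffP /differentiable_continuous.
have [t0|t0] := leP 0 t.
  have inb s : s \in `[0, t] -> `|s| <= `|t|.
    by rewrite in_itv /= => /andP[s0 st]; rewrite !ger0_norm.
  have [||c /inb ct] := @MVT_segment R phi dphi 0 t t0.
    by move=> s st; apply/dp/inb/subset_itv_oo_cc.
    by apply: continuous_in_subspaceT => s; rewrite inE => /inb /cp.
  by rewrite subr0 => ->; rewrite normrM ler_wpM2r ?pC.
have inb s : s \in `[t, 0] -> `|s| <= `|t|.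
  by rewrite in_itv /= => /andP[st s0]; rewrite (ler0_norm s0) (ler0_norm (ltW t0)) lerN2.
have [||c /inb ct] := @MVT_segment R phi dphi t 0 (ltW t0).
  by move=> s st; apply/dp/inb/subset_itv_oo_cc.
  by apply: continuous_in_subspaceT => s; rewrite inE => /inb /cp.
by rewrite sub0r distrC => ->; rewrite normrM normrN ler_wpM2r ?pC.
Qed.

Lemma mean_value_bound m n (phi dphi : R -> 'M[R]_(m, n)) (t C : R) :
  (forall s : R, `|s| <= `|t| -> is_derive s 1 phi (dphi s)) ->
  (forall s : R, `|s| <= `|t| -> `|dphi s| <= C) ->
  `|phi t - phi 0| <= C * `|t|.
Proof.
move=> dp pC; have C0 : 0 <= C.
  by apply: le_trans (pC 0 _); rewrite ?normr0.
apply: norm_le_coord => [|i j]; first exact: mulr_ge0.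
rewrite !mxE; apply: (@mean_value_bound_real (fun s => phi s i j) (fun s => dphi s i j)) => s st.
  by move/is_derive_mxP: (dp s st).
exact: le_trans (coord_le_norm _ _ _) (pC s st).
Qed.

Lemma mean_value_segment m n (V : normedModType R) (g : V -> 'M[R]_(m, n)) x y (C : R) :
  (forall z, differentiable g z) ->
  (forall t : R, 0 <= t <= 1 -> `|'D_(x - y) g (y + t *: (x - y))| <= C) ->
  `|g x - g y| <= C.
Proof.
move=> dg gC.
have C0 : 0 <= C by apply: le_trans (gC 0 _); rewrite ?lexx ?ler01.
apply: norm_le_coord => [|i j] //; rewrite !mxE.
have dphi (s : R) : is_derive s 1 (fun t : R => g (y + t *: (x - y)) i j)
    ('D_(x - y) g (y + s *: (x - y)) i j).
  move: i j; apply/is_derive_mxP; exact: is_derive_line.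
have [|c /[!in_itv]/= c01] := @MVT_segment R (fun t => g (y + t *: (x - y)) i j)
  (fun s => 'D_(x - y) g (y + s *: (x - y)) i j) 0 1 ler01.
  apply: continuous_subspaceT => s; have [+ _] := dphi s.
  by move=> /derivable1_diffP /differentiable_continuous.
rewrite scale1r subrKC scale0r addr0 subr0 mulr1 => ->.
exact: le_trans (coord_le_norm _ _ _) (gC c c01).
Qed.

Section MatrixSource.
Context {m n m' n' : nat}.
Implicit Types (x y v : 'M[R]_(m, n)) (g : 'M[R]_(m, n) -> 'M[R]_(m', n')).

Lemma derive_locally_bounded g (r : R) : Ck 1 g ->
  exists2 C, 0 < C & forall x v, `|x| <= r -> `|'D_v g x| <= C * `|v|.
Proof.
move=> [dg Dg].
have /choice[C CP] ij : exists C, 0 < C /\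
    forall x, `|x| <= r -> `|'D_(delta_mx ij.1 ij.2) g x| <= C.
  by have [C C0 CP] := continuous_locally_bounded r (Dg (delta_mx ij.1 ij.2)); exists C.
exists (\sum_ij C ij + 1) => [|x v xr].
  by rewrite ltr_wpDl // sumr_ge0 // => ij _; have [/ltW] := CP ij.
rewrite derive_sum_delta // pair_bigA /= (le_trans (ler_norm_sum _ _ _)) //.
apply: (@le_trans _ _ (\sum_ij C ij * `|v|)).
  apply: ler_sum => ij _; rewrite normrZ mulrC ler_pM ?coord_le_norm //.
  by have [_] := CP ij; apply.
by rewrite -mulr_suml ler_wpM2r // lerDl.
Qed.

Lemma ball_segment x y (r t : R) : `|x| <= r -> `|y| <= r -> 0 <= t <= 1 ->
  `|y + t *: (x - y)| <= r.
Proof.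
move=> xr yr /andP[t0 t1]; have -> : y + t *: (x - y) = t *: x + (1 - t) *: y.
  by rewrite scalerBr scalerBl scale1r addrCA addrA -addrA.
rewrite (le_trans (ler_normD _ _)) // !normrZ (ger0_norm t0) ger0_norm ?subr_ge0 //.
have := ler_wpM2l t0 xr; have : (1 - t) * `|y| <= (1 - t) * r by rewrite ler_wpM2l ?subr_ge0.
by move=> *; lra.
Qed.

Lemma locally_lipschitz g (r : R) : Ck 1 g ->
  exists2 C, 0 < C & forall x y, `|x| <= r -> `|y| <= r -> `|g x - g y| <= C * `|x - y|.
Proof.
move=> Cg; have [C C0 CP] := derive_locally_bounded r Cg; exists C => // x y xr yr.
apply: mean_value_segment => [|t t01]; first by have [] := Cg.
by apply: CP; apply: ball_segment.
Qed.

End MatrixSource.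

Section Schwarz.
Context {V : normedModType R}.

(** The mean value theorem is applied to the increment of H in the direction v as
    a function of the displacement along u, then to 'D_u H along v. *)
Lemma second_difference (H G : V -> R) x u v (t : R) : 0 < t -> Ck 2 H ->
  (forall z, 'D_v ('D_u H) z = G z) ->
  exists c : R * R, [/\ 0 <= c.1 <= t, 0 <= c.2 <= t &
    H (x + t *: u + t *: v) - H (x + t *: u) - (H (x + t *: v) - H x) =
    G (x + c.1 *: u + c.2 *: v) * t * t].
Proof.
move=> t0 [dH DH] DG; have [dDH _] := DH u.
pose phi (s : R) := H (x + t *: v + s *: u) - H (x + s *: u).
pose dphi (s : R) := 'D_u H (x + t *: v + s *: u) - 'D_u H (x + s *: u).
have ph (s : R) : is_derive s 1 phi (dphi s).
  by apply: is_deriveB; apply: is_derive_line.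
have [|c /[!in_itv]/= ct] := @MVT_segment R phi dphi 0 t (ltW t0).
  apply: continuous_subspaceT => s; have [+ _] := ph s.
  by move=> /derivable1_diffP /differentiable_continuous.
rewrite /phi !scale0r !addr0 subr0 => E1.
pose psi (s : R) := 'D_u H (x + c *: u + s *: v).
pose dpsi (s : R) := G (x + c *: u + s *: v).
have ps (s : R) : is_derive s 1 psi (dpsi s).
  by rewrite /dpsi -DG; apply: is_derive_line.
have [|e /[!in_itv]/= et] := @MVT_segment R psi dpsi 0 t (ltW t0).
  apply: continuous_subspaceT => s; have [+ _] := ps s.
  by move=> /derivable1_diffP /differentiable_continuous.
rewrite /psi !scale0r !addr0 subr0 => E2.
exists (c, e); split=> //=; rewrite -[x + t *: u + t *: v]addrAC E1 /dphi.
by rewrite -E2 [x + t *: v + c *: u]addrAC.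
Qed.

Lemma eq_of_nearby_values (A B : V -> R) x u v :
  {for x, continuous A} -> {for x, continuous B} ->
  (forall t : R, 0 < t -> exists c c' : R * R,
     [/\ 0 <= c.1 <= t, 0 <= c.2 <= t, 0 <= c'.1 <= t, 0 <= c'.2 <= t &
     A (x + c.1 *: u + c.2 *: v) = B (x + c'.1 *: u + c'.2 *: v)]) ->
  A x = B x.
Proof.
move=> cA cB AB; apply/eqP; rewrite -subr_eq0 -normr_le0; apply/ler_addgt0Pl => e e0.
rewrite addr0; have e20 : 0 < e / 2 by rewrite divr_gt0.
move/cvgrPdist_le: cA => /(_ _ e20) /nbhs_normP[d1 /= d10 D1].
move/cvgrPdist_le: cB => /(_ _ e20) /nbhs_normP[d2 /= d20 D2].
pose K := `|u| + `|v| + 1.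
have K0 : 0 < K by rewrite ltr_wpDl // addr_ge0.
pose d := Num.min d1 d2; have d0 : 0 < d by rewrite lt_min d10.
pose t := d / K / 2; have t0 : 0 < t by rewrite !divr_gt0.
have small (c : R * R) : 0 <= c.1 <= t -> 0 <= c.2 <= t ->
    `|x - (x + c.1 *: u + c.2 *: v)| < d.
  move=> /andP[c0 ct] /andP[c0' ct'].
  rewrite -addrA opprD addNKr normrN (le_lt_trans (ler_normD _ _)) // !normrZ !ger0_norm //.
  apply: (@le_lt_trans _ _ (t * K)).
    rewrite /K !mulrDr mulr1.
    have := ler_wpM2r (normr_ge0 u) ct; have := ler_wpM2r (normr_ge0 v) ct'; lra.
  rewrite /t mulrAC divfK ?gt_eqF //; lra.
have [c [c' [c1 c2 c1' c2' E]]] := AB t t0.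
have := small c c1 c2; have := small c' c1' c2'; rewrite !lt_min => /andP[_ s2] /andP[s1 _].
apply: le_trans (ler_distD (A (x + c.1 *: u + c.2 *: v)) _ _) _.
rewrite [leRHS]splitr lerD ?D1 // E distrC; exact: D2.
Qed.

(** The second difference of H at x in the directions u and v is symmetric in u
    and v; divided by t^2, it is a value near x of either mixed derivative. *)
Lemma schwarz_real (H : V -> R) x u v : Ck 2 H ->
  'D_u ('D_v H) x = 'D_v ('D_u H) x.
Proof.
move=> CH; have [dH DH] := CH.
have [A EA] : exists A : V -> R, forall z, 'D_u ('D_v H) z = A z by exists ('D_u ('D_v H)).
have [B EB] : exists B : V -> R, forall z, 'D_v ('D_u H) z = B z by exists ('D_v ('D_u H)).
have cA : continuous A.
  by rewrite -(funext EA); have [_ /(_ u)] := DH v.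
have cB : continuous B.
  by rewrite -(funext EB); have [_ /(_ v)] := DH u.
rewrite EA EB; apply: (eq_of_nearby_values (u := v) (v := u) (cA x) (cB x)) => t t0.
have [c [c1 c2 E]] := @second_difference H B x u v t t0 CH EB.
have [c' [c1' c2' E']] := @second_difference H A x v u t t0 CH EA.
exists c', (c.2, c.1); split=> //=; rewrite (addrAC x (c.2 *: v)).
apply: (mulIf (lt0r_neq0 t0)); apply: (mulIf (lt0r_neq0 t0)).
rewrite -E -E' (addrAC x (t *: u)).
by move: (H (x + t *: v + t *: u)) (H (x + t *: u)) (H (x + t *: v)) (H x) => *; ring.
Qed.

Lemma schwarz m n (g : V -> 'M[R]_(m, n)) x u v : Ck 2 g ->
  'D_u ('D_v g) x = 'D_v ('D_u g) x.
Proof.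
move=> Cg; have [dg Dg] := Cg.
have [du _] := Dg u; have [dv _] := Dg v.
have Cij i j : Ck 2 (fun y => g y i j) by move/Ck_mxP: Cg.
have E w i j : (fun y => ('D_w g y) i j) = 'D_w (fun z => g z i j).
  by apply: funext => y; rewrite (derive_coord w i j (dg y)).
apply/matrixP => i j.
apply: etrans (derive_coord u i j (dv x)) _.
apply: etrans _ (esym (derive_coord v i j (du x))).
by rewrite (E v i j) (E u i j); apply: schwarz_real.
Qed.

End Schwarz.

End MeanValue.

Local Opaque derive.

(** * Locally uniform estimates in the stepsize *)

Section BigO.
Context {R : realType}.

(** [is_bigO] between arbitrary normed spaces: the tangent lift below acts on
    matrices and the quadratic forms take matrix values. *)
Definition bigO {V W : normedModType R} (E : R -> V -> W) (p : nat) : Prop :=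
  forall r : R, exists C : R, \forall h \near (0 : R),
    forall y, `|y| <= r -> `|E h y| <= C * `|h| ^+ p.

Lemma near0P (P : R -> Prop) : (\forall h \near (0 : R), P h) <->
  exists2 d : R, 0 < d & forall h, `|h| < d -> P h.
Proof.
split=> [/nbhs_normP[d /= d0 dP]|[d d0 dP]]; last apply/nbhs_normP; exists d => // h.
  by move=> hd; apply: dP; rewrite /ball_ /= sub0r normrN.
by rewrite /ball_ /= sub0r normrN; apply: dP.
Qed.

Lemma near0W (P : R -> Prop) : (forall h, P h) -> \forall h \near (0 : R), P h.
Proof. by move=> PT; apply/near0P; exists 1. Qed.

Section Basic.
Context {V W : normedModType R}.
Implicit Types (E F : R -> V -> W) (p q : nat).

Lemma near0_le1 : \forall h \near (0 : R), `|h| <= 1.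
Proof.
by apply/near0P; exists 1 => // h /ltW.
Qed.

Lemma bigO_pos E p : bigO E p -> forall r : R, exists2 C : R, 0 < C &
  \forall h \near (0 : R), forall y, `|y| <= r -> `|E h y| <= C * `|h| ^+ p.
Proof.
move=> OE r; have [C CP] := OE r; exists (`|C| + 1); first exact: ltr_wpDl.
apply: filterS CP => h CP y yr; apply: le_trans (CP y yr) _.
by rewrite ler_wpM2r // (le_trans (ler_norm _)) // lerDl.
Qed.

End Basic.

Section Calculus.
Context {V W : normedModType R}.
Implicit Types (E F G : R -> V -> W) (p q k : nat).

Lemma bigO_dominated (V' W' : normedModType R) (F : R -> V' -> W') E p :
  (forall r : R, exists c r' : R, \forall h \near (0 : R), forall y, `|y| <= r ->
     exists y', `|y'| <= r' /\ `|E h y| <= c * `|F h y'|) ->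
  bigO F p -> bigO E p.
Proof.
move=> EF OF r; have [c [r' cP]] := EF r; have [C C0 CP] := bigO_pos OF r'.
exists (`|c| * C); move: cP CP; apply: filterS2 => h cP CP y yr.
have [y' [yr' le]] := cP y yr; apply: le_trans le _.
apply: (@le_trans _ _ (`|c| * `|F h y'|)); first by rewrite ler_wpM2r // ler_norm.
by rewrite -mulrA ler_wpM2l // CP.
Qed.

Lemma bigO_near E F p :
  (forall r : R, \forall h \near (0 : R), forall y, `|y| <= r -> E h y = F h y) ->
  bigO F p -> bigO E p.
Proof.
move=> EF; apply: bigO_dominated => r; exists 1, r.
by apply: filterS (EF r) => h EFh y yr; exists y; split=> //; rewrite mul1r EFh.
Qed.

Lemma eq_bigO E F p : (forall h y, E h y = F h y) -> bigO F p -> bigO E p.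
Proof. by move=> EF; apply: bigO_near => r; apply: near0W => h y _; apply: EF. Qed.

Lemma bigO0 p : bigO (fun (_ : R) (_ : V) => 0 : W) p.
Proof. by move=> r; exists 0; apply: near0W => h y _; rewrite normr0 mul0r. Qed.

Lemma bigOD E F p : bigO E p -> bigO F p -> bigO (fun h y => E h y + F h y) p.
Proof.
move=> OE OF r; have [C CP] := OE r; have [D DP] := OF r.
exists (C + D); move: CP DP; apply: filterS2 => h CP DP y yr.
by rewrite (le_trans (ler_normD _ _)) // mulrDl lerD ?CP ?DP.
Qed.

Lemma bigON E p : bigO E p -> bigO (fun h y => - E h y) p.
Proof.
apply: bigO_dominated => r; exists 1, r; apply: near0W => h y yr.
by exists y; rewrite normrN mul1r.
Qed.

Lemma bigOB E F p : bigO E p -> bigO F p -> bigO (fun h y => E h y - F h y) p.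
Proof. by move=> OE OF; apply: bigOD (bigON OF). Qed.

Lemma bigO_transB F E G p : bigO (fun h y => E h y - F h y) p ->
  bigO (fun h y => F h y - G h y) p -> bigO (fun h y => E h y - G h y) p.
Proof.
by move=> OE OF; apply: eq_bigO (bigOD OE OF) => h y; rewrite subrKA.
Qed.

Lemma bigO_sum (I : Type) (r : seq I) (P : pred I) (E : I -> R -> V -> W) p :
  (forall i, P i -> bigO (E i) p) ->
  bigO (fun h y => \sum_(i <- r | P i) E i h y) p.
Proof.
move=> OE; elim: r => [|i r IHr].
  by apply: eq_bigO (bigO0 p) => h y; rewrite big_nil.
case Pi: (P i); last by apply: eq_bigO IHr => h y; rewrite big_cons Pi.
by apply: eq_bigO (bigOD (OE i Pi) IHr) => h y; rewrite big_cons Pi.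
Qed.

Lemma bigO_leq p q E : (p <= q)%N -> bigO E q -> bigO E p.
Proof.
move=> pq OE r; have [C C0 CP] := bigO_pos OE r; exists C.
move: CP near0_le1; apply: filterS2 => h CP h1 y yr.
by rewrite (le_trans (CP y yr)) // ler_pM2l // ler_wiXn2l.
Qed.

Lemma bigO_exp k p E : bigO E p -> bigO (fun h y => h ^+ k *: E h y) (k + p).
Proof.
move=> OE r; have [C CP] := OE r; exists C; apply: filterS CP => h CP y yr.
by rewrite normrZ normrX exprD mulrCA ler_wpM2l ?exprn_ge0 // CP.
Qed.

Lemma bigOZ (c : R) p E : bigO E p -> bigO (fun h y => c *: E h y) p.
Proof.
apply: bigO_dominated => r; exists `|c|, r; apply: near0W => h y yr.
by exists y; rewrite normrZ.
Qed.

Lemma bigO_pow k p E : (0 < k)%N -> bigO E p ->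
  bigO (fun h y => E (h ^+ k) y) (k * p).
Proof.
move=> k0 OE r; have [C /near0P[d d0 CP]] := OE r; exists C.
have [hk] : exists2 d', 0 < d' & forall h : R, `|h| < d' -> `|h ^+ k| < d.
  exists (Num.min 1 d) => [|h]; first by rewrite lt_min ltr01.
  rewrite lt_min => /andP[h1 hd]; apply: le_lt_trans hd.
  by rewrite normrX -{2}[`|h|]expr1 ler_wiXn2l // ltW.
move=> hk0 hkP; apply/near0P; exists hk => // h /hkP hd y yr.
by rewrite exprM -normrX; apply: CP.
Qed.

End Calculus.

Lemma bigO_subst (U V W : normedModType R) (E : R -> V -> W) (S : R -> U -> V) p :
  bigO S 0 -> bigO E p -> bigO (fun h y => E h (S h y)) p.
Proof.
move=> OS; apply: bigO_dominated => r; have [C CP] := OS r; exists 1, C.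
apply: filterS CP => h CP y yr; exists (S h y); rewrite mul1r; split=> //.
by have := CP y yr; rewrite expr0 mulr1.
Qed.

Lemma bigO_id (V : normedModType R) : bigO (fun _ (y : V) => y) 0.
Proof.
by move=> r; exists r; apply: near0W => h y; rewrite expr0 mulr1.
Qed.

Lemma bigO_close0 (V : normedModType R) (S : R -> V -> V) p :
  bigO (fun h y => S h y - y) p -> bigO S 0.
Proof.
move=> OS; apply: eq_bigO (bigOD (bigO_leq (leq0n p) OS) (@bigO_id V)) => h y.
by rewrite subrK.
Qed.

Section MatrixSource.
Context {m n m' n' : nat} {V : normedModType R}.
Implicit Types (Q : 'M[R]_(m, n) -> 'M[R]_(m', n')).

Lemma bigO_continuous (W : normedModType R) (g : 'M[R]_(m, n) -> W) :
  continuous g -> bigO (fun _ y => g y) 0.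
Proof.
move=> cg r; have [C _ CP] := continuous_locally_bounded r cg; exists C.
by apply: near0W => h y yr; rewrite expr0 mulr1 CP.
Qed.

Lemma bigO_lipschitz Q (S S' : R -> V -> 'M[R]_(m, n)) p : smooth Q ->
  bigO S 0 -> bigO S' 0 -> bigO (fun h y => S h y - S' h y) p ->
  bigO (fun h y => Q (S h y) - Q (S' h y)) p.
Proof.
move=> sQ OS OS'; apply: bigO_dominated => r.
have [C CP] := OS r; have [C' CP'] := OS' r.
have [L _ LP] := locally_lipschitz (Num.max C C') (sQ 1%N).
exists L, r; move: CP CP'; apply: filterS2 => h CP CP' y yr; exists y; split=> //.
move: (CP y yr) (CP' y yr); rewrite expr0 !mulr1 => ? ?.
by apply: LP; rewrite le_max; apply/orP; [left|right].
Qed.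

Lemma bigO_derive Q (S S' : R -> V -> 'M[R]_(m, n)) p : smooth Q ->
  bigO S 0 -> bigO S' p -> bigO (fun h y => 'D_(S' h y) Q (S h y)) p.
Proof.
move=> sQ OS; apply: bigO_dominated => r; have [C CP] := OS r.
have [L _ LP] := derive_locally_bounded C (sQ 1%N).
exists L, r; apply: filterS CP => h CP y yr; exists y; split=> //.
by apply: LP; have := CP y yr; rewrite expr0 mulr1.
Qed.

Lemma bigO_integrate (E E' : R -> V -> 'M[R]_(m, n)) p :
  (forall (h : R) y, is_derive h 1 (E ^~ y) (E' h y)) -> (forall y, E 0 y = 0) ->
  bigO E' p -> bigO E p.+1.
Proof.
move=> dE E0 OE r; have [C C0 /near0P[d d0 CP]] := bigO_pos OE r; exists C.
apply/near0P; exists d => // h hd y yr.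
rewrite -[E h y]subr0 -(E0 y) exprSr mulrA.
apply: (@mean_value_bound R _ _ (E ^~ y) (E' ^~ y)) => s sh.
apply: le_trans (CP s (le_lt_trans sh hd) y yr) _.
by rewrite ler_pM2l // lerXn2r ?nnegrE.
Qed.

End MatrixSource.

End BigO.

(** * Taylor polynomials of flows *)

Section Flow.
Context {R : realType}.

Section Lie.
Context {m n : nat}.
Implicit Types w : 'M[R]_(m, n) -> 'M[R]_(m, n).

(** The derivative of Q along the vector field w; the iterates of [lie f] on [id]
    are the time derivatives of the solutions of y' = f(y). *)
Definition lie {m' n'} w (Q : 'M[R]_(m, n) -> 'M[R]_(m', n')) :=
  fun y => 'D_(w y) Q y.

Lemma smooth_lie m' n' w (Q : 'M[R]_(m, n) -> 'M[R]_(m', n')) :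
  smooth w -> smooth Q -> smooth (lie w Q).
Proof.
move=> sw sQ k.
rewrite (_ : lie w Q = fun y => \sum_i \sum_j w y i j *: 'D_(delta_mx i j) Q y).
  apply: Ck_sum => i _; apply: Ck_sum => j _; apply: Ck_scale.
    by have /Ck_mxP := sw k.
  exact: smooth_derive.
by apply: funext => y; rewrite /lie derive_sum_delta //; apply: smooth_differentiable.
Qed.

Lemma smooth_lie_iter m' n' w (Q : 'M[R]_(m, n) -> 'M[R]_(m', n')) i :
  smooth w -> smooth Q -> smooth (iter i (lie w) Q).
Proof. by move=> sw sQ; elim: i => //= i; apply: smooth_lie. Qed.

Lemma smooth_id : smooth (@id 'M[R]_(m, n)).
Proof. by move=> k; apply: (@Ck_linear R _ _ k idfun) => x. Qed.

Lemma lie_id w : lie w id = w.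
Proof. by apply: funext => y; rewrite /lie derive_id. Qed.

(** The truncated Lie series of the flow of w, a polynomial in t: it stands for
    the flow, which need not be defined for all times. *)
Definition flow_taylor w (N : nat) (t : R) (y : 'M[R]_(m, n)) : 'M[R]_(m, n) :=
  \sum_(i < N.+1) (t ^+ i / i`!%:R) *: iter i (lie w) id y.

Lemma bigO_lie_taylor m' n' w (Q : 'M[R]_(m, n) -> 'M[R]_(m', n')) (a k : nat) :
  smooth w -> smooth Q ->
  bigO (fun t y => (t ^+ a / k`!%:R) *: iter k (lie w) Q y) a.
Proof.
move=> sw sQ; rewrite -[X in bigO _ X]addn0.
apply: (@eq_bigO _ _ _ _ (fun t y => t ^+ a *: ((k`!%:R)^-1 *: iter k (lie w) Q y))).
  by move=> t y; rewrite scalerA.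
apply: bigO_exp; apply: bigOZ; apply: bigO_continuous.
exact/smooth_continuous/smooth_lie_iter.
Qed.

Lemma bigO_lie_series m' n' w (Q : 'M[R]_(m, n) -> 'M[R]_(m', n')) N :
  smooth w -> smooth Q ->
  bigO (fun t y => \sum_(i < N) (t ^+ i / i`!%:R) *: iter i (lie w) Q y) 0.
Proof.
move=> sw sQ; apply: bigO_sum => i _.
by apply: bigO_leq (leq0n i) _; apply: bigO_lie_taylor.
Qed.

Lemma is_derive_lie_series m' n' w (Q : 'M[R]_(m, n) -> 'M[R]_(m', n')) N (t : R) y :
  is_derive t 1
    (fun t : R => \sum_(i < N.+1) (t ^+ i / i`!%:R) *: iter i (lie w) Q y)
    (\sum_(i < N) (t ^+ i / i`!%:R) *: iter i (lie w) (lie w Q) y).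
Proof.
pose G (i : nat) (t : R) := (t ^+ i / i`!%:R) *: iter i (lie w) Q y.
pose dG (i : nat) (t : R) := (i%:R * t ^+ i.-1 / i`!%:R) *: iter i (lie w) Q y.
have dGP i : is_derive t 1 (G i) (dG i t).
  rewrite /G /dG; have dX : is_derive t 1 (fun t : R => t ^+ i / i`!%:R) (i%:R * t ^+ i.-1 / i`!%:R).
    have dXi : is_derive t 1 (fun t : R => t ^+ i) (i%:R * t ^+ i.-1).
      apply: DeriveDef; first exact: exprn_derivable.
      by rewrite exp_derive !scaleRE mulr1.
    have := @is_deriveZ R R R (fun t : R => t ^+ i) (i`!%:R^-1) t 1 _ dXi.
    rewrite scaleRE mulrC; congr (is_derive _ _ _ _).
    by apply: funext => s; rewrite mulrC.
  have [dd <-] := dX.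
  have df : differentiable (fun t : R => t ^+ i / i`!%:R) t by apply/derivable1_diffP.
  have dfl : differentiable (fun t : R => (t ^+ i / i`!%:R) *: iter i (lie w) Q y) t.
    exact: differentiableZl.
  apply: DeriveDef; first exact: diff_derivable.
  by rewrite deriveE // diffZl // -deriveE.
rewrite (_ : (fun t => _) = \sum_(i < N.+1) G i); last first.
  by apply: funext => s; rewrite fct_sumE.
apply: is_derive_eq; rewrite big_ord_recl /= {1}/dG mul0r mul0r scale0r add0r.
apply: eq_bigr => i _; rewrite /dG /bump /= add1n -iterSr /=; congr (_ *: _).
by rewrite factS natrM invfM mulrACA mulfV ?pnatr_eq0 // mul1r.
Qed.

Lemma flow_taylor0 w N y : flow_taylor w N 0 y = y.
Proof.
rewrite /flow_taylor big_ord_recl big1 ?addr0 /= => [|i _].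
  by rewrite expr0 divr1 scale1r.
by rewrite expr0n /= mul0r scale0r.
Qed.

Lemma bigO_flow_taylor w N : smooth w -> bigO (flow_taylor w N) 0.
Proof. by move=> sw; apply: bigO_lie_series => //; apply: smooth_id. Qed.

(** The time derivative of Q along S = [flow_taylor w N.+1] is the derivative of
    Q in the direction of the time derivative of S, which is w(S) up to O(t^N+1):
    it is [lie w Q] at S up to O(t^N+1), and the expansion of the latter is
    integrated in t. *)
Theorem lie_series m' n' w (Q : 'M[R]_(m, n) -> 'M[R]_(m', n')) N :
  smooth w -> smooth Q ->
  bigO (fun t y => Q (flow_taylor w N t y) -
    \sum_(i < N.+1) (t ^+ i / i`!%:R) *: iter i (lie w) Q y) N.+1.
Proof.
move=> sw; elim: N m' n' Q => [|N IHN] m' n' Q sQ.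
  apply: eq_bigO (bigO0 1) => t y.
  by rewrite /flow_taylor !big_ord_recl !big_ord0 /= !expr0 !divr1 !scale1r !addr0 subrr.
(* The induction hypothesis speaks of the shorter series; the two differ by
   O(t^(N+1)). *)
pose S := flow_taylor w N.+1; have OS : bigO S 0 by apply: bigO_flow_taylor.
pose dS t y := \sum_(i < N.+1) (t ^+ i / i`!%:R) *: iter i (lie w) w y.
have dSP (t : R) y : is_derive t 1 (S ^~ y) (dS t y).
  by rewrite /dS -{2}(lie_id w); apply: is_derive_lie_series.
have OS_N m0 n0 (g : 'M[R]_(m, n) -> 'M[R]_(m0, n0)) : smooth g ->
    bigO (fun t y => g (S t y) - \sum_(i < N.+1) (t ^+ i / i`!%:R) *: iter i (lie w) g y) N.+1.
  move=> sg; apply: bigO_transB (IHN _ _ g sg).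
  apply: bigO_lipschitz => //; first exact: bigO_flow_taylor.
  apply: eq_bigO (bigO_lie_taylor N.+1 N.+1 sw smooth_id) => t y.
  by rewrite /S /flow_taylor big_ord_recr /= addrAC subrr add0r.
apply: (@bigO_integrate _ _ _ _ _ (fun t y => 'D_(dS t y) Q (S t y) -
    \sum_(i < N.+1) (t ^+ i / i`!%:R) *: iter i (lie w) (lie w Q) y)) => [t y|y|].
- apply: is_deriveB; last exact: is_derive_lie_series.
  have [dd <-] := dSP t y.
  have dSt : differentiable (S ^~ y) t by apply/derivable1_diffP.
  have dQ : differentiable Q (S t y) by apply: smooth_differentiable.
  have dQS : differentiable (Q \o S ^~ y) t by apply: differentiable_comp.
  apply: DeriveDef; first exact: diff_derivable.
  by rewrite deriveE // diff_comp //= -!deriveE.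
- rewrite flow_taylor0 big_ord_recl big1 => [|i _]; first by rewrite expr0 divr1 scale1r addr0 subrr.
  by rewrite expr0n /= mul0r scale0r.
apply: bigO_transB (OS_N _ _ _ (smooth_lie sw sQ)).
apply: (@eq_bigO _ _ _ _ (fun t y => 'D_(dS t y - w (S t y)) Q (S t y))).
  move=> t y; have dQ : differentiable Q (S t y) by apply: smooth_differentiable.
  by rewrite /lie !deriveE // linearB.
apply: bigO_derive => //.
by apply: eq_bigO (bigON (OS_N _ _ _ sw)) => t y; rewrite opprB.
Qed.

End Lie.

End Flow.

(** * Asymptotic expansions in the stepsize *)

Section Expansions.
Context {R : realType}.

Section AnyTarget.
Context {V W : normedModType R}.
Implicit Types (E F : R -> V -> W) (c d : nat -> V -> W) (M k : nat).

Definition expands M E c :=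
  bigO (fun h y => E h y - \sum_(j < M) h ^+ j *: c j y) M.

Definition locally_bounded c := forall j, bigO (fun _ => c j) 0.

Lemma expands_monomials M (I : finType) (e : I -> nat) (x : I -> V -> W) :
  (forall a, bigO (fun _ => x a) 0) ->
  expands M (fun h y => \sum_a h ^+ e a *: x a y)
            (fun m y => \sum_(a | e a == m) x a y).
Proof.
move=> Ox; apply: (@eq_bigO _ _ _ _ (fun h y => \sum_(a | (M <= e a)%N) h ^+ e a *: x a y)).
  move=> h y; apply/eqP; rewrite subr_eq; apply/eqP.
  rewrite (bigID (fun a => M <= e a)%N) /=; congr (_ + _).
  under [RHS]eq_bigr do rewrite scaler_sumr.
  rewrite (exchange_big_dep predT) //= big_mkcond /=; apply: eq_bigr => a _.
  rewrite -ltnNge; case: (ltnP (e a) M) => [aM|Ma].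
    by rewrite (big_pred1 (Ordinal aM)) // => j; rewrite eq_sym -val_eqE.
  rewrite big_pred0 // => j; apply/negP => /eqP ej.
  by move: (ltn_ord j); rewrite -ej ltnNge Ma.
apply: bigO_sum => a Ma; apply: (bigO_leq Ma); rewrite -[X in bigO _ X]addn0.
exact/bigO_exp/Ox.
Qed.

Lemma eq_expands M E c d : (forall j y, (j < M)%N -> c j y = d j y) ->
  expands M E c -> expands M E d.
Proof.
move=> cd; apply: eq_bigO => h y; congr (_ - _); apply: eq_bigr => j _.
by rewrite cd.
Qed.

Lemma expands_close M E F c : bigO (fun h y => E h y - F h y) M ->
  expands M F c -> expands M E c.
Proof. exact: bigO_transB. Qed.

Lemma expands_sum M (I : Type) (r : seq I) (P : pred I) (E : I -> R -> V -> W)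
    (c : I -> nat -> V -> W) : (forall i, P i -> expands M (E i) (c i)) ->
  expands M (fun h y => \sum_(i <- r | P i) E i h y)
            (fun j y => \sum_(i <- r | P i) c i j y).
Proof.
move=> Ec; apply: eq_bigO (@bigO_sum _ _ _ _ r P _ M Ec) => h y.
rewrite sumrB exchange_big /=; congr (_ - _); apply: eq_bigr => j _.
by rewrite scaler_sumr.
Qed.

Lemma expandsB M E F c d : expands M E c -> expands M F d ->
  expands M (fun h y => E h y - F h y) (fun j y => c j y - d j y).
Proof.
move=> Ec Fd; apply: eq_bigO (bigOB Ec Fd) => h y.
under eq_bigr do rewrite scalerBr.
by rewrite sumrB !opprB addrACA [RHS]addrACA [- F h y + _]addrC.
Qed.

Lemma expands_exp M k E c : locally_bounded c -> expands M E c ->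
  expands M (fun h y => h ^+ k *: E h y)
            (fun m y => if (k <= m)%N then c (m - k)%N y else 0).
Proof.
move=> Oc Ec.
apply: (expands_close (F := fun h y => \sum_(j < M) h ^+ (j + k) *: c j y)).
  apply: (bigO_leq (leq_addl k M)); apply: eq_bigO (bigO_exp k Ec) => h y.
  rewrite scalerBr scaler_sumr; congr (_ - _); apply: eq_bigr => j _.
  by rewrite scalerA -exprD addnC.
apply: (eq_expands _ (expands_monomials M (fun j : 'I_M => j + k)%N (fun j => Oc j))).
move=> m y mM; case: leqP => [km|mk].
  have lt : (m - k < M)%N by rewrite (leq_ltn_trans (leq_subr _ _)).
  by rewrite (big_pred1 (Ordinal lt)) // => j; rewrite /= -val_eqE /= -[RHS](eqn_add2r k) subnK.
rewrite big_pred0 // => j; apply/negP => /eqP jm.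
by move: mk; rewrite -jm ltnNge leq_addl.
Qed.

End AnyTarget.

Section FlowSubstitution.
Context {m n m' n' : nat}.
Implicit Types (w : 'M[R]_(m, n) -> 'M[R]_(m, n)).
Implicit Types (c : nat -> 'M[R]_(m, n) -> 'M[R]_(m', n')).

(** The coefficient of h^l of \sum_j h^j c_j composed with the flow of w at
    time h^K: the flow acts on c_j as \sum_i h^(K i) / i! (lie w)^i. *)
Definition flow_coef w (K : nat) c (l : nat) : 'M[R]_(m, n) -> 'M[R]_(m', n') :=
  fun y => \sum_(i < l.+1 | (K * i <= l)%N)
    (i`!%:R)^-1 *: iter i (lie w) (c (l - K * i)%N) y.

Lemma smooth_sum (V W : normedModType R) (I : Type) (r : seq I) (P : pred I)
    (F : I -> V -> W) :
  (forall i, P i -> smooth (F i)) -> smooth (fun x => \sum_(i <- r | P i) F i x).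
Proof. by move=> sF k; apply: Ck_sum => i Pi; apply: sF. Qed.

Lemma smooth_scale (V W : normedModType R) (F : V -> W) (a : R) :
  smooth F -> smooth (fun x => a *: F x).
Proof. by move=> sF k; apply: CkZ. Qed.

Lemma smooth_flow_coef w K c : smooth w -> (forall j, smooth (c j)) ->
  forall l, smooth (flow_coef w K c l).
Proof.
move=> sw sc l; apply: smooth_sum => i _; apply: smooth_scale.
exact: smooth_lie_iter.
Qed.

Lemma smooth_locally_bounded c : (forall j, smooth (c j)) -> locally_bounded c.
Proof. by move=> sc j; apply/bigO_continuous/smooth_continuous. Qed.

Lemma expands_flow w K M E c : (0 < K)%N -> smooth w -> (forall j, smooth (c j)) ->
  expands M E c ->
  expands M (fun h y => E h (flow_taylor w M (h ^+ K) y)) (flow_coef w K c).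
Proof.
move=> K0 sw sc Ec; pose S h y := flow_taylor w M (h ^+ K) y.
have OS : bigO S 0 by rewrite -[0%N](muln0 K); apply: bigO_pow K0 (bigO_flow_taylor _ sw).
apply: (expands_close (F := fun h y => \sum_(j < M) h ^+ j *: c j (S h y))).
  exact: bigO_subst OS Ec.
pose x (a : 'I_M * 'I_M.+1) y := (a.2`!%:R)^-1 *: iter a.2 (lie w) (c a.1) y.
apply: (expands_close (F := fun h y =>
    \sum_(a : 'I_M * 'I_M.+1) h ^+ (a.1 + K * a.2) *: x a y)).
  apply: (@eq_bigO _ _ _ _ (fun h y => \sum_(j < M) h ^+ j *: (c j (S h y) -
      \sum_(i < M.+1) ((h ^+ K) ^+ i / i`!%:R) *: iter i (lie w) (c j) y))).
    move=> h y; rewrite -(pair_bigA _ (fun (j : 'I_M) (i : 'I_M.+1) => h ^+ (j + K * i) *: x (j, i) y)) /=.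
    rewrite -sumrB; apply: eq_bigr => j _; rewrite scalerBr; congr (_ - _).
    rewrite scaler_sumr; apply: eq_bigr => i _.
    by rewrite /x /= !scalerA exprD exprM mulrA.
  apply: bigO_sum => j _; apply: (@bigO_leq _ _ _ _ (j + K * M.+1)).
    by rewrite (leq_trans _ (leq_addl _ _)) // (leq_trans (leqnSn M)) // leq_pmull.
  exact: bigO_exp (bigO_pow K0 (lie_series M sw (sc j))).
have Ox a : bigO (fun _ => x a) 0.
  apply: bigO_continuous; apply: smooth_continuous; apply: smooth_scale.
  exact: smooth_lie_iter.
apply: (eq_expands _ (expands_monomials M (fun a : 'I_M * 'I_M.+1 => a.1 + K * a.2)%N Ox)).
move=> l y lM; rewrite -(pair_big_dep predT (fun (j : 'I_M) (i : 'I_M.+1) => (j + K * i == l)%N)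
  (fun j i => x (j, i) y)) /=.
rewrite (exchange_big_dep predT) //= /flow_coef.
rewrite (big_ord_widen_cond M.+1 (fun i => (K * i <= l)%N)
  (fun i => i`!%:R^-1 *: iter i (lie w) (c (l - K * i)%N) y)) ?ltnS ?(ltnW lM) //.
rewrite [RHS]big_mkcond /=; apply: eq_bigr => i _.
case: ifPn => [/andP[Kil il]|nKil].
  have lt : (l - K * i < M)%N by rewrite (leq_ltn_trans (leq_subr _ _)).
  by rewrite (big_pred1 (Ordinal lt)) // => j; rewrite /= -val_eqE /= -[RHS](eqn_add2r (K * i)) subnK.
rewrite big_pred0 // => j; apply/negP => /eqP jl; case/negP: nKil.
rewrite -jl leq_addl /= ltnS (leq_trans _ (leq_addl _ _)) // leq_pmull //.
Qed.

End FlowSubstitution.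

(** * Solutions of implicit equations close to the identity *)

Section Implicit.
Context {m n : nat}.
Implicit Types (p : nat -> 'M[R]_(m, n) -> 'M[R]_(m, n)).

Definition hpoly p (N : nat) (h : R) (y : 'M[R]_(m, n)) : 'M[R]_(m, n) :=
  \sum_(j < N) h ^+ j *: p j y.

Lemma hpolyE p N h y : p 0%N = id ->
  hpoly p N.+1 h y = y + \sum_(j < N) h ^+ j.+1 *: p j.+1 y.
Proof. by move=> p0; rewrite /hpoly big_ord_recl /= p0 expr0 scale1r. Qed.

Lemma higher_terms_lipschitz p N (r : R) : (forall j, smooth (p j)) ->
  exists2 L : R, 0 < L & forall h x y, `|h| <= 1 -> `|x| <= r -> `|y| <= r ->
   `|\sum_(j < N) h ^+ j.+1 *: p j.+1 x - \sum_(j < N) h ^+ j.+1 *: p j.+1 y| <=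
     `|h| * L * `|x - y|.
Proof.
move=> sp; have /choice[L LP] j : exists L : R, 0 < L /\
    forall x y, `|x| <= r -> `|y| <= r -> `|p j x - p j y| <= L * `|x - y|.
  by have [L L0 LP] := locally_lipschitz r (sp j 1%N); exists L.
exists (\sum_(j < N) L j.+1 + 1) => [|h x y h1 xr yr].
  by rewrite ltr_wpDl // sumr_ge0 // => j _; have [/ltW] := LP j.+1.
rewrite -sumrB (le_trans (ler_norm_sum _ _ _)) //.
apply: (@le_trans _ _ (\sum_(j < N) `|h| * L j.+1 * `|x - y|)).
  apply: ler_sum => j _; have [L0 LjP] := LP j.+1.
  rewrite -scalerBr normrZ normrX -mulrA ler_pM ?exprn_ge0 ?LjP //.
  by rewrite exprS ler_piMr // exprn_ile1.
rewrite -mulr_suml -mulr_sumr ler_wpM2r // ler_wpM2l // lerDl //.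
Qed.

(** The part of [hpoly] of positive degree in h is a contraction for small h, so
    that approximate solutions with close values are close. *)
Lemma implicit_close p N q (S S' : R -> 'M[R]_(m, n) -> 'M[R]_(m, n)) :
  (0 < N)%N -> p 0%N = id -> (forall j, smooth (p j)) -> bigO S 0 -> bigO S' 0 ->
  bigO (fun h y => hpoly p N h (S h y) - hpoly p N h (S' h y)) q ->
  bigO (fun h y => S h y - S' h y) q.
Proof.
case: N => // N _ p0 sp OS OS'; apply: bigO_dominated => r.
have [C CP] := OS r; have [C' CP'] := OS' r.
have [L L0 LP] := higher_terms_lipschitz N (Num.max C C') sp.
exists 2, r.
have small : \forall h \near (0 : R), `|h| * L <= 2^-1.
  apply/near0P; exists (2^-1 / L) => [|h /ltW]; first by rewrite divr_gt0.
  by rewrite ler_pdivlMr.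
have small1 : \forall h \near (0 : R), `|h| * L <= 2^-1 /\ `|h| <= 1.
  exact: filterI small near0_le1.
move: CP CP' small1; apply: filterS3 => h CP CP' [hL h1] y yr.
exists y; split=> //; rewrite !hpolyE //.
move: (CP y yr) (CP' y yr); rewrite expr0 !mulr1 => Sr Sr'.
have := LP h (S h y) (S' h y) h1; rewrite !le_max Sr Sr' orbT => /(_ isT isT).
set A := \sum_(_ < _) _; set B := \sum_(_ < _) _; set x := S h y; set x' := S' h y.
move=> /le_trans/(_ (ler_wpM2r (normr_ge0 _) hL)) AB.
have : `|x - x'| <= `|x + A - (x' + B)| + `|A - B|.
  have -> : x + A - (x' + B) = x - x' + (A - B) by rewrite opprD addrACA.
  by rewrite -{1}(addrK (A - B) (x - x')) ler_normB.
by move: AB; lra.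
Qed.

End Implicit.

End Expansions.

(** * Bernoulli numbers and the form of the method *)

Section Bernoulli.

Definition bernoulli_coef (j : nat) : rat := bernoulli j / j`!%:R.

Lemma fact_neq0 (k : nat) : k`!%:R != 0 :> rat.
Proof. by rewrite pnatr_eq0 -lt0n fact_gt0. Qed.

Lemma bernoulli_coef_gen n :
  \sum_(j < n.+1) bernoulli_coef j / ((n.+1 - j)`!)%:R = (n == 0%N)%:R.
Proof. exact: bernoulli_gen. Qed.

(** ((1 - e^(-z)) / z) e^z = (e^z - 1) / z. *)
Lemma alternating_fact_sum k :
  \sum_(j < k.+1) ((-1) ^+ j / (j.+1)`!%:R) / (k - j)`!%:R = ((k.+1)`!%:R)^-1 :> rat.
Proof.
have E : \sum_(j < k.+1) (-1) ^+ j * 'C(k.+1, j.+1)%:R = 1 :> rat.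
  have := exprDn (1 : rat) (-1) k.+1; rewrite subrr expr0n /= big_ord_recl /=.
  rewrite expr1n bin0 mulr1 mulr1n => /esym/eqP; rewrite addrC addr_eq0 => /eqP E.
  apply: oppr_inj; rewrite -[RHS]E -sumrN; apply: eq_bigr => j _.
  by rewrite expr1n mul1r /bump /= add1n exprS mulN1r mulNrn mulr_natr.
apply: (mulfI (fact_neq0 k.+1)); rewrite mulfV ?fact_neq0 //; apply: etrans _ E.
rewrite mulr_sumr; apply: eq_bigr => j _.
have jk : (j.+1 <= k.+1)%N by [].
rewrite -(bin_fact jk) subSS 2!natrM.
have := fact_neq0 j.+1; have := fact_neq0 (k - j).
move: ((j.+1)`!) ((k - j)`!) => a b a0 b0.
by field; rewrite a0 b0.
Qed.

(** B(-z) (e^z - 1) / z = e^z for B(z) = z / (e^z - 1), by multiplying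
    B(-z) (1 - e^(-z)) / z = 1 by e^z. *)
Lemma bernoulli_coef_neg n :
  \sum_(j < n.+1) (-1) ^+ j * bernoulli_coef j / ((n.+1 - j)`!)%:R = (n`!%:R)^-1 :> rat.
Proof.
pose A := \poly_(j < n.+1) ((-1) ^+ j * bernoulli_coef j : rat).
pose F := \poly_(j < n.+1) ((-1) ^+ j / (j.+1)`!%:R : rat).
pose X := \poly_(j < n.+1) ((j`!%:R)^-1 : rat).
have FX k : (k < n.+1)%N -> (F * X)`_k = ((k.+1)`!%:R)^-1.
  move=> kn; rewrite coefM -alternating_fact_sum; apply: eq_bigr => j _.
  have jk : (j <= k)%N by rewrite -ltnS.
  by rewrite !coef_poly (leq_ltn_trans jk kn) (leq_ltn_trans (leq_subr _ _) kn).
have AF k : (k < n.+1)%N -> (A * F)`_k = (k == 0%N)%:R.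
  move=> kn; rewrite coefM.
  transitivity ((-1) ^+ k * \sum_(j < k.+1) bernoulli_coef j / ((k.+1 - j)`!)%:R : rat).
    rewrite mulr_sumr; apply: eq_bigr => j _.
    have jk : (j <= k)%N by rewrite -ltnS.
    rewrite !coef_poly (leq_ltn_trans jk kn) (leq_ltn_trans (leq_subr _ _) kn).
    have -> : (-1) ^+ k = (-1) ^+ j * (-1) ^+ (k - j) :> rat by rewrite -exprD subnKC.
    rewrite subSn //; move: (bernoulli_coef j) (((k - j).+1)`!%:R) => b c.
    by rewrite !mulrA; congr (_ / _); rewrite mulrAC.
  by rewrite bernoulli_coef_gen; case: k {kn} => [|k]; rewrite ?expr1n ?mul1r ?mulr0 ?expr0.
have : \sum_(j < n.+1) A`_j * (F * X)`_(n - j) = \sum_(j < n.+1) (A * F)`_j * X`_(n - j).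
  by rewrite -!coefM mulrA.
rewrite [X in _ = X -> _](_ : _ = (n`!%:R)^-1) => [<-|]; last first.
  rewrite big_ord_recl big1 => [|j _].
    by rewrite AF // mul1r subn0 addr0 coef_poly ltnSn.
  by rewrite AF ?mul0r // /bump /= add1n ltnS.
apply: eq_bigr => j _; have jn : (j <= n)%N by rewrite -ltnS.
by rewrite FX ?coef_poly ?ltnS ?leq_subr ?jn // subSn.
Qed.

Lemma convolution_fact_inj (x : nat -> rat) :
  (forall n, \sum_(j < n.+1) x j / ((n.+1 - j)`!)%:R = 0) -> forall n, x n = 0.
Proof.
move=> x0; elim/ltn_ind => n IHn; have := x0 n.
by rewrite big_ord_recr /= subSnn divr1 big1 ?add0r // => j _; rewrite IHn ?mul0r.
Qed.

(** B(-z) = B(z) + z, since both become e^z when multiplied by (e^z - 1) / z. *)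
Lemma bernoulli_coef_sign n :
  (-1) ^+ n * bernoulli_coef n = bernoulli_coef n + (n == 1%N)%:R.
Proof.
apply/eqP; rewrite -subr_eq0; apply/eqP.
apply: (convolution_fact_inj (x := fun n =>
  (-1) ^+ n * bernoulli_coef n - (bernoulli_coef n + (n == 1%N)%:R))) => {}n.
under eq_bigr do rewrite mulrBl mulrDl.
rewrite sumrB big_split /= bernoulli_coef_neg bernoulli_coef_gen.
case: n => [|n]; first by rewrite big_ord1 /= mul0r addr0 fact0 invr1 subrr.
rewrite add0r 2!big_ord_recl big1 => [|j _]; last by rewrite /= mul0r.
by rewrite /= mul0r mul1r addr0 add0r subSS subn0 subrr.
Qed.

Lemma bernoulli_coef_odd n : odd n -> n != 1%N -> bernoulli_coef n = 0.
Proof.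
move=> on n1; have := bernoulli_coef_sign n.
rewrite -signr_odd on (negPf n1) addr0 expr1 mulN1r => /eqP.
by rewrite -subr_eq0 -opprD oppr_eq0 -mulr2n mulrn_eq0 => /eqP.
Qed.

Lemma bernoulli_coef0 : bernoulli_coef 0 = 1.
Proof. by rewrite /bernoulli_coef /bernoulli /= divr1. Qed.

Lemma bernoulli_coef1 : bernoulli_coef 1 = - 2^-1.
Proof.
have := bernoulli_coef_sign 1; rewrite expr1 mulN1r /=.
by move=> E; lra.
Qed.

(** The coefficient of h^m y^(m), m <= 2 s + 2, in the residual of an exact
    solution y in the method: by the recursion of the Bernoulli numbers, only the
    truncation of the sum at j < 2 s contributes, and B_(2s+1) = 0. *)
Lemma euler_maclaurin_coef (s m : nat) : (1 <= s)%N -> (m <= 2 * s + 2)%N ->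
  \sum_(j < 2 * s | (j <= m)%N) bernoulli_coef j / (m - j)`!%:R
    - (if (m < 2 * s)%N then (-1) ^+ m * bernoulli_coef m else 0) =
  - (m == 2 * s + 1)%N%:R * bernoulli_coef (2 * s)
  - (m == 2 * s + 2)%N%:R / 2 * bernoulli_coef (2 * s).
Proof.
move=> s1 m2.
have gen n : \sum_(j < n) bernoulli_coef j / (n - j)`!%:R = (n == 1%N)%:R.
  by case: n => [|n]; [rewrite big_ord0|rewrite bernoulli_coef_gen].
have [mlt|mge] := ltnP m (2 * s).
  rewrite (_ : \sum_(_ < _ | _) _ = \sum_(j < m.+1) bernoulli_coef j / (m - j)`!%:R).
    rewrite big_ord_recr /= subnn divr1 gen bernoulli_coef_sign.
    have -> : (m == 2 * s + 1)%N = false by lia.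
    have -> : (m == 2 * s + 2)%N = false by lia.
    by rewrite oppr0 !mul0r subr0 addrC subrr.
  by rewrite (big_ord_widen_cond (2 * s) predT (fun j => bernoulli_coef j / (m - j)`!%:R)).
rewrite subr0 (eq_bigl predT) => [|j]; last by rewrite (leq_trans (ltnW (ltn_ord j))).
have {m2} : [|| m == 2 * s, m == 2 * s + 1 | m == 2 * s + 2]%N by lia.
have b1 : (2 * s == 1)%N = false by lia.
case/or3P => /eqP ->.
- rewrite gen b1; have -> : (2 * s == 2 * s + 1)%N = false by lia.
  have -> : (2 * s == 2 * s + 2)%N = false by lia.
  by rewrite oppr0 !mul0r subr0.
- have -> : (2 * s + 1 == 2 * s + 2)%N = false by lia.
  have := gen (2 * s + 1)%N; rewrite addn1 big_ord_recr /= subSnn divr1 eqxx.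
  have -> : ((2 * s).+1 == 1)%N = false by lia.
  by move=> /eqP; rewrite addr_eq0 => /eqP ->; rewrite mulr1n mulN1r !mul0r subr0.
- have -> : (2 * s + 2 == 2 * s + 1)%N = false by lia.
  have := gen (2 * s + 2)%N; rewrite addn2 !big_ord_recr /= subSnn.
  have -> : ((2 * s).+2 - 2 * s)%N = 2%N by lia.
  rewrite (bernoulli_coef_odd (n := (2 * s).+1)) ?eqxx /= ?oddM //; last by lia.
  rewrite mul0r addr0 => /eqP; rewrite addr_eq0 => /eqP ->.
  by rewrite oppr0 mul0r add0r mulr1n div1r mulrC.
Qed.

End Bernoulli.

Section MethodForm.
Context {R : realType}.

Definition bernR (j : nat) : R := ratr (bernoulli_coef j).

(** The coefficient of h^j in the Euler-Maclaurin formula, where [iter j (lie f) id]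
    is the j-th time derivative of a solution. *)
Definition em_coef {m n : nat} (f : 'M[R]_(m, n) -> 'M[R]_(m, n)) (j : nat) y :=
  bernR j *: iter j (lie f) id y.

Lemma em_coef0 m n (f : 'M[R]_(m, n) -> 'M[R]_(m, n)) : em_coef f 0 = id.
Proof.
by apply: funext => y; rewrite /em_coef /bernR bernoulli_coef0 rmorph1 scale1r.
Qed.

Lemma smooth_em_coef m n (f : 'M[R]_(m, n) -> 'M[R]_(m, n)) j :
  smooth f -> smooth (em_coef f j).
Proof. by move=> sf; apply: smooth_scale; apply: smooth_lie_iter smooth_id. Qed.

Lemma lie_derivativeE d (f : 'cV[R]_d -> 'cV[R]_d) j : smooth f ->
  lie_derivative f j = iter j.+1 (lie f) id.
Proof.
move=> sf; elim: j => [|j IHj]; first by rewrite /= lie_id.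
rewrite iterS -IHj; apply: funext => z; rewrite /= mul_jac -?deriveE //.
all: apply: smooth_differentiable; rewrite IHj; apply: smooth_lie_iter => //.
all: exact: smooth_id.
Qed.

Lemma sum_even_odd (V : zmodType) s (F : nat -> V) :
  \sum_(j < 2 * s) F j = \sum_(k < s) (F (2 * k)%N + F (2 * k).+1).
Proof.
elim: s => [|s IHs]; first by rewrite !big_ord0.
by rewrite mulnS add2n 2!big_ord_recr IHs big_ord_recr /= addrA.
Qed.

(** As B_1 = -1/2 and the other odd Bernoulli numbers vanish, the method is the
    symmetric equation P_h(y1) = P_(-h)(y0), where P_h is [hpoly] of the terms
    [em_coef f j]. *)
Lemma EulerMaclaurin_hpoly d s (f : 'cV[R]_d -> 'cV[R]_d) h y0 y1 :
  (1 <= s)%N -> smooth f ->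
  EulerMaclaurin_eq s f h y0 y1 <->
  hpoly (em_coef f) (2 * s) h y1 = hpoly (em_coef f) (2 * s) (- h) y0.
Proof.
move=> s1 sf.
have hE x z : hpoly (em_coef f) (2 * s) x z = z - (x / 2) *: f z +
    \sum_(1 <= k < s) (x ^+ (2 * k) * bernR (2 * k)) *: lie_derivative f (2 * k - 1) z.
  case: s s1 => // s _; rewrite /hpoly (sum_even_odd s.+1 (fun j => x ^+ j *: em_coef f j z)).
  rewrite big_ord_recl big_add1 big_mkord; congr (_ + _).
    rewrite /= muln0 em_coef0 expr0 scale1r expr1 /em_coef /= lie_id /bernR bernoulli_coef1.
    by rewrite rmorphN fmorphV rmorph_nat scalerA mulrN scaleNr.
  apply: eq_bigr => k _; rewrite /= /bump /= add1n lie_derivativeE // /em_coef !scalerA.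
  have -> : (2 * k.+1 - 1).+1 = (2 * k.+1)%N by lia.
  rewrite /bernR (bernoulli_coef_odd (n := (2 * k.+1).+1)) /= ?oddM //; last by lia.
  by rewrite rmorph0 mulr0 scale0r addr0.
have hNE : hpoly (em_coef f) (2 * s) (- h) y0 = y0 + (h / 2) *: f y0 +
    \sum_(1 <= k < s) (h ^+ (2 * k) * bernR (2 * k)) *: lie_derivative f (2 * k - 1) y0.
  rewrite hE mulNr scaleNr opprK; congr (_ + _); apply: eq_bigr => k _.
  by rewrite exprM sqrrN -exprM.
rewrite /EulerMaclaurin_eq hNE hE.
under [X in _ = _ - X]eq_bigr => k _.
  rewrite scalerBr (_ : _ / _ = h ^+ (2 * k) * bernR (2 * k)); last first.
    by rewrite /bernR /bernoulli_coef [in RHS]fmorph_div rmorph_nat -mulrA.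
  over.
rewrite sumrB.
set S1 := \sum_(_ <= _ < _) _; set S0 := \sum_(_ <= _ < _) _; rewrite scalerDr.
move: (_ *: f y1) (_ *: f y0) S1 S0 => a1 a0 S1 S0.
by split=> /matrixP E; apply/matrixP => i j; move: (E i j); rewrite !mxE; lra.
Qed.

End MethodForm.

(** * Elementary differentials *)

Section TreeLemmas.

Lemma ptree_mem_ind (P : ptree -> Prop) :
  (forall ts, (forall u, u \in ts -> P u) -> P (PNode ts)) -> forall t, P t.
Proof.
move=> Pnode; fix IH 1 => -[ts]; apply: Pnode.
elim: ts => [|t ts IHts] u; first by clear IH.
have IHt := IH t; clear IH; by rewrite in_cons => /predU1P[->|/IHts].
Qed.

(** The sorted representative of the isomorphism class of a plane tree. *)
Fixpoint rooted_rep (t : ptree) : ptree :=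
  let: PNode ts := t in
  PNode (sort (fun u v => pickle u <= pickle v)%N (map rooted_rep ts)).

Lemma rooted_rep_rooted t : is_rooted (rooted_rep t).
Proof.
elim/ptree_mem_ind: t => ts IH /=; rewrite sort_sorted => [|u v]; last exact: leq_total.
by rewrite all_sort; apply/allP => _ /mapP[u uts ->]; apply: IH.
Qed.

Lemma rooted_rep_order t : tree_order (rooted_rep t) = tree_order t.
Proof.
elim/ptree_mem_ind: t => ts IH /=; congr _.+1.
rewrite (perm_sumn (perm_map _ (permEl (perm_sort _ _)))) -map_comp.
by congr sumn; apply/eq_in_map => u /IH.
Qed.

Lemma symmetry_gt0 t : (0 < symmetry t)%N.
Proof.
elim/ptree_mem_ind: t => ts IH /=; rewrite muln_gt0; apply/andP; split.
  by rewrite prodn_gt0 // => u; rewrite fact_gt0.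
elim: ts IH => //= u ts IHts IH; rewrite muln_gt0 IH ?mem_head //= IHts // => v vts.
by rewrite IH // in_cons vts orbT.
Qed.

Lemma tree_order_gt0 t : (0 < tree_order t)%N.
Proof. by case: t. Qed.

End TreeLemmas.

Section MultiDerive.
Context {R : realType} {d : nat}.
Implicit Types (f w : 'cV[R]_d -> 'cV[R]_d) (vs : seq 'cV[R]_d) (v y : 'cV[R]_d).

Lemma smooth_multi_derive f vs : smooth f -> smooth (multi_derive f vs).
Proof. by move=> sf; elim: vs => //= v vs; apply: smooth_derive. Qed.

Lemma smooth_schwarz f (u v y : 'cV[R]_d) : smooth f ->
  'D_u ('D_v f) y = 'D_v ('D_u f) y.
Proof. by move=> sf; apply: schwarz. Qed.

Lemma multi_derive_swap f v vs : smooth f ->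
  multi_derive f (v :: vs) = multi_derive ('D_v f) vs.
Proof.
move=> sf; elim: vs => [//|u vs IHvs]; apply: funext => y /=.
rewrite -IHvs; apply: smooth_schwarz; exact: smooth_multi_derive.
Qed.

Lemma multi_derive_front f vs v vs' : smooth f ->
  multi_derive f (vs ++ v :: vs') = multi_derive f (v :: vs ++ vs').
Proof.
move=> sf; elim: vs => [//|u vs IHvs]; apply: funext => y; rewrite /= IHvs /=.
apply: smooth_schwarz; exact: smooth_multi_derive.
Qed.

Lemma multi_derive_perm f vs ws : smooth f -> perm_eq vs ws ->
  multi_derive f vs = multi_derive f ws.
Proof.
move=> sf; elim: vs ws => [|v vs IHvs] ws; first by rewrite perm_sym => /perm_nilP ->.
move=> pvw; have vw : v \in ws by rewrite -(perm_mem pvw) mem_head.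
case/splitPr: vw pvw => ws1 ws2 pvw; rewrite multi_derive_front //=.
rewrite (IHvs (ws1 ++ ws2)) // -(perm_cons v) (permPl pvw).
by rewrite -[v :: ws2]cat1s perm_catCA.
Qed.

Lemma multi_derive_sum (I : Type) (r : seq I) (c : I -> R) (v : I -> 'cV[R]_d)
    f vs vs' y : smooth f ->
  multi_derive f (vs ++ (\sum_(i <- r) c i *: v i) :: vs') y =
  \sum_(i <- r) c i *: multi_derive f (vs ++ v i :: vs') y.
Proof.
move=> sf; have dm : differentiable (multi_derive f (vs ++ vs')) y.
  exact/smooth_differentiable/smooth_multi_derive.
rewrite multi_derive_front //= derive_sumr //; apply: eq_bigr => i _.
by rewrite deriveZr // multi_derive_front.
Qed.

Lemma multi_derive_coord f v vs y : smooth f ->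
  multi_derive f (v :: vs) y =
  \sum_k v k 0 *: multi_derive ('D_(delta_mx k 0) f) vs y.
Proof.
move=> sf; rewrite {1}(matrix_sum_delta v).
have -> : \sum_i \sum_j v i j *: delta_mx i j = \sum_i v i 0 *: delta_mx i 0.
  by apply: eq_bigr => i _; rewrite big_ord1.
have := @multi_derive_sum _ (index_enum 'I_d) (fun i => v i 0) (fun i => delta_mx i 0) f [::] vs y sf.
rewrite /= => ->; apply: eq_bigr => k _.
by rewrite -(multi_derive_swap (delta_mx k 0) vs sf).
Qed.

(** The multilinear map f^(k)(y) applied to the values at y of vector fields; the
    fields themselves are not differentiated. *)
Definition field_derive f (gs : seq ('cV[R]_d -> 'cV[R]_d)) y :=
  multi_derive f [seq g y | g <- gs] y.

Fixpoint all_smooth (gs : seq ('cV[R]_d -> 'cV[R]_d)) : Prop :=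
  if gs is g :: gs' then smooth g /\ all_smooth gs' else True.

Lemma field_derive_cons f g gs : smooth f ->
  field_derive f (g :: gs) =
  fun y => \sum_k g y k 0 *: field_derive ('D_(delta_mx k 0) f) gs y.
Proof. by move=> sf; apply: funext => y; apply: multi_derive_coord. Qed.

Lemma smooth_field_derive f gs : smooth f -> all_smooth gs ->
  smooth (field_derive f gs).
Proof.
move=> + sgs; elim: gs f sgs => [|g gs IHgs] f //= [sg sgs] sf.
rewrite field_derive_cons // => k; apply: Ck_sum => i _; apply: Ck_scale.
  by move/Ck_mxP: (sg k).
by apply: IHgs => //; apply: smooth_derive.
Qed.

(** The new derivative falls either on f, and w becomes one more argument of a
    higher derivative, or on one of the arguments. *)
Lemma field_derive_leibniz f w gs : smooth f -> all_smooth gs ->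
  lie w (field_derive f gs) =
  fun y => field_derive f (w :: gs) y + \sum_(i < size gs)
    field_derive f (take i gs ++ lie w (nth id gs i) :: drop i.+1 gs) y.
Proof.
move=> + sgs; elim: gs f sgs => [|g gs IHgs] f.
  by move=> _ sf; apply: funext => y; rewrite big_ord0 addr0.
move=> /= [sg sgs] sf; apply: funext => y; rewrite /lie field_derive_cons //.
have sdf k : smooth ('D_(delta_mx k 0) f) by apply: smooth_derive.
have dM k : differentiable (field_derive ('D_(delta_mx k 0) f) gs) y.
  by apply/smooth_differentiable/smooth_field_derive.
have dg k : differentiable (fun y => g y k 0) y.
  by have /differentiable_mxP := smooth_differentiable y sg.
have dgM k : differentiable (fun y => g y k 0 *: field_derive ('D_(delta_mx k 0) f) gs y) y.
  apply/differentiable_mxP => i j; under eq_fun do rewrite mxE.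
  by apply: differentiableM => //; move/differentiable_mxP: (dM k).
rewrite (_ : (fun y => _) =
    \sum_k (fun y => g y k 0 *: field_derive ('D_(delta_mx k 0) f) gs y)); last first.
  by apply: funext => z; rewrite fct_sumE.
rewrite derive_sum => [|k]; last exact: diff_derivable.
transitivity (\sum_k ((lie w g y) k 0 *: field_derive ('D_(delta_mx k 0) f) gs y +
    g y k 0 *: lie w (field_derive ('D_(delta_mx k 0) f) gs) y)).
  apply: eq_bigr => k _; apply/matrixP => i j; rewrite derive_coord // !mxE.
  under eq_fun do rewrite mxE.
  rewrite (@deriveM _ _ (fun y => g y k 0)
    (fun y => field_derive ('D_(delta_mx k 0) f) gs y i j)); first last.
  - by apply: diff_derivable; move/differentiable_mxP: (dM k).
  - exact: diff_derivable.
  rewrite !scaleRE addrC /lie !derive_coord //; last exact: smooth_differentiable.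
  by congr (_ + _); rewrite mulrC.
under [LHS]eq_bigr => k _ do rewrite (IHgs _ sgs (sdf k)) scalerDr scaler_sumr.
rewrite !big_split /= [X in _ + (_ + X) = _]exchange_big /=.
have E (g' : 'cV[R]_d -> 'cV[R]_d) gs' : \sum_k g' y k 0 *: field_derive ('D_(delta_mx k 0) f) gs' y =
    field_derive f (g' :: gs') y by rewrite field_derive_cons.
rewrite (big_ord_recl (size gs)) [X in _ = _ + (X + _)](_ : _ = field_derive f (lie w g :: gs) y);
  last by rewrite /= drop0.
have -> : field_derive f [:: w, g & gs] y = field_derive f [:: g, w & gs] y.
  rewrite /field_derive /=; apply: smooth_schwarz; exact: smooth_multi_derive.
rewrite addrCA; congr (_ + (_ + _)); [exact: E|exact: E|].
by apply: eq_bigr => i _; apply: E.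
Qed.

Lemma elementary_differentialE f ts :
  elementary_differential f (PNode ts) =
  field_derive f [seq elementary_differential f u | u <- ts].
Proof. by apply: funext => y; rewrite /field_derive -map_comp. Qed.

Lemma smooth_elementary_differential f t : smooth f ->
  smooth (elementary_differential f t).
Proof.
move=> sf; elim/ptree_mem_ind: t => ts IH; rewrite elementary_differentialE.
apply: smooth_field_derive => //; elim: ts IH => //= t ts IHts IH; split.
  by apply: IH; rewrite mem_head.
by apply: IHts => u uts; apply: IH; rewrite in_cons uts orbT.
Qed.

Lemma elementary_differential_rep f t : smooth f ->
  elementary_differential f (rooted_rep t) = elementary_differential f t.
Proof.
move=> sf; elim/ptree_mem_ind: t => ts IH; apply: funext => y /=.
rewrite (multi_derive_perm sf (perm_map _ (permEl (perm_sort _ _)))) -map_comp.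
by congr (multi_derive _ _ _); apply/eq_in_map => u /IH /= ->.
Qed.

End MultiDerive.

(** * Universal combinations of elementary differentials *)

Section Universal.
Context {R : realType}.

(** A vector field built from f, for every dimension and every f at once. *)
Definition field_family :=
  forall d : nat, ('cV[R]_d -> 'cV[R]_d) -> 'cV[R]_d -> 'cV[R]_d.

(** The degree n part of a B-series. In degree 0, where there is only the empty
    tree, its coefficient is stored at the one-vertex tree. *)
Definition tree_comb (n : nat) (a : ptree -> R) : field_family :=
  fun d f y => if n is 0 then a (PNode [::]) *: y
  else \sum_(t <- rooted_trees n) a t *: elementary_differential f t y.

(** The coefficients are quantified before the dimension and the field: this is
    the requirement that those of a B-series do not depend on f. *)
Definition universal (n : nat) (e : field_family) : Prop :=
  exists a, forall d (f : 'cV[R]_d -> 'cV[R]_d), smooth f -> e d f = tree_comb n a f.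

Lemma eq_universal n (e e' : field_family) :
  (forall d (f : 'cV[R]_d -> 'cV[R]_d), smooth f -> e d f = e' d f) ->
  universal n e' -> universal n e.
Proof. by move=> ee' [a ea]; exists a => d f sf; rewrite ee' ?ea. Qed.

Lemma universal0 n : universal n (fun d f y => 0).
Proof.
exists (fun=> 0) => d f _; apply: funext => y; rewrite /tree_comb.
by case: n => [|n]; rewrite ?scale0r // big1 // => t _; rewrite scale0r.
Qed.

Lemma universalD n e e' : universal n e -> universal n e' ->
  universal n (fun d f y => e d f y + e' d f y).
Proof.
move=> [a ea] [b eb]; exists (fun t => a t + b t) => d f sf; apply: funext => y.
rewrite ea // eb // /tree_comb; case: n {ea eb} => [|n]; first by rewrite scalerDl.
by rewrite -big_split; apply: eq_bigr => t _; rewrite scalerDl.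
Qed.

Lemma universalZ n (c : R) e : universal n e -> universal n (fun d f y => c *: e d f y).
Proof.
move=> [a ea]; exists (fun t => c * a t) => d f sf; apply: funext => y.
rewrite ea // /tree_comb; case: n {ea} => [|n]; first by rewrite scalerA.
by rewrite scaler_sumr; apply: eq_bigr => t _; rewrite scalerA.
Qed.

Lemma universal_sum n (T : eqType) (s : seq T) (P : pred T) (e : T -> field_family) :
  (forall x, x \in s -> P x -> universal n (e x)) ->
  universal n (fun d f y => \sum_(x <- s | P x) e x d f y).
Proof.
elim: s => [|x s IHs] us.
  by apply: eq_universal (universal0 n) => d f _; apply: funext => y; rewrite big_nil.
have {}IHs : universal n (fun d f y => \sum_(x <- s | P x) e x d f y).
  by apply: IHs => z zs; apply: us; rewrite in_cons zs orbT.
case Px: (P x); last first.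
  by apply: eq_universal IHs => d f _; apply: funext => y; rewrite big_cons Px.
apply: (eq_universal _ (universalD (us x _ Px) IHs)); last exact: mem_head.
by move=> d f _; apply: funext => y; rewrite big_cons Px.
Qed.

Lemma universal_id : universal 0 (fun d f => id).
Proof. by exists (fun=> 1) => d f _; apply: funext => y; rewrite /tree_comb scale1r. Qed.

Lemma universal_tree t :
  universal (tree_order t) (fun d f => elementary_differential f t).
Proof.
exists (fun u => (u == rooted_rep t)%:R) => d f sf; apply: funext => y.
rewrite /tree_comb; case Eo: (tree_order t) => [|n]; first by have := tree_order_gt0 t; rewrite Eo.
have tn : rooted_rep t \in rooted_trees n.+1.
  by rewrite mem_rooted_trees rooted_rep_rooted rooted_rep_order Eo eqxx.
rewrite (bigD1_seq (rooted_rep t)) ?uniq_rooted_trees //= eqxx scale1r big1 => [|u /negPf ->].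
  by rewrite addr0 elementary_differential_rep.
by rewrite scale0r.
Qed.

Fixpoint all_universal (G : seq (nat * field_family)) : Prop :=
  if G is p :: G' then [/\ (0 < p.1)%N, universal p.1 p.2 & all_universal G'] else True.

Lemma all_universal_cat G G' :
  all_universal (G ++ G') <-> all_universal G /\ all_universal G'.
Proof.
elim: G => [|p G IHG] /=; first by split=> [|[]].
by split=> [[? ? /IHG[]]|[[? ? ?] ?]]; split=> //; apply/IHG.
Qed.

(** By multilinearity, the families in G are expanded one at a time into trees,
    which are moved to us. *)
Lemma universal_field_derive_aux (us : seq ptree) (G : seq (nat * field_family)) :
  all_universal G ->
  universal (sumn (map tree_order us) + sumn (map fst G)).+1
   (fun d f y => field_derive f ([seq elementary_differential f u | u <- us] ++
                                 [seq p.2 d f | p <- G]) y).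
Proof.
elim: G us => [|[k g] G IHG] us /=.
  move=> _; rewrite addn0; apply: (eq_universal _ (universal_tree (PNode us))).
  by move=> d f _; rewrite cats0 elementary_differentialE.
move=> [/= k0 [a ga] uG].
apply: (@eq_universal _ _ (fun d f y => \sum_(t <- rooted_trees k) a t *:
    field_derive f ([seq elementary_differential f u | u <- rcons us t] ++
      [seq p.2 d f | p <- G]) y)).
  move=> d f sf; apply: funext => y; rewrite /field_derive map_cat /= ga // /tree_comb.
  case: k k0 {ga} => // k _; rewrite multi_derive_sum //; apply: eq_bigr => t _.
  by rewrite map_cat map_rcons map_rcons cat_rcons.
apply: universal_sum => t; rewrite mem_rooted_trees => /andP[_ /eqP tk] _.
apply: universalZ; have := IHG (rcons us t) uG.
by rewrite map_rcons sumn_rcons tk -addnA.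
Qed.

Lemma universal_field_derive (G : seq (nat * field_family)) : all_universal G ->
  universal (sumn (map fst G)).+1
    (fun d f => field_derive f [seq p.2 d f | p <- G]).
Proof. exact: (universal_field_derive_aux [::]). Qed.

Lemma smooth_universal n e d (f : 'cV[R]_d -> 'cV[R]_d) :
  universal n e -> smooth f -> smooth (e d f).
Proof.
move=> [a ea] sf; rewrite ea // /tree_comb; case: n {ea} => [|n].
  exact: smooth_scale smooth_id.
apply: smooth_sum => t _; apply: smooth_scale; exact: smooth_elementary_differential.
Qed.

(** The derivative of an elementary differential along a vector field grafts the
    field at each vertex. *)
Lemma universal_lie_tree k w t : (0 < k)%N -> universal k w ->
  universal (tree_order t + k) (fun d f => lie (w d f) (elementary_differential f t)).
Proof.
move=> k0 uw; elim/ptree_mem_ind: t => ts IH.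
pose F u : field_family := fun d f => elementary_differential f u.
pose L u : field_family := fun d f => lie (w d f) (elementary_differential f u).
pose G := [seq (tree_order u, F u) | u <- ts].
have uG us : all_universal [seq (tree_order u, F u) | u <- us].
  by elim: us => //= u us IHus; split=> //; [exact: tree_order_gt0|exact: universal_tree].
have sG d (f : 'cV[R]_d -> 'cV[R]_d) us : smooth f ->
    all_smooth [seq elementary_differential f u | u <- us].
  by move=> sf; elim: us => //= u us; split=> //; apply: smooth_elementary_differential.
pose t0 := PNode [::].
apply: (@eq_universal _ _ (fun d f y =>
   field_derive f [seq p.2 d f | p <- (k, w) :: G] y +
   \sum_(i <- index_iota 0 (size ts)) field_derive f [seq p.2 d f | p <-
     [seq (tree_order u, F u) | u <- take i ts] ++
     (tree_order (nth t0 ts i) + k, L (nth t0 ts i))%N ::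
     [seq (tree_order u, F u) | u <- drop i.+1 ts]] y)).
  move=> d f sf; rewrite elementary_differentialE field_derive_leibniz //; last exact: sG.
  apply: funext => y; rewrite /G /= -map_comp; congr (_ + _).
  rewrite size_map big_mkord; apply: eq_bigr => i _.
  rewrite map_cat /= -!map_comp map_take map_drop (nth_map t0) //.
apply: universalD.
  have UG : all_universal ((k, w) :: G) by split=> //; apply: uG.
  have := universal_field_derive UG.
  by rewrite /G /= -map_comp addnC.
apply: universal_sum => i; rewrite mem_index_iota => /= its _.
set G' := _ ++ _.
have -> : (tree_order (PNode ts) + k = (sumn (map fst G')).+1)%N.
  rewrite /G' map_cat /= -!map_comp /= sumn_cat /= addSn; congr _.+1.
  rewrite -{1}(cat_take_drop i ts) map_cat sumn_cat (drop_nth t0 its) /=.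
  by rewrite -!addnA; congr (_ + (_ + _))%N; rewrite addnC.
apply: universal_field_derive; apply/all_universal_cat; split; first exact: uG.
split=> /=; [by rewrite addn_gt0 k0 orbT|apply: IH; exact: mem_nth|exact: uG].
Qed.

Lemma universal_lie k n w e : (0 < k)%N -> universal k w -> universal n e ->
  universal (n + k) (fun d f => lie (w d f) (e d f)).
Proof.
move=> k0 uw [a ea]; case: n ea => [|n] ea.
  apply: (eq_universal _ (universalZ (a (PNode [::])) uw)) => d f sf.
  rewrite ea //; apply: funext => y.
  rewrite /lie /tree_comb (@deriveZ _ _ _ id) ?derive_id //.
apply: (@eq_universal _ _ (fun d f y => \sum_(t <- rooted_trees n.+1)
   a t *: lie (w d f) (elementary_differential f t) y)).
  move=> d f sf; rewrite ea //; apply: funext => y; rewrite /lie /tree_comb.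
  elim: (rooted_trees n.+1) => [|t s IHs].
    by under eq_fun do rewrite big_nil; rewrite big_nil derive_cst.
  under eq_fun do rewrite big_cons.
  have dt : differentiable (elementary_differential f t) y.
    exact/smooth_differentiable/smooth_elementary_differential.
  have ds : differentiable (fun y => \sum_(t <- s) a t *: elementary_differential f t y) y.
    apply: smooth_differentiable; apply: smooth_sum => u _; apply: smooth_scale.
    exact: smooth_elementary_differential.
  rewrite (@deriveD _ _ _ (fun y => a t *: elementary_differential f t y)); first last.
  - exact: diff_derivable.
  - exact/diff_derivable/differentiableZ.
  by rewrite IHs (@deriveZ _ _ _ (elementary_differential f t)) ?big_cons //; apply: diff_derivable.
apply: universal_sum => t; rewrite mem_rooted_trees => /andP[_ /eqP <-] _.
by apply: universalZ; apply: universal_lie_tree.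
Qed.

End Universal.

(** * The B-series of the method *)

Section FlowComposition.
Context {R : realType} {m n : nat}.
Implicit Types (w Q : 'M[R]_(m, n) -> 'M[R]_(m, n)) (ws : seq ('M[R]_(m, n) -> 'M[R]_(m, n))).

(** For ws = [:: w_K; ...; w_1], the flow of w_1 at time h after that of w_2 at
    time h^2, and so on. Every formal map y + O(h) has this form, and the form is
    convenient because composition acts on the right by Lie series. *)
Fixpoint flow_comp (M : nat) ws (h : R) (y : 'M[R]_(m, n)) : 'M[R]_(m, n) :=
  if ws is w :: ws' then
    flow_comp M ws' h (flow_taylor w M (h ^+ (size ws').+1) y)
  else y.

Fixpoint flow_comp_coef ws Q : nat -> 'M[R]_(m, n) -> 'M[R]_(m, n) :=
  if ws is w :: ws' then flow_coef w (size ws').+1 (flow_comp_coef ws' Q)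
  else fun j => if j is 0 then Q else fun=> 0.

Fixpoint all_smooth_fields ws : Prop :=
  if ws is w :: ws' then smooth w /\ all_smooth_fields ws' else True.

Lemma smooth_flow_comp_coef ws Q j : all_smooth_fields ws -> smooth Q ->
  smooth (flow_comp_coef ws Q j).
Proof.
elim: ws j => [|w ws IHws] j /=; first by case: j => [|j] // _ _ k; apply: Ck_cst.
by move=> [sw sws] sQ; apply: smooth_flow_coef => // l; apply: IHws.
Qed.

Lemma expands_flow_comp M ws Q : all_smooth_fields ws -> smooth Q ->
  expands M (fun h y => Q (flow_comp M ws h y)) (flow_comp_coef ws Q).
Proof.
elim: ws => [|w ws IHws] /=.
  move=> _ sQ; case: M => [|M].
    apply: eq_bigO (bigO_continuous (smooth_continuous sQ)) => h y.
    by rewrite big_ord0 subr0.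
  apply: eq_bigO (bigO0 _) => h y.
  by rewrite big_ord_recl big1 => [|i _]; rewrite ?scaler0 // addr0 expr0 scale1r subrr.
move=> [sw sws] sQ.
apply: (expands_flow (E := fun h y => Q (flow_comp M ws h y))) => // [j|].
  exact: smooth_flow_comp_coef.
exact: IHws.
Qed.

Lemma bigO_flow_comp M ws : all_smooth_fields ws -> bigO (flow_comp M ws) 0.
Proof.
elim: ws => [|w ws IHws] /=; first by move=> _; apply: bigO_id.
move=> [sw sws]; apply: (bigO_subst (E := flow_comp M ws)); last exact: IHws.
rewrite -[0%N](muln0 (size ws).+1); apply: (bigO_pow (E := flow_taylor w M)) => //.
exact: bigO_flow_taylor.
Qed.

Lemma flow_coef_low w K (c : nat -> 'M[R]_(m, n) -> 'M[R]_(m, n)) l :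
  (l < K)%N -> flow_coef w K c l = c l.
Proof.
move=> lK; apply: funext => y; rewrite /flow_coef (big_pred1 ord0) /= => [|i].
  by rewrite muln0 subn0 invr1 scale1r.
rewrite /= -val_eqE /=; case: (nat_of_ord i) => [|j]; first by rewrite muln0.
by apply/negP => le; move: lK; rewrite ltnNge (leq_trans _ le) // leq_pmulr.
Qed.

Lemma flow_coef_first w K (c : nat -> 'M[R]_(m, n) -> 'M[R]_(m, n)) y :
  (0 < K)%N -> flow_coef w K c K y = c K y + lie w (c 0%N) y.
Proof.
case: K => // K _; rewrite /flow_coef big_mkcond big_ord_recl /= muln0 subn0 invr1 scale1r.
congr (_ + _); rewrite big_ord_recl /= muln1 leqnn subnn invr1 scale1r big1 ?addr0 // => i _.
by rewrite /bump /= !add1n -{2}[K.+1]muln1 leq_pmul2l.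
Qed.

Lemma flow_comp_coef0 ws Q : flow_comp_coef ws Q 0 = Q.
Proof. by elim: ws => //= w ws IHws; rewrite flow_coef_low. Qed.

End FlowComposition.

Section ModifiedFlow.
Context {R : realType} {s : nat} (s1 : (1 <= s)%N).

Section Field.
Context {d : nat}.
Implicit Types (f : 'cV[R]_d -> 'cV[R]_d).

(** The coefficient of h^l of P_h(T) - P_(-h)(id), where P_h is [hpoly] of the
    [em_coef f j] and T the composition of the flows of ws. *)
Definition em_residual f ws (l : nat) (y : 'cV[R]_d) : 'cV[R]_d :=
  \sum_(j < 2 * s | (j <= l)%N) flow_comp_coef ws (em_coef f j) (l - j) y -
  (if (l < 2 * s)%N then (-1) ^+ l *: em_coef f l y else 0).

(** Composing with the flow of w at time h^K changes P_h(T) by h^K w + O(h^(K+1)):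
    the choice of w_K cancels the residual in degree K and keeps the lower ones. *)
Fixpoint em_fields f (K : nat) : seq ('cV[R]_d -> 'cV[R]_d) :=
  if K is K'.+1 then (fun y => - em_residual f (em_fields f K') K y) :: em_fields f K'
  else [::].

Lemma size_em_fields f K : size (em_fields f K) = K.
Proof. by elim: K => //= K ->. Qed.

Lemma em_fields_stable f K Q l : (l <= K)%N ->
  flow_comp_coef (em_fields f K) Q l = flow_comp_coef (em_fields f l) Q l.
Proof.
elim: K => [|K IHK]; first by rewrite leqn0 => /eqP ->.
rewrite leq_eqVlt => /predU1P[-> //|lK]; rewrite -IHK //=.
by rewrite flow_coef_low // size_em_fields.
Qed.

Lemma em_residual_eq0 f K l y : (l <= K)%N -> em_residual f (em_fields f K) l y = 0.
Proof.
have s20 : (0 < 2 * s)%N by rewrite muln_gt0.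
elim: K => [|K IHK].
  rewrite leqn0 => /eqP ->; rewrite /em_residual (big_pred1 (Ordinal s20)) => [|j].
    by rewrite s20 /= expr0 scale1r subrr.
  by rewrite /= leqn0 -val_eqE.
rewrite leq_eqVlt => /predU1P[->|lK]; last first.
  rewrite -[RHS](IHK lK) /em_residual; congr (_ - _); apply: eq_bigr => j jl /=.
  by rewrite flow_coef_low // size_em_fields (leq_trans _ lK) // ltnS leq_subr.
set w := fun y => - em_residual f (em_fields f K) K.+1 y.
suff : em_residual f (em_fields f K.+1) K.+1 y =
    em_residual f (em_fields f K) K.+1 y + w y by rewrite /w subrr.
rewrite /em_residual addrAC; congr (_ - _).
rewrite (bigD1 (Ordinal s20)) //= [in RHS](bigD1 (Ordinal s20)) //= [RHS]addrAC.
congr (_ + _); rewrite ?subn0.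
  by rewrite size_em_fields flow_coef_first // flow_comp_coef0 em_coef0 lie_id.
apply: eq_bigr => j /andP[jK j0]; rewrite flow_coef_low // size_em_fields ltnS.
have {}j0 : (0 < j)%N by move: j0; rewrite -val_eqE /= lt0n.
by case: (val j) j0 jK => // i _; rewrite subSS leq_subr.
Qed.

Lemma expands_em_residual M f ws : all_smooth_fields ws -> smooth f ->
  expands M (fun h y => hpoly (em_coef f) (2 * s) h (flow_comp M ws h y) -
                        hpoly (em_coef f) (2 * s) (- h) y) (em_residual f ws).
Proof.
move=> sws sf; apply: expandsB.
  apply: (eq_expands (c := fun l y => \sum_(j < 2 * s)
      (if (j <= l)%N then flow_comp_coef ws (em_coef f j) (l - j) y else 0))).
    by move=> l y _; rewrite [RHS]big_mkcond.
  apply: expands_sum => j _.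
  apply: (@expands_exp _ _ _ M j (fun h y => em_coef f j (flow_comp M ws h y))).
    by apply: smooth_locally_bounded => i; apply: smooth_flow_comp_coef => //; apply: smooth_em_coef.
  by apply: expands_flow_comp => //; apply: smooth_em_coef.
have Oc (j : 'I_(2 * s)) : bigO (fun _ y => (-1) ^+ j *: em_coef f j y) 0.
  by apply: bigO_continuous; apply: smooth_continuous; apply: smooth_scale; apply: smooth_em_coef.
apply: (eq_expands (c := fun l y => \sum_(j < 2 * s | val j == l) (-1) ^+ j *: em_coef f j y)).
  move=> l y _; case: ifPn => [lt|nlt]; first by rewrite (big_pred1 (Ordinal lt)).
  rewrite big_pred0 // => j; apply/negP => /eqP jl; case/negP: nlt; rewrite -jl; exact: ltn_ord.
apply: eq_bigO (@expands_monomials _ _ _ M _ (fun j : 'I_(2 * s) => val j) _ Oc) => h y; congr (_ - _).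
apply: eq_bigr => j _; rewrite [RHS]scalerA; congr (_ *: _).
by rewrite [LHS]exprNn mulrC.
Qed.

End Field.

Definition em_family (K : nat) : field_family (R := R) :=
  fun d f y => - em_residual f (em_fields f K) K.+1 y.

Definition em_series_coef (l : nat) : field_family (R := R) :=
  fun d f => flow_comp_coef (em_fields f l) id l.

Lemma universal_em_coef j : universal j (fun d (f : 'cV[R]_d -> 'cV[R]_d) => em_coef f j).
Proof.
apply: universalZ; elim: j => [|j IHj]; first exact: universal_id.
have u1 : universal (R := R) 1 (fun d f => f).
  apply: eq_universal (universal_tree (PNode [::])) => d f _; exact: funext.
by have := universal_lie (isT : (0 < 1)%N) u1 IHj; rewrite addn1.
Qed.

Lemma universal_lie_iter k n w e i : (0 < k)%N -> universal k w -> universal n e ->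
  universal (n + k * i) (fun d f => iter i (lie (w d f)) (e d f) : 'cV[R]_d -> _).
Proof.
move=> k0 uw ue; elim: i => [|i IHi]; first by rewrite muln0 addn0.
have := universal_lie k0 uw IHi.
by rewrite mulnS [(k + _)%N]addnC addnA.
Qed.

Lemma universal_em_family_aux K :
  (forall q Q, universal q Q -> forall j, universal (q + j)
    (fun d (f : 'cV[R]_d -> 'cV[R]_d) => flow_comp_coef (em_fields f K) (Q d f) j)) ->
  universal K.+1 (em_family K).
Proof.
move=> IHK; apply: (@eq_universal _ _ _ (fun d f y => -1 *: em_residual f (em_fields f K) K.+1 y)).
  by move=> d f _; apply: funext => y; rewrite scaleN1r.
apply: universalZ; apply: (@eq_universal _ _ _ (fun d f y =>
    \sum_(j < 2 * s | (j <= K.+1)%N) flow_comp_coef (em_fields f K) (em_coef f j) (K.+1 - j) y +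
    (if (K.+1 < 2 * s)%N then - (-1) ^+ K.+1 else 0) *: em_coef f K.+1 y)).
  move=> d f _; apply: funext => y; rewrite /em_residual; congr (_ + _).
  by case: ifP => _; rewrite ?scaleNr // oppr0 scale0r.
apply: universalD; last by apply: universalZ; apply: universal_em_coef.
apply: universal_sum => j _ jK; rewrite -{1}(subnKC jK).
exact: IHK (universal_em_coef j) _.
Qed.

(** The coefficients are made of Lie derivatives along the fields w_K, which are
    themselves coefficients of this kind in lower degree. *)
Lemma universal_flow_comp_coef K q Q : universal q Q -> forall j, universal (q + j)
    (fun d (f : 'cV[R]_d -> 'cV[R]_d) => flow_comp_coef (em_fields f K) (Q d f) j).
Proof.
elim: K q Q => [|K IHK] q Q uQ j.
  case: j => [|j]; rewrite ?addn0 //=; exact: universal0.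
have uw := universal_em_family_aux IHK.
apply: (@eq_universal _ _ _ (fun d f => flow_coef (em_family K f) K.+1
    (flow_comp_coef (em_fields f K) (Q d f)) j)).
  by move=> d f _; rewrite /= size_em_fields.
apply: universal_sum => i _ le; apply: universalZ.
rewrite -{1}(subnK le) addnA; apply: (universal_lie_iter i) => //.
exact: IHK.
Qed.

Lemma universal_em_family K : universal K.+1 (em_family K).
Proof. by apply: universal_em_family_aux; apply: universal_flow_comp_coef. Qed.

Lemma universal_em_series_coef l : universal l (em_series_coef l).
Proof. exact: (universal_flow_comp_coef l (@universal_id R)). Qed.

Lemma smooth_em_fields d (f : 'cV[R]_d -> 'cV[R]_d) K : smooth f ->
  all_smooth_fields (em_fields f K).
Proof.
move=> sf; elim: K => //= K IHK; split=> //.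
exact: (smooth_universal (universal_em_family K)).
Qed.

(** The composition of flows solves the implicit equation up to O(h^(N+1)), and
    the solutions of this equation close to y are stable by [implicit_close]. *)
Lemma em_expands d (f : 'cV[R]_d -> 'cV[R]_d) Psi N : smooth f ->
  is_EulerMaclaurin s f Psi -> expands N.+1 Psi (fun l => em_series_coef l f).
Proof.
move=> sf [eqPsi Psi1]; have sws := smooth_em_fields N sf.
apply: (eq_expands (c := flow_comp_coef (em_fields f N) id)).
  by move=> l y lN; rewrite em_fields_stable.
apply: (expands_close (F := flow_comp N.+1 (em_fields f N))); last first.
  exact: (expands_flow_comp N.+1 sws (@smooth_id R d 1)).
apply: (@implicit_close _ _ _ (em_coef f) (2 * s)).
- by rewrite muln_gt0.
- exact: em_coef0.
- by move=> j; apply: smooth_em_coef.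
- exact: bigO_close0 Psi1.
- exact: bigO_flow_comp.
apply: (@bigO_near _ _ _ _ (fun h y => - (hpoly (em_coef f) (2 * s) h
   (flow_comp N.+1 (em_fields f N) h y) - hpoly (em_coef f) (2 * s) (- h) y))).
  move=> r; apply: filterS (eqPsi r) => h eqh y yr; rewrite opprB; congr (_ - _).
  by apply/EulerMaclaurin_hpoly => //; apply: eqh.
apply: bigON; apply: eq_bigO (expands_em_residual N.+1 sws sf) => h y.
by rewrite big1 ?subr0 // => l _; rewrite em_residual_eq0 ?scaler0 // -ltnS.
Qed.

Theorem EulerMaclaurin_Bseries : exists (a_empty : R) (a : ptree -> R),
  forall (d : nat) (f : 'cV[R]_d -> 'cV[R]_d) (Psi : R -> 'cV[R]_d -> 'cV[R]_d),
    smooth f -> is_EulerMaclaurin s f Psi -> is_Bseries f Psi a_empty a.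
Proof.
have [b bP] := choice universal_em_series_coef.
(* The normalization of a B-series divides the coefficient of t by sigma(t). *)
exists 1, (fun t => (symmetry t)%:R * b (tree_order t) t) => d f Psi sf isPsi N.
apply: eq_bigO (em_expands N sf isPsi) => h y; congr (_ - _).
rewrite big_ord_recl expr0 !scale1r; congr (_ + _).
rewrite big_add1 big_mkord; apply: eq_bigr => l _; rewrite lift0.
rewrite bP // /tree_comb scaler_sumr; apply: eq_big_seq => t.
rewrite mem_rooted_trees => /andP[_ /eqP <-]; rewrite scalerA; congr (_ *: _).
by rewrite mulrA divfK // pnatr_eq0 -lt0n symmetry_gt0.
Qed.

End ModifiedFlow.

(** * Almost conserved quantities of the method *)

Lemma euler_maclaurin_coefR (R : realType) (s m : nat) : (1 <= s)%N -> (m <= 2 * s + 2)%N ->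
  \sum_(j < 2 * s | (j <= m)%N) bernR j / (m - j)`!%:R
    - (if (m < 2 * s)%N then (-1) ^+ m * bernR m else 0) =
  - (m == 2 * s + 1)%N%:R * bernR (2 * s)
  - (m == 2 * s + 2)%N%:R / 2 * bernR (2 * s) :> R.
Proof.
move=> s1 /(euler_maclaurin_coef s1) /(congr1 (ratr : rat -> R)).
rewrite /bernR; move: bernoulli_coef => B.
rewrite !rmorphB /= !rmorphM /= rmorphN fmorphV !rmorph_nat rmorph_sum /= => <-.
congr (_ - _); first by apply: eq_bigr => j _; rewrite fmorph_div rmorph_nat.
by case: ifP => _; rewrite ?rmorph0 // rmorphM rmorph_sign.
Qed.

Lemma bernR0 (R : realType) : bernR 0 = 1 :> R.
Proof. by rewrite /bernR bernoulli_coef0 rmorph1. Qed.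

Lemma bernR1 (R : realType) : bernR 1 = - 2^-1 :> R.
Proof. by rewrite /bernR bernoulli_coef1 rmorphN fmorphV rmorph_nat. Qed.

Section LieAlgebra.
Context {R : realType} {m n m' n' : nat}.
Implicit Types (w : 'M[R]_(m, n) -> 'M[R]_(m, n)) (Q P : 'M[R]_(m, n) -> 'M[R]_(m', n')).

Lemma lieD w Q P : smooth Q -> smooth P ->
  lie w (fun y => Q y + P y) = fun y => lie w Q y + lie w P y.
Proof.
move=> sQ sP; apply: funext => y.
by rewrite /lie (@deriveD _ _ _ Q P) //; apply/diff_derivable/smooth_differentiable.
Qed.

Lemma lieZ w (c : R) Q : smooth Q ->
  lie w (fun y => c *: Q y) = fun y => c *: lie w Q y.
Proof.
move=> sQ; apply: funext => y.
by rewrite /lie (@deriveZ _ _ _ Q) //; apply/diff_derivable/smooth_differentiable.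
Qed.

Lemma lie0 w : lie w (fun _ => 0 : 'M[R]_(m', n')) = fun _ => 0.
Proof. by apply: funext => y; rewrite /lie derive_cst. Qed.

Lemma smoothD Q P : smooth Q -> smooth P -> smooth (fun y => Q y + P y).
Proof. by move=> sQ sP k; apply: CkD. Qed.

Lemma lie_sum w N (F : 'I_N -> 'M[R]_(m, n) -> 'M[R]_(m', n')) :
  (forall i, smooth (F i)) ->
  lie w (fun y => \sum_i F i y) = fun y => \sum_i lie w (F i) y.
Proof.
move=> sF; apply: funext => y; rewrite /lie.
have -> : (fun y => \sum_i F i y) = \sum_i F i by apply: funext => z; rewrite fct_sumE.
by rewrite derive_sum // => i; apply/diff_derivable/smooth_differentiable.
Qed.

Lemma lieZl w (c : R) Q : smooth Q ->
  lie (fun y => c *: w y) Q = fun y => c *: lie w Q y.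
Proof.
by move=> sQ; apply: funext => y; rewrite /lie deriveZr //; apply: smooth_differentiable.
Qed.

Lemma lie_iter0 w i : iter i (lie w) (fun _ => 0 : 'M[R]_(m', n')) = fun _ => 0.
Proof. by elim: i => //= i ->; apply: lie0. Qed.

End LieAlgebra.

Section StrangSplitting.
Context {R : realType} {s : nat} (s1 : (1 <= s)%N) {m n : nat}.
Variable F : 'M[R]_(m, n) -> 'M[R]_(m, n).
Hypothesis sF : smooth F.

Let b : R := bernR (2 * s).
Let K : nat := (2 * s + 1)%N.
Let M : nat := (2 * s + 3)%N.
Let D m' n' := @lie R m n m' n' F.

(** The modified equation of the method is y' = F + b h^(2s) D^(2s) F + O(h^(2s+2)),
    where D is the derivative along F; this is the field D^(2s) F. *)
Definition leading_defect : 'M[R]_(m, n) -> 'M[R]_(m, n) := iter (2 * s + 1) (lie F) id.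

Let w := fun y => (b / 2) *: leading_defect y.

Lemma smooth_leading_defect : smooth leading_defect.
Proof. exact: smooth_lie_iter sF smooth_id. Qed.

Let sY := smooth_leading_defect.

Let sw : smooth w. Proof. exact: smooth_scale. Qed.

(** Symmetric composition of the flow of F with two half-steps of the flow of
    b times the leading defect: being symmetric, it agrees with the flow of the
    modified equation up to O(h^(2s+3)). *)
Definition strang (h : R) (y : 'M[R]_(m, n)) : 'M[R]_(m, n) :=
  flow_taylor w M (h ^+ K) (flow_taylor F M (h ^+ 1) (flow_taylor w M (h ^+ K) y)).

(** The three terms come from the flow of F, the leading defect in degree 2s+1,
    and its two compositions with F in degree 2s+2. *)
Definition strang_coef m' n' (Q : 'M[R]_(m, n) -> 'M[R]_(m', n')) (l : nat) y :=
  (l`!%:R)^-1 *: iter l (lie F) Q y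
  + (l == 2 * s + 1)%N%:R *: (b *: lie leading_defect Q y)
  + (l == 2 * s + 2)%N%:R *: ((b / 2) *: (lie F (lie leading_defect Q) y +
                                          lie leading_defect (lie F Q) y)).

Lemma flow_coef_two m' n' (v : 'M[R]_(m, n) -> 'M[R]_(m, n))
    (c : nat -> 'M[R]_(m, n) -> 'M[R]_(m', n')) l y : (l < 2 * K)%N ->
  flow_coef v K c l y = c l y + (if (K <= l)%N then lie v (c (l - K)%N) y else 0).
Proof.
move=> l2; rewrite /flow_coef big_mkcond big_ord_recl /= muln0 subn0 invr1 scale1r.
congr (_ + _); case: l l2 => [|l] l2; first by rewrite big_ord0 /K addn1.
rewrite big_ord_recl /= muln1 big1 ?addr0 => [|i _].
  by case: ifP => // _; rewrite invr1 scale1r.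
rewrite /bump /= !add1n ifF //; apply/negP => le; move: l2; rewrite ltnNge mulnC.
by rewrite (leq_trans _ le) // leq_mul2l orbT.
Qed.

Lemma flow_coef_unit m' n' (v : 'M[R]_(m, n) -> 'M[R]_(m, n))
    (c : nat -> 'M[R]_(m, n) -> 'M[R]_(m', n')) l y :
  flow_coef v 1 c l y = \sum_(i < l.+1) (i`!%:R)^-1 *: iter i (lie v) (c (l - i)%N) y.
Proof.
rewrite /flow_coef; apply: eq_big => i; last by rewrite mul1n.
by rewrite mul1n -ltnS ltn_ord.
Qed.

(** Two Lie operators of the defect would give degree 2(2s+1) > 2s+2, and so at
    most one of them appears. *)
Lemma expands_strang m' n' (Q : 'M[R]_(m, n) -> 'M[R]_(m', n')) : smooth Q ->
  expands M (fun h y => Q (strang h y)) (strang_coef Q).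
Proof.
move=> sQ; pose c0 (j : nat) := if j is 0 then Q else fun=> 0.
have sc0 j : smooth (c0 j) by case: j => [|j] // k; apply: Ck_cst.
have E0 : expands M (fun _ y => Q y) c0.
  apply: eq_bigO (bigO0 _) => h y; rewrite /M addn3 big_ord_recl big1 => [|i _].
    by rewrite addr0 expr0 scale1r subrr.
  by rewrite scaler0.
have K0 : (0 < K)%N by rewrite /K addn1.
have E1 := expands_flow K0 sw sc0 E0; have sc1 := smooth_flow_coef K sw sc0.
have E2 := expands_flow (ltn0Sn 0) sF sc1 E1; have sc2 := smooth_flow_coef 1 sF sc1.
have := expands_flow K0 sw sc2 E2; apply: eq_expands => l y lM.
have lK : (l < 2 * K)%N by move: lM; rewrite /M /K; lia.
have K20 : (0 < 2 * K)%N by rewrite muln_gt0.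
have lwQ : lie w Q = fun y => (b / 2) *: lie leading_defect Q y by apply: lieZl.
have slQ : smooth (lie leading_defect Q) by apply: smooth_lie.
have c1E j : (j < 2 * K)%N -> flow_coef w K c0 j =
    if j == 0 then Q else if j == K then lie w Q else fun=> 0.
  move=> jK; apply: funext => z; rewrite flow_coef_two //.
  case: j jK => [|j] jK; first by rewrite leqNgt K0 addr0.
  rewrite /= add0r; case: ifPn => [Kj|nKj].
    have [->|ne] := eqVneq j.+1 K; first by rewrite subnn.
    have : (j.+1 - K != 0)%N by rewrite subn_eq0 -ltnNge ltn_neqAle eq_sym ne.
    by case: (j.+1 - K)%N => // i _; rewrite /= lie0.
  by rewrite ifF //; apply: contraNF nKj => /eqP ->.
have c2E j : (j < 2 * K)%N -> flow_coef F 1 (flow_coef w K c0) j =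
    fun z => (j`!%:R)^-1 *: iter j (lie F) Q z +
     (if (K <= j)%N then ((j - K)`!%:R)^-1 *: iter (j - K) (lie F) (lie w Q) z else 0).
  move=> jK; apply: funext => z; rewrite flow_coef_unit big_ord_recr /= subnn (c1E 0%N K20) /= addrC.
  congr (_ + _); rewrite (eq_bigr (fun i : 'I_j => if (j - i == K)%N then
      (i`!%:R)^-1 *: iter i (lie F) (lie w Q) z else 0)) => [|i _]; last first.
    rewrite c1E ?(leq_ltn_trans (leq_subr _ _)) // subn_eq0 leqNgt ltn_ord /=.
    by case: ifP => // _; rewrite lie_iter0 scaler0.
  rewrite -big_mkcond /=; case: leqP => [Kj|jltK].
    have lt : (j - K < j)%N by rewrite ltn_subrL K0 (leq_trans K0 Kj).
    rewrite (big_pred1 (Ordinal lt)) // => i; rewrite /= -val_eqE /=.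
    by have ij := ltn_ord i; apply/eqP/eqP; lia.
  rewrite big_pred0 // => i; apply/negP => /eqP ji; move: jltK.
  by rewrite -ji ltnNge leq_subr.
rewrite flow_coef_two // c2E // /strang_coef -[(2 * s + 1)%N]/K.
have [ltlK|geKl] := ltnP l K.
  rewrite !addr0 (ltn_eqF ltlK) ltn_eqF ?scale0r ?addr0 //.
  by move: ltlK; rewrite /K; lia.
have : (l == K) || (l == K.+1) by move: lM geKl; rewrite /M /K; lia.
have KE : (2 * s + 2)%N = K.+1 by rewrite /K; lia.
have K2 : (1 < K)%N by rewrite /K; lia.
clearbody K.
rewrite KE => /orP[] /eqP ->.
  rewrite !subnn eqxx (ltn_eqF (ltnSn K)) scale1r scale0r [RHS]addr0 -addrA; congr (_ + _).
  rewrite (c2E 0%N K20) leqNgt K0 /= invr1 scale1r.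
  have -> : (fun z => 1 *: Q z + 0) = Q by apply: funext => z; rewrite scale1r addr0.
  by rewrite lwQ -scalerDl; congr (_ *: _); lra.
rewrite !subSnn !(gtn_eqF (ltnSn K)) eqxx scale1r scale0r addr0 -addrA; congr (_ + _).
rewrite c2E; last by move: K2; lia.
rewrite leqNgt K2 /= invr1 !scale1r scalerDr; congr (_ + _).
  by rewrite lwQ lieZ.
have -> : (fun z => 1 *: lie F Q z + 0) = lie F Q.
  by apply: funext => z; rewrite scale1r addr0.
exact: (congr1 (fun u => u y) (lieZl leading_defect (b / 2) (smooth_lie sF sQ))).
Qed.

Lemma bigO_strang : bigO strang 0.
Proof.
have O1 (v : 'M[R]_(m, n) -> 'M[R]_(m, n)) k : (0 < k)%N -> smooth v ->
    bigO (fun h => flow_taylor v M (h ^+ k)) 0.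
  move=> k0 sv; rewrite -[0%N](muln0 k); apply: (bigO_pow (E := flow_taylor v M)) k0 _.
  exact: bigO_flow_taylor.
have K0 : (0 < K)%N by rewrite /K addn1.
exact: (bigO_subst (O1 w K K0 sw) (bigO_subst (O1 F 1%N isT sF) (O1 w K K0 sw))).
Qed.

Lemma smooth_strang_coef m' n' (Q : 'M[R]_(m, n) -> 'M[R]_(m', n')) l : smooth Q ->
  smooth (strang_coef Q l).
Proof.
move=> sQ; have slF (P : 'M[R]_(m, n) -> 'M[R]_(m', n')) : smooth P -> smooth (lie F P).
  exact: smooth_lie.
have slY (P : 'M[R]_(m, n) -> 'M[R]_(m', n')) : smooth P -> smooth (lie leading_defect P).
  exact: smooth_lie.
apply: smoothD; first apply: smoothD; apply: smooth_scale.
- exact: smooth_lie_iter.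
- exact/smooth_scale/slY.
- apply: smooth_scale; apply: smoothD; [exact/slF/slY|exact/slY/slF].
Qed.

(** The terms of the flow of F are summed by [euler_maclaurin_coef]: they vanish
    up to degree 2s and leave -b D^(2s+1) id in degree 2s+1, and half of
    -b D^(2s+2) id in degree 2s+2. These are cancelled by the defect, where in
    degree 2s+2 the coefficient B_1 = -1/2 of the method leaves one of the two
    orders of composition. *)
Lemma strang_residual :
  bigO (fun h y => hpoly (em_coef F) (2 * s) h (strang h y) -
                   hpoly (em_coef F) (2 * s) (- h) y) M.
Proof.
have sE j : smooth (em_coef F j) by apply: smooth_em_coef.
pose c (l : nat) y := \sum_(j < 2 * s)
  (if (j <= l)%N then strang_coef (em_coef F j) (l - j) y else 0) -
  \sum_(j < 2 * s | val j == l) (-1) ^+ j *: em_coef F j y.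
have Oc (j : 'I_(2 * s)) : bigO (fun _ y => (-1) ^+ j *: em_coef F j y) 0.
  exact/bigO_continuous/smooth_continuous/smooth_scale.
have ex : expands M (fun h y => hpoly (em_coef F) (2 * s) h (strang h y) -
                   hpoly (em_coef F) (2 * s) (- h) y) c.
  apply: expandsB.
    apply: expands_sum => j _.
    apply: (@expands_exp _ _ _ M j (fun h y => em_coef F j (strang h y))); last exact: expands_strang.
    by apply: smooth_locally_bounded => i; apply: smooth_strang_coef.
  apply: eq_bigO (@expands_monomials _ _ _ M _ (fun j : 'I_(2 * s) => val j) _ Oc) => h y.
  congr (_ - _); apply: eq_bigr => j _; rewrite [RHS]scalerA; congr (_ *: _).
  by rewrite [LHS]exprNn mulrC.
apply: eq_bigO ex => h y; rewrite big1 ?subr0 // => l _.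
suff -> : c l y = 0 by rewrite scaler0.
have lM := ltn_ord l; move: (val l) lM => {}l lM; rewrite /c /strang_coef.
pose Y j := iter j (lie F) id.
have sYj j : smooth (Y j) by exact: smooth_lie_iter sF smooth_id.
have YE j k : iter k (lie F) (em_coef F j) = fun y => bernR j *: Y (k + j)%N y.
  by elim: k => // k IHk; rewrite iterS IHk lieZ.
have LE j : lie leading_defect (em_coef F j) = fun y => bernR j *: lie leading_defect (Y j) y.
  exact: (lieZ leading_defect (bernR j) (sYj j)).
have KK : (2 * s + 2)%N = K.+1 by rewrite /K; lia.
have K0 : (0 < K)%N by rewrite /K addn1.
have s20 : (0 < 2 * s)%N by lia.
have s21 : (1 < 2 * s)%N by lia.
(* T0-T3 collect the contributions to degree l of P_(-h), of the flow of F and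
   of the defect in its degrees 2s+1 and 2s+2. *)
pose x2 j := b *: (bernR j *: lie leading_defect (Y j) y).
pose x3 j := (b / 2) *: (bernR j *: (lie F (lie leading_defect (Y j)) y +
                                     lie leading_defect (Y j.+1) y)).
have pick k (x : nat -> 'M[R]_(m, n)) : (l - k < 2 * s)%N ->
    \sum_(j < 2 * s) (if (j <= l)%N then (l - j == k)%N%:R *: x j else 0) =
    if (k <= l)%N then x (l - k)%N else 0.
  move=> lk; rewrite (eq_bigr (fun j : 'I_(2 * s) =>
      if (j <= l)%N && (l - j == k)%N then x j else 0)) => [|j _]; last first.
    by case: ifP => //= _; case: ifP => _; rewrite ?scale1r ?scale0r.
  rewrite -big_mkcond /=; case: leqP => [kl|lk'].
    rewrite (big_pred1 (Ordinal lk)) // => j; rewrite /= -val_eqE /=.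
    by apply/andP/eqP; lia.
  by rewrite big_pred0 // => j; apply/negP => /andP[jl /eqP]; lia.
have T0 : \sum_(j < 2 * s | val j == l) (-1) ^+ j *: em_coef F j y =
    (if (l < 2 * s)%N then (-1) ^+ l * bernR l else 0) *: Y l y.
  case: ifPn => [lt|nlt]; first by rewrite (big_pred1 (Ordinal lt)) // -scalerA.
  rewrite scale0r big_pred0 // => j; apply/negP => /eqP jl; case/negP: nlt.
  rewrite -jl; exact: ltn_ord.
have T1 : \sum_(j < 2 * s) (if (j <= l)%N then
      ((l - j)`!%:R)^-1 *: iter (l - j) (lie F) (em_coef F j) y else 0) =
    (\sum_(j < 2 * s | (j <= l)%N) bernR j / (l - j)`!%:R) *: Y l y.
  rewrite scaler_suml [RHS]big_mkcond; apply: eq_bigr => j _; case: ifP => // jl.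
  by rewrite YE subnK // scalerA mulrC.
have T2 : \sum_(j < 2 * s) (if (j <= l)%N then (l - j == K)%N%:R *:
      (b *: lie leading_defect (em_coef F j) y) else 0) =
    (if (K <= l)%N then x2 (l - K)%N else 0).
  apply: etrans _ (pick K x2 _); last by move: lM; rewrite /M /K; lia.
  by apply: eq_bigr => j _; rewrite LE.
have T3 : \sum_(j < 2 * s) (if (j <= l)%N then (l - j == K.+1)%N%:R *:
      ((b / 2) *: (lie F (lie leading_defect (em_coef F j)) y +
                   lie leading_defect (lie F (em_coef F j)) y)) else 0) =
    (if (K.+1 <= l)%N then x3 (l - K.+1)%N else 0).
  apply: etrans _ (pick K.+1 x3 _); last by move: lM; rewrite /M /K; lia.
  apply: eq_bigr => j _; case: ifP => // _; congr (_ *: (_ *: _)).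
  rewrite -[lie F (em_coef F j)]/(iter 1 (lie F) (em_coef F j)) (YE j 1%N).
  rewrite (lieZ leading_defect (bernR j) (sYj _)) LE.
  by rewrite (lieZ F (bernR j) (smooth_lie sY (sYj j))) scalerDr.
rewrite KK -[(2 * s + 1)%N]/K T0.
rewrite (eq_bigr (fun j : 'I_(2 * s) =>
   (if (j <= l)%N then ((l - j)`!%:R)^-1 *: iter (l - j) (lie F) (em_coef F j) y else 0) +
   (if (j <= l)%N then (l - j == K)%N%:R *:
      (b *: lie leading_defect (em_coef F j) y) else 0) +
   (if (j <= l)%N then (l - j == K.+1)%N%:R *:
      ((b / 2) *: (lie F (lie leading_defect (em_coef F j)) y +
                   lie leading_defect (lie F (em_coef F j)) y)) else 0))) => [|j _]; last first.
  by case: ifP => // _; rewrite !addr0.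
rewrite !big_split /= T1 T2 T3.
transitivity ((\sum_(j < 2 * s | (j <= l)%N) bernR j / (l - j)`!%:R -
     (if (l < 2 * s)%N then (-1) ^+ l * bernR l else 0)) *: Y l y +
   (if (K <= l)%N then x2 (l - K)%N else 0) + (if (K.+1 <= l)%N then x3 (l - K.+1)%N else 0)).
  rewrite scalerBl; set A1 := _ *: Y l y; set A0 := _ *: Y l y.
  set A2 := if _ then _ else _; set A3 := if _ then _ else _.
  by rewrite -!addrA; congr (_ + _); rewrite [RHS]addrC -addrA.
have -> : \sum_(j < 2 * s | (j <= l)%N) bernR j / (l - j)`!%:R -
     (if (l < 2 * s)%N then (-1) ^+ l * bernR l else 0) =
     - (l == K)%N%:R * b - (l == K.+1)%N%:R / 2 * b.
  have lM' : (l <= 2 * s + 2)%N by move: lM; rewrite /M; lia.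
  by rewrite (euler_maclaurin_coefR R s1 lM') -KK.
have [ltlK|geKl] := ltnP l K.
  by rewrite ltnNge (ltnW ltlK) /= (ltn_eqF ltlK) (ltn_eqF (leqW ltlK)) oppr0 !mul0r subrr scale0r !addr0.
have : (l == K) || (l == K.+1) by move: lM geKl; rewrite /M /K; lia.
case/orP => /eqP ->.
  rewrite ltnn eqxx (ltn_eqF (ltnSn K)) subnn /x2 bernR0 scale1r /Y lie_id.
  by rewrite !mul0r subr0 addr0 mulN1r scaleNr addNr.
rewrite ltnSn subnn subSnn eqxx (gtn_eqF (ltnSn K)) /x2 /x3 bernR0 bernR1 scale1r.
rewrite /Y lie_id [iter 1 _ _]/= lie_id oppr0 mul0r sub0r.
rewrite scalerDr scalerA mulrN !scaleNr addrACA addNr addr0.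
by rewrite div1r [2^-1 * b]mulrC addNr.
Qed.

End StrangSplitting.

Section AlmostConserved.
Context {R : realType}.

Lemma expands_leq (V W : normedModType R) M M' (E : R -> V -> W) c : (M' <= M)%N ->
  locally_bounded c -> expands M E c -> expands M' E c.
Proof.
move=> le Oc /(bigO_leq le) EM.
have OT : bigO (fun h y => \sum_(M' <= j < M) h ^+ j *: c j y) M'.
  rewrite (_ : (fun h y => _) = fun h y => \sum_(j <- index_iota M' M | (M' <= j)%N) h ^+ j *: c j y).
    apply: bigO_sum => j jM; apply: (bigO_leq jM).
    by rewrite -[X in bigO _ X]addn0; apply: bigO_exp; apply: Oc.
  by apply: funext => h; apply: funext => y; rewrite big_nat_cond; under eq_bigl do rewrite andbAC;
    rewrite [RHS]big_nat_cond; apply: eq_bigl => j; rewrite andbT; case: (M' <= j)%N => //=; rewrite andbT.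
apply: eq_bigO (bigOD EM OT) => h y.
have -> : \sum_(j < M) h ^+ j *: c j y =
    \sum_(j < M') h ^+ j *: c j y + \sum_(M' <= j < M) h ^+ j *: c j y.
  by rewrite -!(big_mkord predT (fun j => h ^+ j *: c j y)) (big_cat_nat (n := M')).
by rewrite opprD addrA subrK.
Qed.

Context {s : nat} (s1 : (1 <= s)%N) {m n : nat}.
Variable F : 'M[R]_(m, n) -> 'M[R]_(m, n).
Hypothesis sF : smooth F.
Variable Psi : R -> 'M[R]_(m, n) -> 'M[R]_(m, n).
Hypothesis Psi0 : bigO Psi 0.
Hypothesis eqPsi : forall r : R, \forall h \near (0 : R), forall y, `|y| <= r ->
  hpoly (em_coef F) (2 * s) h (Psi h y) = hpoly (em_coef F) (2 * s) (- h) y.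

Lemma expands_method m' n' (Q : 'M[R]_(m, n) -> 'M[R]_(m', n')) : smooth Q ->
  expands (2 * s + 3) (fun h y => Q (Psi h y)) (strang_coef (s := s) F Q).
Proof.
move=> sQ; apply: (expands_close _ (expands_strang s1 sF sQ)).
have Ostr := bigO_strang (s := s) sF.
apply: bigO_lipschitz => //.
apply: (@implicit_close _ _ _ (em_coef F) (2 * s)) => //.
- by rewrite muln_gt0.
- exact: em_coef0.
- by move=> j; apply: smooth_em_coef.
apply: (@bigO_near _ _ _ _ (fun h y => - (hpoly (em_coef F) (2 * s) h
   (strang (s := s) F h y) - hpoly (em_coef F) (2 * s) (- h) y))).
  by move=> r; apply: filterS (eqPsi r) => h eqh y yr; rewrite opprB eqh.
exact: bigON (strang_residual s1 sF).
Qed.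

(** Let D and E be the derivatives along F and along b times the leading defect.
    As D Q0 = 0 and E Q0 = D Q1, the expansion of Q0 along the method is
    Q0 + h^(2s+1) D Q1 + h^(2s+2)/2 D^2 Q1 + O(h^(2s+3)), which is also that of
    Q0 + h^(2s) (Q1(Psi) - Q1). The term of Q2 changes
    by O(h^(4s+1)) only; it serves to complete a square. *)
Theorem almost_conserved m' n' (Q0 Q1 Q2 : 'M[R]_(m, n) -> 'M[R]_(m', n')) :
  smooth Q0 -> smooth Q1 -> smooth Q2 ->
  lie F Q0 = (fun _ => 0) ->
  (fun y => bernR (2 * s) *: lie (leading_defect (s := s) F) Q0 y) = lie F Q1 ->
  let Q h y := Q0 y - h ^+ (2 * s) *: Q1 y + h ^+ (4 * s) *: Q2 y in
  bigO (fun h y => Q h (Psi h y) - Q h y) (2 * s + 3).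
Proof.
move=> sQ0 sQ1 sQ2 DQ0 EQ0 Q; set Y := leading_defect F in EQ0 *.
have sY : smooth Y by apply: smooth_leading_defect.
have Oc m0 n0 (P : 'M[R]_(m, n) -> 'M[R]_(m0, n0)) : smooth P ->
    locally_bounded (strang_coef (s := s) F P).
  by move=> sP; apply: smooth_locally_bounded => j; apply: smooth_strang_coef.
have X0 := expands_method sQ0.
have le3 : (3 <= 2 * s + 3)%N by rewrite leq_addl.
have le1 : (1 <= 2 * s + 3)%N by rewrite addn3.
have X1 := expands_leq le3 (Oc _ _ _ sQ1) (expands_method sQ1).
have X2 := expands_leq le1 (Oc _ _ _ sQ2) (expands_method sQ2).
have O2 : bigO (fun h y => h ^+ (4 * s) *: (Q2 (Psi h y) - \sum_(j < 1) h ^+ j *: strang_coef (s := s) F Q2 j y)) (2 * s + 3).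
  by apply: (bigO_leq _ (bigO_exp (4 * s) X2)); lia.
have O1 := bigO_exp (2 * s) X1.
apply: eq_bigO (bigOD (bigOB X0 O1) O2) => h y.
have cQ1 l : (l < 3)%N -> strang_coef (s := s) F Q1 l y = (l`!%:R)^-1 *: iter l (lie F) Q1 y.
  move=> l3; rewrite /strang_coef ltn_eqF; last by lia.
  by rewrite ltn_eqF ?scale0r ?addr0 //; lia.
have cst0 m0 n0 (P : 'M[R]_(m, n) -> 'M[R]_(m0, n0)) : strang_coef (s := s) F P 0 y = P y.
  rewrite /strang_coef ltn_eqF; last by lia.
  by rewrite ltn_eqF ?scale0r ?addr0 ?invr1 ?scale1r //=; lia.
have it0 l : iter l.+1 (lie F) Q0 = fun _ => 0 by rewrite iterSr DQ0 lie_iter0.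
have cQ0 l : (l < 2 * s)%N -> strang_coef (s := s) F Q0 l.+1 y = 0.
  move=> l2; rewrite /strang_coef it0 ltn_eqF; last by lia.
  by rewrite ltn_eqF ?scale0r ?addr0 ?scaler0 //; lia.
have cQ0a : strang_coef (s := s) F Q0 (2 * s).+1 y = lie F Q1 y.
  rewrite /strang_coef it0 -addn1 eqxx ltn_eqF; last by lia.
  by rewrite scaler0 add0r scale1r scale0r addr0 -EQ0.
have cQ0b : strang_coef (s := s) F Q0 (2 * s).+2 y = 2^-1 *: lie F (lie F Q1) y.
  rewrite /strang_coef it0 -addn2 eqxx gtn_eqF; last by lia.
  rewrite DQ0 lie0 scaler0 scale0r !add0r scale1r addr0 -EQ0 lieZ; last exact: smooth_lie.
  by rewrite scalerA mulrC.
have S0 : \sum_(j < 2 * s + 3) h ^+ j *: strang_coef (s := s) F Q0 j y =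
    Q0 y + h ^+ (2 * s).+1 *: lie F Q1 y + h ^+ (2 * s).+2 *: (2^-1 *: lie F (lie F Q1) y).
  rewrite addn3 2!big_ord_recr /= cQ0a cQ0b big_ord_recl big1 => [|l _].
    by rewrite addr0 expr0 scale1r (cst0 _ _ Q0).
  by rewrite lift0 cQ0 ?scaler0.
rewrite S0 big_ord1 cst0 2!big_ord_recr big_ord1 /= !cQ1 //= /Q.
rewrite expr0 expr1 invr1 !scale1r !scalerBr !scalerDr !scalerA -!exprSr -exprD addn2.
move: (Q0 _) (Q0 y) (Q1 _) (Q1 y) (Q2 _) (Q2 y) (lie F Q1 y) (lie F (lie F Q1) y) => a0 a0' a1 a1' a2 a2' d1 d2.
by apply/matrixP => i j; rewrite !mxE; ring.
Qed.

End AlmostConserved.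

(** * Quadratic forms in tangent vectors *)

Section QuadraticForms.
Context {R : realType} {s : nat} {m n d e : nat}.
Variables (F : 'M[R]_(m, n) -> 'M[R]_(m, n)) (J : 'M[R]_d).
Variable B : nat -> 'M[R]_(m, n) -> 'M[R]_(d, e).
Hypothesis sB : forall j, smooth (B j).
Hypothesis DB : forall j, lie F (B j) = B j.+1.

(** In the application, B j is the j-th time derivative of a tangent vector. *)
Definition pairing j k (y : 'M[R]_(m, n)) : 'M[R]_e := (B j y)^T *m J *m B k y.

Definition sym_pairing j k y := pairing j k y + pairing k j y.

(** A primitive of [sym_pairing 0 (2 * s + 1)] along F, found by integrating by
    parts s times; what remains, [sym_pairing s s.+1], is half of the derivative of
    [sym_pairing s s]. *)
Definition pairing_primitive y :=
  \sum_(i < s) (-1) ^+ i *: sym_pairing i (2 * s - i) y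
  + ((-1) ^+ s / 2) *: sym_pairing s s y.

Lemma smooth_pairing j k : smooth (pairing j k).
Proof.
move=> i; apply: Ck_mulmx (sB k i); apply: Ck_mulmx (Ck_cst _ _).
by apply: Ck_trmx; apply: sB.
Qed.

Lemma lie_pairing w j k : lie w (pairing j k) =
  fun y => (lie w (B j) y)^T *m J *m B k y + (B j y)^T *m J *m lie w (B k) y.
Proof.
apply: funext => y; rewrite /lie /pairing.
have dj : differentiable (B j) y by apply: smooth_differentiable.
have dT : differentiable (fun y => (B j y)^T) y.
  by apply: smooth_differentiable => i; apply: Ck_trmx; apply: sB.
have dTJ : differentiable (fun y => (B j y)^T *m J) y.
  by apply: differentiable_mulmx.
rewrite derive_mulmx //; last exact: smooth_differentiable.
by rewrite derive_mulmx // derive_cst mulmx0 addr0 derive_trmx.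
Qed.

Lemma smooth_sym_pairing j k : smooth (sym_pairing j k).
Proof. by apply: smoothD; apply: smooth_pairing. Qed.

Lemma lie_sym_pairing j k :
  lie F (sym_pairing j k) = fun y => sym_pairing j.+1 k y + sym_pairing j k.+1 y.
Proof.
rewrite lieD; try exact: smooth_pairing.
by apply: funext => y; rewrite !lie_pairing !DB /sym_pairing [X in _ + X = _]addrC addrACA.
Qed.

Lemma smooth_pairing_primitive : smooth pairing_primitive.
Proof.
apply: smoothD; last exact/smooth_scale/smooth_sym_pairing.
by apply: smooth_sum => i _; apply: smooth_scale; apply: smooth_sym_pairing.
Qed.

Lemma alternating_telescope (V : lmodType R) (a : nat -> V) N :
  \sum_(i < N) (-1) ^+ i *: (a i.+1 + a i) = a 0%N - (-1) ^+ N *: a N.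
Proof.
elim: N => [|N IHN]; first by rewrite big_ord0 expr0 scale1r subrr.
by rewrite big_ord_recr /= IHN exprS mulN1r scaleNr opprK scalerDr [_ *: a N.+1 + _]addrC addrA subrK.
Qed.

Lemma lie_pairing_primitive : lie F pairing_primitive = sym_pairing 0 (2 * s + 1).
Proof.
have sy := smooth_sym_pairing.
rewrite lieD; first last.
- exact: smooth_scale.
- by apply: smooth_sum => i _; apply: smooth_scale.
rewrite lie_sum => [|i]; last exact: smooth_scale.
apply: funext => y; rewrite lieZ // lie_sym_pairing.
have -> : sym_pairing s.+1 s y = sym_pairing s s.+1 y by rewrite /sym_pairing addrC.
have half (x : 'M[R]_e) : ((-1) ^+ s / 2) *: (x + x) = (-1) ^+ s *: x.
  by rewrite scalerDr -scalerDl -splitr.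
rewrite half.
rewrite (eq_bigr (fun i : 'I_s => (-1) ^+ i *: (sym_pairing i.+1 (2 * s + 1 - i.+1) y +
    sym_pairing i (2 * s + 1 - i) y))) => [|i _].
  rewrite (alternating_telescope (fun i => sym_pairing i (2 * s + 1 - i) y)) subn0.
  by have -> : (2 * s + 1 - s = s.+1)%N by [lia]; rewrite subrK.
have is' := ltn_ord i; rewrite lieZ // lie_sym_pairing; congr (_ *: (_ + _)).
  by congr (sym_pairing _ _ y); lia.
by congr (sym_pairing _ _ y); lia.
Qed.

End QuadraticForms.

(** * Implicit differentiation *)

Section ImplicitDifferentiation.
Context {R : realType}.

Lemma is_diff_approx (V W : normedModType R) (f : V -> W) x (L : {linear V -> W}) :
  continuous L ->
  (forall e : R, 0 < e -> \forall k \near (0 : V), `|f (k + x) - f x - L k| <= e * `|k|) ->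
  is_diff x f L.
Proof.
move=> cL fL.
have E : f \o shift x = cst (f x) + L +o_ (0 : V) id.
  by apply/eqaddoP => e /fL; apply: filterS => k; rewrite !fctE /= opprD addrA.
have dL := diff_unique cL E; apply: DiffDef => //.
by apply/diff_locallyP; rewrite dL.
Qed.

Lemma differentiable_approx (V W : normedModType R) (f : V -> W) x :
  differentiable f x -> forall e : R, 0 < e ->
  \forall k \near (0 : V), `|f (k + x) - f x - 'd f x k| <= e * `|k|.
Proof.
move=> /diff_locallyP[_ /eqaddoP E] e /E; apply: filterS => k.
by rewrite !fctE /= opprD addrA.
Qed.

Lemma jacE n m (g : 'cV[R]_n -> 'cV[R]_m) (y v : 'cV[R]_n) : differentiable g y ->
  jac g y *m v = 'D_v g y.
Proof. by move=> dg; rewrite mul_jac // deriveE. Qed.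

Lemma eq_jac n m (g : 'cV[R]_n -> 'cV[R]_m) (y : 'cV[R]_n) (A : 'M[R]_(m, n)) :
  differentiable g y -> (forall v, 'D_v g y = A *m v) -> jac g y = A.
Proof.
move=> dg gA; apply/matrixP => i j; rewrite mxE gA -colE mxE //.
Qed.

Lemma jac_comp n m p (g : 'cV[R]_n -> 'cV[R]_m) (f : 'cV[R]_m -> 'cV[R]_p) y :
  differentiable g y -> differentiable f (g y) ->
  jac (f \o g) y = jac f (g y) *m jac g y.
Proof.
move=> dg df; apply: eq_jac => [|v]; first exact: differentiable_comp.
have dfg : differentiable (f \o g) y by apply: differentiable_comp.
rewrite -mulmxA (jacE v dg) (jacE _ df) (deriveE v dfg) (diff_comp dg df) /=.
by rewrite -(deriveE v dg) -(deriveE _ df).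
Qed.

Lemma mulmx_continuous m n p (A : 'M[R]_(m, n)) : continuous (mulmx A : 'M[R]_(n, p) -> _).
Proof. exact: (@Ck_mulmx R 0%N _ _ _ _ (fun=> A) id (Ck_cst _ _) (smooth_id 0%N)). Qed.

Lemma unitmx_of_injective n (A : 'M[R]_n) :
  (forall v : 'cV[R]_n, A *m v = 0 -> v = 0) -> A \in unitmx.
Proof.
move=> Ainj; rewrite -unitmx_tr -row_free_unit; apply: inj_row_free => v vA.
by apply: trmx_inj; rewrite trmx0; apply: Ainj; rewrite -[A]trmxK -trmx_mul vA trmx0.
Qed.

(** A branch of solutions of a(psi y) = b(y) that is Lipschitz at y0 is
    differentiable at y0 when a is regular there: the continuity required by the
    implicit function theorem is given, and only the derivative has to be found. *)
Lemma implicit_differentiable d (a psi b : 'cV[R]_d -> 'cV[R]_d) y0 (C : R) :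
  differentiable a (psi y0) -> jac a (psi y0) \in unitmx -> differentiable b y0 ->
  (\forall y \near y0, a (psi y) = b y) ->
  (\forall y \near y0, `|psi y - psi y0| <= C * `|y - y0|) ->
  differentiable psi y0.
Proof.
move=> da ua db eab psiC; set N := jac a (psi y0) in ua *.
pose L' : {linear 'cV[R]_d -> 'cV[R]_d} := mulmx (invmx N *m jac b y0).
suff D : is_diff y0 psi L' by exact: ex_diff.
apply: is_diff_approx; first exact: mulmx_continuous.
move=> e e0; pose c := d%:R * `|invmx N| + 1; pose C' := `|C| + 1.
have c0 : 0 < c by rewrite ltr_wpDl // mulr_ge0.
have C0 : 0 < C' by rewrite ltr_wpDl.
pose e1 := e / (2 * c * C'); pose e2 := e / (2 * c).
have e10 : 0 < e1 by rewrite divr_gt0 // !mulr_gt0.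
have e20 : 0 < e2 by rewrite divr_gt0 // mulr_gt0.
have /nbhs_normP[d1 /= d10 D1] := differentiable_approx da e10.
have D2 := differentiable_approx db e20.
have shift0 P : (\forall y \near y0, P y) -> \forall k \near (0 : 'cV[R]_d), P (k + y0).
  by rewrite (near_shift 0) /= => H; apply: filterS H => y; rewrite subr0.
have eab0 := nbhs_singleton eab.
have small : \forall k \near (0 : 'cV[R]_d), `|k| < d1 / C'.
  by apply/nbhs_normP; exists (d1 / C') => /=; [exact: divr_gt0|move=> k /=; rewrite sub0r normrN].
have {}psiC := shift0 _ psiC; have {}eab := shift0 _ eab.
have D3 : \forall k \near (0 : 'cV[R]_d), [/\ `|psi (k + y0) - psi y0| <= C * `|k + y0 - y0|,
    a (psi (k + y0)) = b (k + y0) & `|k| < d1 / C'].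
  by apply: filterS3 psiC eab small => k ? ? ?; split.
move: D2 D3; apply: filterS2 => k D2 [psiC' eab' small'].
set q := psi (k + y0) - psi y0.
have qk : `|q| <= C' * `|k|.
  apply: le_trans psiC' _; rewrite addrK ler_wpM2r // /C' (le_trans (ler_norm C)) //.
  by rewrite lerDl.
have qd : `|q| < d1.
  by rewrite (le_lt_trans qk) // mulrC -ltr_pdivlMr.
have := D1 q; rewrite /ball_ /= sub0r normrN => /(_ qd).
rewrite {1}/q subrK eab' eab0 -mul_jac // -/N => D1q.
rewrite -mul_jac // in D2.
have NqB : `|N *m q - jac b y0 *m k| <= (e1 * C' + e2) * `|k|.
  rewrite -(subrKA (b (k + y0) - b y0)) (le_trans (ler_normD _ _)) // mulrDl lerD //.
  by rewrite distrC (le_trans D1q) // -mulrA ler_wpM2l // ltW.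
have -> : q - L' k = invmx N *m (N *m q - jac b y0 *m k).
  by rewrite mulmxBr mulKmx // mulmxA.
apply: le_trans (norm_mulmx _ _) _.
apply: (@le_trans _ _ (c * ((e1 * C' + e2) * `|k|))).
  by rewrite ler_pM // ?mulr_ge0 // /c lerDl.
rewrite mulrA ler_wpM2r // le_eqVlt; apply/orP; left; apply/eqP.
by rewrite /e1 /e2; field; rewrite !gt_eqF.
Qed.

End ImplicitDifferentiation.

(** * The tangent lift *)

Section TangentLift.
Context {R : realType} {d : nat}.
Implicit Types (f X w : 'cV[R]_d -> 'cV[R]_d) (Z : 'M[R]_(d, 1 + d)).

(** The induced map on pairs of a point and a frame of tangent vectors. For a
    vector field f, [tangent f] is the equation y' = f(y), A' = f'(y) A. *)
Definition tangent X Z : 'M[R]_(d, 1 + d) :=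
  row_mx (X (lsubmx Z)) (jac X (lsubmx Z) *m rsubmx Z).

Lemma smooth_jac n m (g : 'cV[R]_n -> 'cV[R]_m) : smooth g -> smooth (jac g).
Proof.
move=> sg k; apply/Ck_mxP => i j; under eq_fun do rewrite mxE.
by have /Ck_mxP := smooth_derive (delta_mx j 0) sg k.
Qed.

Lemma smooth_lsubmx : smooth (@lsubmx R d 1 d).
Proof.
by move=> k; apply: Ck_linear => x; apply: differentiable_continuous; apply: differentiable_lsubmx.
Qed.

Lemma smooth_rsubmx : smooth (@rsubmx R d 1 d).
Proof.
by move=> k; apply: Ck_linear => x; apply: differentiable_continuous; apply: differentiable_rsubmx.
Qed.

Lemma smooth_row_mx (V : normedModType R) m n1 n2 (g : V -> 'M[R]_(m, n1)) (h : V -> 'M[R]_(m, n2)) :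
  smooth g -> smooth h -> smooth (fun x => row_mx (g x) (h x)).
Proof.
move=> sg sh k; apply/Ck_mxP => i j; under eq_fun do rewrite mxE.
by case: (fintype.split j) => l; [have /Ck_mxP := sg k|have /Ck_mxP := sh k].
Qed.

Lemma smooth_tangent X : smooth X -> smooth (tangent X).
Proof.
move=> sX; apply: smooth_row_mx => k.
  exact: (Ck_comp (smooth_lsubmx k) (sX k)).
apply: (Ck_mulmx _ (smooth_rsubmx k)).
exact: (Ck_comp (smooth_lsubmx k) (smooth_jac sX k)).
Qed.

Lemma derive_linear (V W : normedModType R) (L : {linear V -> W}) x v :
  continuous L -> 'D_v L x = L v.
Proof.
by move=> cL; rewrite deriveE ?diff_lin //; apply: linear_differentiable.
Qed.

Lemma derive_lsubmx Z V : 'D_V (@lsubmx R d 1 d) Z = lsubmx V.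
Proof.
by apply: derive_linear => x; apply: differentiable_continuous; apply: differentiable_lsubmx.
Qed.

Lemma derive_rsubmx Z V : 'D_V (@rsubmx R d 1 d) Z = rsubmx V.
Proof.
by apply: derive_linear => x; apply: differentiable_continuous; apply: differentiable_rsubmx.
Qed.

Lemma derive_comp_lsubmx n m (g : 'cV[R]_d -> 'M[R]_(n, m)) Z V : smooth g ->
  'D_V (fun Z => g (lsubmx Z)) Z = 'D_(lsubmx V) g (lsubmx Z).
Proof.
move=> sg; have dl := @differentiable_lsubmx R d 1 d Z.
have dg := smooth_differentiable (lsubmx Z) sg.
rewrite deriveE; last exact: (@differentiable_comp _ _ _ _ lsubmx g).
rewrite (@diff_comp _ _ _ _ (@lsubmx R d 1 d) g) //=.
by rewrite -(deriveE V dl) derive_lsubmx -(deriveE _ dg).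
Qed.

Lemma derive_row_mx (V : normedModType R) m n1 n2 (g : V -> 'M[R]_(m, n1)) (h : V -> 'M[R]_(m, n2)) x v :
  smooth g -> smooth h ->
  'D_v (fun x => row_mx (g x) (h x)) x = row_mx ('D_v g x) ('D_v h x).
Proof.
move=> sg sh; have dgh := smooth_differentiable x (smooth_row_mx sg sh).
apply/matrixP => i j; rewrite derive_coord // mxE; under eq_fun do rewrite mxE.
by case: (fintype.split j) => l; rewrite derive_coord //; apply: smooth_differentiable.
Qed.

(** Symmetry of the second derivative of X. *)
Lemma derive_jac_sym X y (u v : 'cV[R]_d) : smooth X ->
  'D_v (jac X) y *m u = 'D_u (jac X) y *m v.
Proof.
move=> sX; have dX z := smooth_differentiable z sX.
have dJ := smooth_differentiable y (smooth_jac sX).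
have E (a b : 'cV[R]_d) : 'D_a (jac X) y *m b = 'D_a ('D_b X) y.
  rewrite (_ : 'D_b X = fun z => jac X z *m b); last by apply: funext => z; rewrite jacE.
  by rewrite derive_mulmx // derive_cst mulmx0 addr0.
apply: etrans (E _ _) _; apply: etrans _ (esym (E _ _)).
exact: (smooth_schwarz v u y sX).
Qed.

Lemma jac_lie w X y : smooth w -> smooth X ->
  jac (lie w X) y = 'D_(w y) (jac X) y + jac X y *m jac w y.
Proof.
move=> sw sX; have dX z := smooth_differentiable z sX.
have dw := smooth_differentiable y sw.
have dJ := smooth_differentiable y (smooth_jac sX).
have -> : lie w X = fun z => jac X z *m w z.
  by apply: funext => z; rewrite jacE.
apply: eq_jac => [|v]; first exact: differentiable_mulmx.
apply: etrans (derive_mulmx v dJ dw) _; apply: etrans _ (esym (mulmxDl _ _ _)).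
apply: (congr2 +%R (derive_jac_sym y (w y) v sX)).
by rewrite -mulmxA (jacE v dw).
Qed.

Lemma lie_tangent w X : smooth w -> smooth X ->
  lie (tangent w) (tangent X) = tangent (lie w X).
Proof.
move=> sw sX; apply: funext => Z; rewrite /lie /tangent derive_row_mx; first last.
- move=> k; apply: (Ck_mulmx _ (smooth_rsubmx k)).
  exact: (Ck_comp (smooth_lsubmx k) (smooth_jac sX k)).
- by move=> k; apply: (Ck_comp (smooth_lsubmx k) (sX k)).
rewrite derive_comp_lsubmx // row_mxKl derive_mulmx; first last.
- exact: differentiable_rsubmx.
- apply: smooth_differentiable => k; exact: (Ck_comp (smooth_lsubmx k) (smooth_jac sX k)).
rewrite (derive_comp_lsubmx _ _ (smooth_jac sX)) row_mxKl derive_rsubmx row_mxKr.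
by rewrite jac_lie // mulmxDl mulmxA.
Qed.

Lemma jac_id (y : 'cV[R]_d) : jac id y = 1%:M.
Proof. by apply: eq_jac => // v; rewrite derive_id mul1mx. Qed.

Lemma tangent_id : tangent id = id.
Proof. by apply: funext => Z; rewrite /tangent jac_id mul1mx hsubmxK. Qed.

(** Differentiation in time commutes with differentiation in the initial value. *)
Lemma iter_lie_tangent f j : smooth f ->
  iter j (lie (tangent f)) id = tangent (iter j (lie f) id).
Proof.
move=> sf; elim: j => [|j IHj]; first by rewrite tangent_id.
rewrite [LHS]iterS IHj; exact: lie_tangent sf (smooth_lie_iter j sf (@smooth_id R d 1)).
Qed.

Lemma tangentZ (c : R) X : smooth X ->
  tangent (fun y => c *: X y) = fun Z => c *: tangent X Z.
Proof.
move=> sX; apply: funext => Z; rewrite /tangent scale_row_mx; congr row_mx.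
have dX := smooth_differentiable (lsubmx Z) sX.
rewrite (@eq_jac _ _ _ _ _ (c *: jac X (lsubmx Z))) -?scalemxAl //.
  exact: differentiableZ.
by move=> v; rewrite (@deriveZ _ _ _ X) ?jacE -?scalemxAl ?jacE //; apply: diff_derivable.
Qed.

Lemma tangentD X X' : smooth X -> smooth X' ->
  tangent (fun y => X y + X' y) = fun Z => tangent X Z + tangent X' Z.
Proof.
move=> sX sX'; apply: funext => Z; rewrite /tangent add_row_mx; congr row_mx.
have dX := smooth_differentiable (lsubmx Z) sX.
have dX' := smooth_differentiable (lsubmx Z) sX'.
rewrite (@eq_jac _ _ _ _ _ (jac X (lsubmx Z) + jac X' (lsubmx Z))) ?mulmxDl //.
  exact: differentiableD.
move=> v; rewrite (@deriveD _ _ _ X X') ?mulmxDl ?jacE //; exact: diff_derivable.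
Qed.

Lemma smooth_hpoly (p : nat -> 'cV[R]_d -> 'cV[R]_d) N h : (forall j, smooth (p j)) ->
  smooth (hpoly p N h).
Proof. by move=> sp; apply: smooth_sum => j _; apply: smooth_scale. Qed.

(** The method commutes with the tangent lift: its derivative is the method applied
    to the variational equation. *)
Lemma hpoly_tangent f N h : smooth f ->
  hpoly (em_coef (tangent f)) N h = tangent (hpoly (em_coef f) N h).
Proof.
move=> sf; have sp j : smooth (em_coef f j) by apply: smooth_em_coef.
have tp j : em_coef (tangent f) j = tangent (em_coef f j).
  rewrite /em_coef tangentZ ?iter_lie_tangent //; exact: smooth_lie_iter sf (@smooth_id R d 1).
elim: N => [|N IHN].
  apply: funext => Z; rewrite /hpoly big_ord0 /tangent big_ord0.
  rewrite (@eq_jac _ _ _ _ _ 0) ?mul0mx ?row_mx0 //.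
    by under eq_fun do rewrite /hpoly big_ord0; exact: differentiable_cst.
  by move=> v; under eq_fun do rewrite /hpoly big_ord0; rewrite derive_cst mul0mx.
have -> : hpoly (em_coef f) N.+1 h = fun y => hpoly (em_coef f) N h y + h ^+ N *: em_coef f N y.
  by apply: funext => y; rewrite /hpoly big_ord_recr.
rewrite tangentD; [|exact: smooth_hpoly|exact: smooth_scale].
by apply: funext => Z; rewrite -IHN tangentZ // -tp /hpoly big_ord_recr.
Qed.

Lemma norm_lsubmx Z : `|lsubmx Z| <= `|Z|.
Proof. by apply: norm_le_coord => // i j; rewrite mxE coord_le_norm. Qed.

Lemma norm_rsubmx Z : `|rsubmx Z| <= `|Z|.
Proof. by apply: norm_le_coord => // i j; rewrite mxE coord_le_norm. Qed.

Lemma norm_row_mx m n1 n2 (A : 'M[R]_(m, n1)) (B : 'M[R]_(m, n2)) :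
  `|row_mx A B| <= `|A| + `|B|.
Proof.
apply: norm_le_coord => [|i j]; first by rewrite addr_ge0.
rewrite mxE; case: (fintype.split j) => k; first by rewrite ler_wpDr // coord_le_norm.
by rewrite ler_wpDl // coord_le_norm.
Qed.

End TangentLift.

(** * Regularity of the method *)

Section Regularity.
Context {R : realType} {d : nat}.

Section HPoly.
Variable p : nat -> 'cV[R]_d -> 'cV[R]_d.
Hypothesis p0 : p 0%N = id.
Hypothesis sp : forall j, smooth (p j).

Lemma derive_hpoly N (h : R) y v :
  'D_v (hpoly p N.+1 h) y = v + \sum_(j < N) h ^+ j.+1 *: 'D_v (p j.+1) y.
Proof.
have -> : hpoly p N.+1 h = id + \sum_(j < N) (h ^+ j.+1 *: p j.+1).
  by apply: funext => z; rewrite hpolyE // !fctE fct_sumE.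
have dj j : differentiable (h ^+ j.+1 *: p j.+1) y.
  by apply: differentiableZ; apply: smooth_differentiable.
rewrite deriveD ?derive_id; first last.
- by apply: derivable_sum => j; apply: diff_derivable.
- exact: derivable_id.
congr (_ + _); rewrite derive_sum => [|j]; last exact: diff_derivable.
by apply: eq_bigr => j _; rewrite deriveZ //; apply/diff_derivable/smooth_differentiable.
Qed.

Lemma derive_hpoly_close N (r : R) : exists2 L : R, 0 < L & forall h y v, `|h| <= 1 ->
  `|y| <= r -> `|'D_v (hpoly p N.+1 h) y - v| <= `|h| * L * `|v|.
Proof.
have /choice[L LP] j : exists L : R, 0 < L /\
    forall y v, `|y| <= r -> `|'D_v (p j) y| <= L * `|v|.
  by have [L L0 LP] := derive_locally_bounded r (sp j 1%N); exists L.
exists (\sum_(j < N) L j.+1 + 1) => [|h y v h1 yr].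
  by rewrite ltr_wpDl // sumr_ge0 // => j _; have [/ltW] := LP j.+1.
rewrite derive_hpoly addrC addKr (le_trans (ler_norm_sum _ _ _)) //.
apply: (@le_trans _ _ (\sum_(j < N) `|h| * L j.+1 * `|v|)).
  apply: ler_sum => j _; have [L0 LjP] := LP j.+1.
  rewrite normrZ normrX -mulrA ler_pM ?exprn_ge0 ?LjP //.
  by rewrite exprS ler_piMr // exprn_ile1.
by rewrite -mulr_suml -mulr_sumr ler_wpM2r // ler_wpM2l // lerDl.
Qed.

Lemma unitmx_near_id (N : 'M[R]_d) :
  (forall v : 'cV[R]_d, `|N *m v - v| <= 2^-1 * `|v|) -> N \in unitmx.
Proof.
move=> Nv; apply: unitmx_of_injective => v Nv0; have := Nv v.
rewrite Nv0 sub0r normrN => v2; apply/eqP; rewrite -normr_le0.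
by have := normr_ge0 v; lra.
Qed.

Variable Psi : R -> 'cV[R]_d -> 'cV[R]_d.
Variable N : nat.
Hypothesis Psi0 : bigO Psi 0.
Hypothesis eqPsi : forall r : R, \forall h \near (0 : R), forall y, `|y| <= r ->
  hpoly p N.+1 h (Psi h y) = hpoly p N.+1 (- h) y.

(** For small h, P_h is close to the identity together with its derivative, which
    makes the solution map of P_h(Psi) = P_(-h) Lipschitz, hence differentiable. *)
Lemma implicit_regular (r : R) : \forall h \near (0 : R), forall y, `|y| <= r ->
  [/\ differentiable (Psi h) y,
      jac (hpoly p N.+1 h) (Psi h y) *m jac (Psi h) y = jac (hpoly p N.+1 (- h)) y &
      `|jac (Psi h) y| <= 3].
Proof.
have [C CP] := Psi0 (r + 1); pose rho := Num.max C (r + 1).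
have [L1 L10 LP1] := higher_terms_lipschitz N rho sp.
have [L2 L20 LP2] := derive_hpoly_close N rho.
have small : \forall h \near (0 : R), [/\ `|h| <= 1, `|h| * L1 <= 2^-1 & `|h| * L2 <= 2^-1].
  apply/near0P; exists (Num.min 1 (Num.min (2^-1 / L1) (2^-1 / L2))).
    by rewrite !lt_min ltr01 !divr_gt0.
  move=> h; rewrite !lt_min => /and3P[/ltW ? /ltW h1 /ltW h2].
  by split=> //; rewrite -ler_pdivlMr.
move: CP (eqPsi (r + 1)) small; apply: filterS3 => h CP eqh [h1 hL1 hL2] y yr.
have PsiC (z : 'cV[R]_d) : `|z| <= r + 1 -> `|Psi h z| <= rho.
  by move=> /CP; rewrite expr0 mulr1 le_max => ->.
have rrho (z : 'cV[R]_d) : `|z| <= r + 1 -> `|z| <= rho by rewrite le_max => ->; rewrite orbT.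
have yr1 : `|y| <= r + 1 by rewrite (le_trans yr) // lerDl.
have sP k : smooth (hpoly p N.+1 k) by apply: smooth_hpoly.
have dP (k : R) (z : 'cV[R]_d) : differentiable (hpoly p N.+1 k) z by apply: smooth_differentiable.
have near_y : \forall z \near y, `|z| <= r + 1.
  apply/nbhs_normP; exists 1 => //= z; rewrite /ball_ /= distrC => zy.
  by rewrite -(subrK y z) (le_trans (ler_normD _ _)) // addrC lerD // ltW.
have closeP (k : R) (z v : 'cV[R]_d) : `|k| = `|h| -> `|z| <= rho ->
    `|'D_v (hpoly p N.+1 k) z - v| <= 2^-1 * `|v|.
  move=> kh zr; have k1 : `|k| <= 1 by rewrite kh.
  by apply: le_trans (LP2 k z v k1 zr) _; rewrite kh ler_wpM2r.
have uP : jac (hpoly p N.+1 h) (Psi h y) \in unitmx.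
  by apply: unitmx_near_id => v; rewrite jacE //; apply: closeP => //; apply: PsiC.
have lip : \forall z \near y, `|Psi h z - Psi h y| <= 3 * `|z - y|.
  apply: filterS near_y => z zr.
  have := eqh z zr; have := eqh y yr1; rewrite !hpolyE //.
  have := LP1 h (Psi h z) (Psi h y) h1 (PsiC z zr) (PsiC y yr1).
  have Nh1 : `|- h| <= 1 by rewrite normrN.
  have := LP1 (- h) z y Nh1 (rrho z zr) (rrho y yr1); rewrite normrN.
  set A := \sum_(_ < _) _; set B := \sum_(_ < _) _; set A' := \sum_(_ < _) _; set B' := \sum_(_ < _) _.
  move=> /le_trans/(_ (ler_wpM2r (normr_ge0 _) hL1)) AB.
  move=> /le_trans/(_ (ler_wpM2r (normr_ge0 _) hL1)) AB' Ey Ez.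
  have E : Psi h z - Psi h y = (z - y) + (A - B) - (A' - B').
    rewrite addrACA -opprD -Ez -Ey.
    by apply/matrixP => i j; rewrite !mxE; ring.
  have : `|Psi h z - Psi h y| <= `|z - y| + `|A - B| + `|A' - B'|.
    by rewrite {1}E (le_trans (ler_normB _ _)) // lerD2r ler_normD.
  by move: AB AB'; lra.
have dPsi : differentiable (Psi h) y.
  apply: (implicit_differentiable (dP h _) uP (dP (- h) y)) lip.
  by apply: filterS near_y => z zr; apply: eqh.
have J : jac (hpoly p N.+1 h) (Psi h y) *m jac (Psi h) y = jac (hpoly p N.+1 (- h)) y.
  apply: etrans (esym (jac_comp dPsi (dP h _))) _.
  have eqn : \forall z \near y, (hpoly p N.+1 h \o Psi h) z = hpoly p N.+1 (- h) z.
    by apply: filterS near_y => z zr; apply: eqh.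
  apply/matrixP => i j.
  have E : 'D_(delta_mx j 0) (hpoly p N.+1 h \o Psi h) y =
      'D_(delta_mx j 0) (hpoly p N.+1 (- h)) y by apply: near_eq_derive eqn.
  by rewrite [LHS]mxE [RHS]mxE; exact: (congr1 (fun M : 'cV[R]_d => M i 0) E).
split=> //; apply: norm_le_coord => // i j.
pose u : 'cV[R]_d := jac (Psi h) y *m delta_mx j 0.
have -> : jac (Psi h) y i j = u i 0 by rewrite /u -colE [RHS]mxE.
apply: le_trans (coord_le_norm _ _ _) _.
have d1 : `|delta_mx j 0 : 'cV[R]_d| <= 1.
  by apply: norm_le_coord => // a b; rewrite mxE; case: (_ && _); rewrite ?normr1 ?normr0.
have := closeP h (Psi h y) u erefl (PsiC y yr1).
have := closeP (- h) y (delta_mx j 0) (normrN h) (rrho y yr1).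
rewrite -(jacE _ (dP h _)) -(jacE _ (dP (- h) y)) -J -mulmxA -/u.
move: (jac (hpoly p N.+1 h) (Psi h y) *m u) (delta_mx j 0 : 'cV[R]_d) d1 => x e d1.
move=> c1 c2.
have : `|u| <= `|x - u| + `|x| by rewrite -{1}(subKr x u) (le_trans (ler_normB _ _)) // addrC.
have : `|x| <= `|x - e| + `|e| by rewrite -{1}(subrK e x) ler_normD.
by move: c1 c2 d1; lra.
Qed.

End HPoly.

Section LiftedMethod.
Variables (s : nat) (f : 'cV[R]_d -> 'cV[R]_d) (Psi : R -> 'cV[R]_d -> 'cV[R]_d).
Hypothesis s1 : (1 <= s)%N.
Hypothesis sf : smooth f.
Hypothesis Psi_EM : is_EulerMaclaurin s f Psi.

Lemma em_bigO0 : bigO Psi 0.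
Proof. by have [_ P1] := Psi_EM; exact: bigO_close0 P1. Qed.

Lemma em_hpoly (r : R) : \forall h \near (0 : R), forall y, `|y| <= r ->
  hpoly (em_coef f) (2 * s) h (Psi h y) = hpoly (em_coef f) (2 * s) (- h) y.
Proof.
have [eqP _] := Psi_EM; apply: filterS (eqP r) => h eqh y yr.
by apply/EulerMaclaurin_hpoly => //; apply: eqh.
Qed.

Lemma em_regular (r : R) : \forall h \near (0 : R), forall y, `|y| <= r ->
  [/\ differentiable (Psi h) y,
      jac (hpoly (em_coef f) (2 * s) h) (Psi h y) *m jac (Psi h) y =
      jac (hpoly (em_coef f) (2 * s) (- h)) y &
      `|jac (Psi h) y| <= 3].
Proof.
have [N NE] : exists N, (2 * s = N.+1)%N by exists (2 * s).-1; rewrite prednK // muln_gt0.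
have := em_hpoly; rewrite NE => eqN.
apply: (implicit_regular (em_coef0 f) _ em_bigO0 eqN) => j; exact: smooth_em_coef.
Qed.

(** Differentiate P_h(Psi h y) = P_(-h)(y). *)
Lemma em_tangent (r : R) : \forall h \near (0 : R), forall Z, `|Z| <= r ->
  hpoly (em_coef (tangent f)) (2 * s) h (tangent (Psi h) Z) =
  hpoly (em_coef (tangent f)) (2 * s) (- h) Z.
Proof.
move: (em_hpoly r) (em_regular r); apply: filterS2 => h eqh regh Z Zr.
have yr : `|lsubmx Z| <= r := le_trans (norm_lsubmx Z) Zr.
have [_ J _] := regh _ yr.
have tE k W : hpoly (em_coef (tangent f)) (2 * s) k W = tangent (hpoly (em_coef f) (2 * s) k) W.
  by rewrite hpoly_tangent.
apply: etrans (tE _ _) _; apply: etrans _ (esym (tE _ _)).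
rewrite /tangent row_mxKl row_mxKr (eqh _ yr); congr row_mx.
by apply: etrans (mulmxA _ _ _) _; congr (_ *m _).
Qed.

Lemma em_tangent_bigO0 : bigO (fun h => tangent (Psi h)) 0.
Proof.
move=> r; have [C CP] := em_bigO0 r; exists (C + d%:R * 3 * r).
move: CP (em_regular r); apply: filterS2 => h CP regh Z Zr.
have yr : `|lsubmx Z| <= r := le_trans (norm_lsubmx Z) Zr.
have [_ _ J3] := regh _ yr; rewrite expr0 mulr1.
apply: le_trans (norm_row_mx _ _) _; apply: lerD; first by have := CP _ yr; rewrite expr0 mulr1.
apply: le_trans (norm_mulmx _ _) _; rewrite ler_pM ?mulr_ge0 //.
  by rewrite ler_wpM2l.
exact: le_trans (norm_rsubmx Z) Zr.
Qed.

End LiftedMethod.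

End Regularity.

(** * A smooth cutoff *)

Section Cutoff.
Context {R : realType}.

(** The factors x^-n make the family closed under differentiation, up to linear
    combinations. *)
Definition flat (n : nat) (x : R) : R := if 0 < x then x^-1 ^+ n * expR (- x^-1) else 0.

(** exp(1/x) >= x^-(n+1) / (n+1)!. *)
Lemma flat_le (n : nat) (x : R) : 0 < x -> flat n x <= (n.+1)`!%:R * x.
Proof.
move=> x0; rewrite /flat x0 expRN -ler_pdivlMr ?invr_gt0 ?expR_gt0 // invrK.
have xi0 : 0 < x^-1 by rewrite invr_gt0.
have := expR_ge1Dxn n (ltW xi0); have f0 : 0 < (n.+1)`!%:R :> R by rewrite ltr0n fact_gt0.
move=> le; have : x^-1 ^+ n.+1 / (n.+1)`!%:R <= expR x^-1 by apply: le_trans le; rewrite lerDr.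
rewrite ler_pdivrMr // exprS mulrC => le2.
have := ler_wpM2l (ltW x0) le2; rewrite mulrA [x * _]mulrC -mulrA mulfV ?gt_eqF // mulr1.
by move/le_trans; apply; rewrite le_eqVlt; apply/orP; left; apply/eqP; ring.
Qed.

Lemma flat_ge0 n x : 0 <= flat n x.
Proof.
rewrite /flat; case: ifP => // x0; rewrite mulr_ge0 ?expR_ge0 //.
by rewrite exprn_ge0 // invr_ge0 ltW.
Qed.

Lemma flat_shift n x : flat n x = x * flat n.+1 x.
Proof.
rewrite /flat; case: ifP => [x0|]; last by rewrite mulr0.
by rewrite exprS !mulrA mulfV ?gt_eqF // mul1r.
Qed.

Lemma is_derive_flat n (x : R) : is_derive x 1 (flat n) (flat n.+2 x - n%:R * flat n.+1 x).
Proof.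
have [x0|x0|->] := ltgtP x 0.
- have E : \near x, 0 = flat n x.
    by apply: filterS (lt_nbhsl x0) => y y0; rewrite /flat ltNge (ltW y0).
  rewrite /flat ltNge (ltW x0) /= mulr0 subr0.
  exact: (near_eq_is_derive E (is_derive_cst 0 x 1)).
- pose g (y : R) := y^-1 ^+ n * expR (- y^-1).
  have E : \near x, g x = flat n x.
    by apply: filterS (lt_nbhsr x0) => y y0; rewrite /flat y0.
  apply: (near_eq_is_derive E).
  have xn0 : x != 0 by rewrite gt_eqF.
  have dV : is_derive x 1 (fun y : R => y^-1) (- x ^- 2).
    have := @is_deriveV R id x 1 1 xn0 (is_derive_id x 1).
    by rewrite scaleRE mulr1.
  have dX : is_derive x^-1 1 (fun z : R => z ^+ n) (n%:R * x^-1 ^+ n.-1).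
    apply: DeriveDef; first exact: exprn_derivable.
    by rewrite exp_derive !scaleRE mulr1.
  have dXV := @is_derive1_comp R (fun z : R => z ^+ n) (fun y => y^-1) x _ _ dX dV.
  have dN : is_derive x 1 (fun y : R => - y^-1) (x ^- 2).
    by rewrite -[x ^- 2]opprK; apply: (@is_deriveN R R R (fun y => y^-1) x 1).
  have dE := @is_derive1_comp R expR (fun y => - y^-1) x _ _ (is_derive_expR _) dN.
  have := is_deriveM dXV dE; congr (is_derive _ _ _ _).
  rewrite /flat x0 /= !scaleRE -!exprVn; move: (expR (- x^-1)) (x^-1) => e z.
  by case: n {g E dX dXV} => [|n] /=; rewrite ?mul0r ?exprS; ring.
have f0 k : flat k 0 = 0 by rewrite /flat ltxx.
rewrite !f0 mulr0 subr0.
have c0 : continuous (\0 : R -> R) by move=> z; exact: cst_continuous.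
have D : is_diff (0 : R) (flat n) (\0 : {linear R -> R}).
  apply: is_diff_approx => // e e0.
  apply/near0P; exists (e / (n.+2)`!%:R) => [|k kd].
    by rewrite divr_gt0 // ltr0n fact_gt0.
  rewrite addr0 f0 /= !subr0 flat_shift normrM mulrC ler_wpM2r //.
  rewrite ger0_norm ?flat_ge0 //; have [k0|k0] := ltP 0 k; last first.
    by rewrite /flat ltNge k0 ltW.
  apply: le_trans (flat_le _ k0) _; rewrite mulrC -ler_pdivlMr ?ltr0n ?fact_gt0 //.
  by rewrite -[k]gtr0_norm // ltW.
have df : differentiable (flat n) (0 : R) by exact: ex_diff.
apply: DeriveDef; first exact: diff_derivable.
by rewrite deriveE // diff_val.
Qed.

Lemma smooth_flat n : smooth (flat n).
Proof.
move=> k; elim: k n => [|k IHk] n.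
  move=> x; apply: differentiable_continuous; apply/derivable1_diffP.
  by have [] := is_derive_flat n x.
have dflat x : differentiable (flat n) x.
  by apply/derivable1_diffP; have [] := is_derive_flat n x.
split=> // v.
rewrite (_ : (fun x => _) = fun x => v * (flat n.+2 x + - n%:R * flat n.+1 x)).
  apply: CkM (Ck_cst _ _) _; apply: CkD => //; apply: CkM (Ck_cst _ _) _; exact: IHk.
apply: funext => x; have [_ D] := is_derive_flat n x.
rewrite mulNr -D -[in LHS](mulr1 v) -scaleRE !deriveE // linearZ //.
Qed.

(** A smooth function equal to 1 on ]-oo, 1] and to 0 on [2, +oo[. *)
Definition smooth_step (t : R) : R := flat 0 (2 - t) / (flat 0 (2 - t) + flat 0 (t - 1)).

Lemma flat0_gt0 x : 0 < x -> 0 < flat 0 x.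
Proof. by move=> x0; rewrite /flat x0 expr0 mul1r expR_gt0. Qed.

Lemma smooth_smooth_step : smooth smooth_step.
Proof.
move=> k; have Cid : Ck k (@id R) by apply: (@Ck_linear R R R k idfun) => x.
have C1 : Ck k (fun t : R => flat 0 (2 - t)).
  apply: Ck_comp1; first exact: smooth_flat.
  under eq_fun do rewrite -mulN1r; apply: CkD; first exact: Ck_cst.
  exact: CkM (Ck_cst _ _) Cid.
have C2 : Ck k (fun t : R => flat 0 (t - 1)).
  by apply: Ck_comp1 (CkD Cid (Ck_cst _ _)); apply: smooth_flat.
apply: (CkM C1); apply: CkV (CkD C1 C2) => t; rewrite gt_eqF //.
have [t2|t2] := ltP t 2; first by rewrite ltr_wpDr ?flat_ge0 // flat0_gt0 // subr_gt0.
by rewrite ltr_wpDl ?flat_ge0 // flat0_gt0 // subr_gt0; lra.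
Qed.

Lemma smooth_step1 t : t <= 1 -> smooth_step t = 1.
Proof.
move=> t1; rewrite /smooth_step; have -> : flat 0 (t - 1) = 0.
  by rewrite /flat ltNge subr_le0 t1.
by rewrite addr0 mulfV // gt_eqF // flat0_gt0 // subr_gt0; lra.
Qed.

Lemma smooth_step0 t : 2 <= t -> smooth_step t = 0.
Proof. by move=> t2; rewrite /smooth_step {1}/flat ltNge subr_le0 t2 mul0r. Qed.

Context {d : nat}.
Implicit Types (y : 'cV[R]_d) (g : 'cV[R]_d -> 'cV[R]_d).

(** The norm of matrices, a maximum, is not smooth. *)
Definition sq_norm y : R := \sum_i y i 0 * y i 0.

Definition truncate (n : nat) g y : 'cV[R]_d := smooth_step (sq_norm y / n.+1%:R) *: g y.

Lemma smooth_sq_norm : smooth sq_norm.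
Proof.
move=> k; have /Ck_mxP C := smooth_id (R := R) (m := d) (n := 1) k.
by apply: Ck_sum => i _; apply: CkM; apply: C.
Qed.

Lemma smooth_truncate n g : smooth g -> smooth (truncate n g).
Proof.
move=> sg k; apply: Ck_scale (sg k); apply: Ck_comp1; first exact: smooth_smooth_step.
exact: CkM (smooth_sq_norm k) (Ck_cst _ _).
Qed.

Lemma sq_norm_le y : sq_norm y <= d%:R * `|y| ^+ 2.
Proof.
apply: (@le_trans _ _ (\sum_(i < d) `|y| ^+ 2)); last by rewrite sumr_const card_ord mulr_natl.
apply: ler_sum => i _; rewrite -expr2 -real_normK ?num_real // lerXn2r ?nnegrE //.
exact: coord_le_norm.
Qed.

Lemma sq_norm_ge y : `|y| ^+ 2 <= sq_norm y.
Proof.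
have s0 : 0 <= sq_norm y by apply: sumr_ge0 => i _; rewrite -expr2 sqr_ge0.
rewrite -[leRHS]sqr_sqrtr // lerXn2r ?nnegrE ?sqrtr_ge0 //.
apply: norm_le_coord; first exact: sqrtr_ge0.
move=> i j; rewrite ord1 -sqrtr_sqr ler_wsqrtr // /sq_norm (bigD1 i) //= -expr2 lerDl.
by apply: sumr_ge0 => k _; rewrite -expr2 sqr_ge0.
Qed.

Lemma truncate_small n g y : d%:R * `|y| ^+ 2 <= n.+1%:R -> truncate n g y = g y.
Proof.
move=> yn; rewrite /truncate smooth_step1 ?scale1r //.
by rewrite ler_pdivrMr ?ltr0n // mul1r (le_trans (sq_norm_le y)).
Qed.

Lemma truncate_derive_bounded n g : smooth g ->
  exists2 C : R, 0 < C & forall y v, `|'D_v (truncate n g) y| <= C * `|v|.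
Proof.
move=> sg; pose r : R := 2 * n.+1%:R.
have [C C0 CP] := derive_locally_bounded r (smooth_truncate n sg 1%N); exists C => // y v.
have [yr|ry] := leP `|y| r; first exact: CP.
have r1 : 1 <= r by rewrite /r -natrM ler1n.
suff -> : 'D_v (truncate n g) y = 0 by rewrite normr0 mulr_ge0 // ltW.
rewrite -[RHS](derive_cst (0 : 'cV[R]_d) y v); apply: near_eq_derive.
have near_y : \forall z \near y, r < `|z|.
  apply/nbhs_normP; exists (`|y| - r) => [|z /= yz]; first by rewrite /= subr_gt0.
  by have := ler_normB y z; have := ler_distD z y 0; rewrite !subr0; lra.
apply: filterS near_y => z rz; rewrite /truncate smooth_step0 ?scale0r //.
rewrite ler_pdivlMr ?ltr0n // (le_trans _ (sq_norm_ge z)) //.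
apply: (@le_trans _ _ `|z|); first exact: ltW.
by rewrite expr2 ler_peMr // ltW // (le_lt_trans r1).
Qed.

End Cutoff.

(** * Localization with a small Lipschitz constant *)

Section Selection.
Context {R : realType} {d : nat}.
Implicit Types (g : 'cV[R]_d -> 'cV[R]_d).

(** The map h^p g is cut off at a radius depending on h, as large as the Lipschitz
    constant 1/2 permits. As h -> 0 every radius becomes permitted. No single
    cutoff radius would do, because the estimates in h hold on every bounded set. *)
Lemma small_representative (p : nat) g : (0 < p)%N -> smooth g ->
  exists U : R -> 'cV[R]_d -> 'cV[R]_d,
    [/\ forall h, smooth (U h), forall h y v, `|'D_v (U h) y| <= 2^-1 * `|v| &
        for_small_h (fun h y => U h y = h ^+ p *: g y)].
Proof.
move=> p0 sg; pose bound n C := 0 < C /\ forall y v, `|'D_v (truncate n g) y| <= C * `|v|.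
have [C CP] : {C : nat -> R & forall n, bound n (C n)}.
  by apply: choice => n; have [C C0 D] := truncate_derive_bounded n sg; exists C.
(* The level is also bounded by 1/|h|, so as to be a maximum over a finite set. *)
pose adm (h : R) n := `|h| ^+ p * C n <= 2^-1.
pose level (h : R) := (\max_(i < (Num.trunc `|h|^-1).+1 | adm h i) i)%N.
pose U h : 'cV[R]_d -> 'cV[R]_d :=
  if adm h (level h) then fun y => h ^+ p *: truncate (level h) g y else fun=> 0.
exists U; split=> [h|h y v|r].
- rewrite /U; case: ifP => _ k; last exact: Ck_cst.
  exact: CkZ (smooth_truncate (level h) sg k).
- rewrite /U; case: ifP => [hC|_]; last by rewrite derive_cst normr0 mulr_ge0.
  have -> : 'D_v (fun z => h ^+ p *: truncate (level h) g z) y =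
      h ^+ p *: 'D_v (truncate (level h) g) y.
    by apply: deriveZ; apply: diff_derivable; apply: smooth_differentiable; apply: smooth_truncate.
  rewrite normrZ normrX; have [_ /(_ y v) D] := CP (level h).
  apply: (@le_trans _ _ (`|h| ^+ p * C (level h) * `|v|)).
    by rewrite -mulrA ler_wpM2l // exprn_ge0.
  by rewrite ler_wpM2r.
pose n0 := (Num.trunc (d%:R * r ^+ 2)).+1.
have [C0 _] := CP n0.
apply/near0P; pose e := Num.min (n0.+1%:R^-1) (2^-1 / C n0).
exists e => [|h he y yr].
  by rewrite /e lt_min invr_gt0 ltr0n /= divr_gt0 // invr_gt0.
have [->|h0] := eqVneq h 0.
  by rewrite /U expr0n gtn_eqF //= scale0r; case: ifP => _ //; rewrite scale0r.
have hp : 0 < `|h| by rewrite normr_gt0.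
have [h1 h2] : `|h| < n0.+1%:R^-1 /\ `|h| < 2^-1 / C n0.
  by move: he; rewrite /e lt_min => /andP[].
have n0h : (n0 < (Num.trunc `|h|^-1).+1)%N.
  rewrite ltnS ltnW // truncn_gt_nat -(invrK (n0.+1%:R)) lef_pV2 ?posrE ?invr_gt0 ?ltr0n //.
  exact: ltW.
have admn0 : adm h n0.
  rewrite /adm -ler_pdivlMr //; apply: le_trans (ltW h2).
  apply: ler_iXnr => //; rewrite (le_trans (ltW h1)) // invf_le1 ?ltr0n // ler1n //.
have le_n0 : (n0 <= level h)%N.
  exact: (@leq_bigmax_cond _ (fun i : 'I_(Num.trunc `|h|^-1).+1 => adm h i) val (Ordinal n0h)).
have adml : adm h (level h).
  have [|i] := @eq_bigmax_cond _ [pred i : 'I_(Num.trunc `|h|^-1).+1 | adm h i] val.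
    by apply/card_gt0P; exists (Ordinal n0h).
  by rewrite inE /level => admi ->.
rewrite /U adml truncate_small //.
have r0 : 0 <= r := le_trans (normr_ge0 y) yr.
apply: (@le_trans _ _ (d%:R * r ^+ 2)); first by rewrite ler_wpM2l // lerXn2r ?nnegrE.
apply: (@le_trans _ _ n0%:R); first by rewrite ltW // /n0 truncnS_gt.
by rewrite ler_nat (leq_trans le_n0).
Qed.

End Selection.

(** * Global inverse of a perturbation of the identity *)

HB.instance Definition _ (R : realType) m n := Complete.copy 'M[R]_(m, n) 'M[R]_(m, n).

Section GlobalInverse.
Context {R : realType} {d : nat}.
Variable u : 'cV[R]_d -> 'cV[R]_d.
Hypothesis smooth_u : smooth u.
Hypothesis u_bound : forall y v, `|'D_v u y| <= 2^-1 * `|v|.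

Let a y := y - u y.

Let u_lipschitz x y : `|u x - u y| <= 2^-1 * `|x - y|.
Proof. by apply: mean_value_segment => // z; apply: smooth_differentiable. Qed.

Let a_surjective x : exists y, a y = x.
Proof.
pose f := fun y => x + u y.
have ffun : set_fun [set: 'cV[R]_d] [set: 'cV[R]_d] f by [].
pose F : {fun [set: 'cV[R]_d] >-> [set: 'cV[R]_d]} := HB.pack f (isFun.Build _ _ _ _ f ffun).
have [|||y _ yf] := @banach_fixed_point R 'cV[R]_d setT F.
- exists (2^-1)%:nng; split; first by rewrite /= invf_lt1 // ltr1n.
  by move=> [y z] _ /=; rewrite /f (opprD x) addrACA subrr add0r.
- exact: closedT.
- by exists 0.
by exists y; rewrite /a {1}yf /= addrK.
Qed.

(** A perturbation of the identity by a contraction is onto by Banach's fixed point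
    theorem applied to y -> x + u y, and shrinks distances at most by a factor 2. *)
Lemma global_inverse : exists chi : 'cV[R]_d -> 'cV[R]_d,
  [/\ diffeomorphism chi (fun y => y - u y),
      forall x, `|chi x| <= 2 * (`|x| + `|u 0|) &
      forall x, `|jac chi x| <= 2].
Proof.
have [chi aK] := choice a_surjective.
have a_expand x y : `|x - y| <= 2 * `|a x - a y|.
  have := u_lipschitz x y; have := ler_normD (a x - a y) (u x - u y).
  have -> : a x - a y + (u x - u y) = x - y by apply/matrixP => i j; rewrite !mxE; ring.
  lra.
have Ka : cancel a chi.
  move=> y; apply/eqP; rewrite -subr_eq0 -normr_le0.
  by have := a_expand (chi (a y)) y; rewrite aK subrr normr0 mulr0.
have da y : differentiable a y.
  by apply: differentiableB => //; apply: smooth_differentiable.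
have jaca y (v : 'cV[R]_d) : jac a y *m v = v - 'D_v u y.
  rewrite jacE // deriveB ?derive_id //; last by apply/diff_derivable/smooth_differentiable.
have ua y : jac a y \in unitmx.
  apply: unitmx_near_id => v; rewrite jaca addrC addKr normrN; exact: u_bound.
have dchi x : differentiable chi x.
  apply: (@implicit_differentiable _ _ a chi id x 2) => //.
  - by apply: filterE => y; rewrite aK.
  - by apply: filterE => y; rewrite -{2}(aK y) -{2}(aK x).
have Dchi v x : 'D_v chi x = invmx (jac a (chi x)) *m v.
  rewrite -jacE // -[LHS](mulKmx (ua (chi x))); congr (_ *m _); rewrite mulmxA -jac_comp //.
  by rewrite (_ : a \o chi = id) ?jac_id ?mul1mx //; apply: funext => z /=; rewrite aK.
have sa : smooth a.
  move=> k; rewrite /a; under eq_fun do rewrite -scaleN1r.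
  by apply: CkD; [exact: smooth_id|exact: CkZ].
have schi : smooth chi.
  elim=> [|k IHk]; first by move=> x; apply: differentiable_continuous.
  split=> // v; rewrite (_ : (fun x => _) = fun x => invmx (jac a (chi x)) *m v).
    apply: Ck_mulmx (Ck_cst _ _); apply: Ck_invmx => [x|]; first exact: ua.
    by apply: (@Ck_comp _ k _ _ _ _ _ chi (jac a) IHk); apply: smooth_jac.
  by apply: funext => x; rewrite Dchi.
exists chi; split=> [|x|x].
- by split.
- have := a_expand (chi x) 0; rewrite aK subr0 /a sub0r opprK => /le_trans; apply.
  by rewrite ler_pM2l // ler_normD.
apply: norm_le_coord => // i j; rewrite mxE Dchi; set e := delta_mx j 0.
have e1 : `|e : 'cV[R]_d| <= 1.
  by apply: norm_le_coord => // k l; rewrite mxE; case: (_ && _); rewrite ?normr1 ?normr0.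
set w := invmx _ *m e; apply: le_trans (coord_le_norm w i 0) _.
have : `|w| <= `|e| + 2^-1 * `|w|.
  have -> : e = w - 'D_w u (chi x) by rewrite -jaca /w mulKVmx.
  by have := ler_normB (w - 'D_w u (chi x)) (- 'D_w u (chi x));
     have := u_bound (chi x) w; rewrite opprK subrK normrN; lra.
by move: e1; lra.
Qed.

End GlobalInverse.

(** * Curls of 1-forms *)

Section InvariantForm.
Context {R : realType} {d : nat}.
Implicit Types (y : 'cV[R]_d).

Variable J : 'M[R]_d.
Hypothesis trJ : J^T = - J.

(** Up to sign, W is the exterior derivative of the 1-form \sum_i a_i dy_i, as a
    field of antisymmetric matrices. *)
Definition has_curl (a : 'cV[R]_d -> 'cV[R]_d) (W : 'cV[R]_d -> 'M[R]_d) :=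
  smooth a /\ forall y, jac a y - (jac a y)^T = W y.

Lemma has_curlD a a' W W' : has_curl a W -> has_curl a' W' ->
  has_curl (fun y => a y + a' y) (fun y => W y + W' y).
Proof.
move=> [sa aW] [sa' aW']; split=> [|y]; first exact: smoothD.
have da := smooth_differentiable y sa; have da' := smooth_differentiable y sa'.
have -> : jac (fun y => a y + a' y) y = jac a y + jac a' y.
  apply: eq_jac => [|v]; first exact: differentiableD.
  by rewrite (@deriveD _ _ _ a a') ?mulmxDl ?jacE //; exact: diff_derivable.
by rewrite -aW -aW' linearD opprD addrACA.
Qed.

Lemma has_curlZ (c : R) a W : has_curl a W -> has_curl (fun y => c *: a y) (fun y => c *: W y).
Proof.
move=> [sa aW]; split=> [|y]; first exact: smooth_scale.
have da := smooth_differentiable y sa.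
have -> : jac (fun y => c *: a y) y = c *: jac a y.
  apply: eq_jac => [|v]; first exact: differentiableZ.
  by rewrite (@deriveZ _ _ _ a) -?scalemxAl ?jacE //; exact: diff_derivable.
by rewrite -aW linearZ scalerBr.
Qed.

Lemma has_curl_sum N (a : 'I_N -> 'cV[R]_d -> 'cV[R]_d) W :
  (forall i, has_curl (a i) (W i)) ->
  has_curl (fun y => \sum_i a i y) (fun y => \sum_i W i y).
Proof.
move=> aW; elim: N a W aW => [|N IHN] a W aW.
  have -> : (fun y => \sum_i a i y) = fun y => 0 *: id y.
    by apply: funext => y; rewrite big_ord0 scale0r.
  have -> : (fun y => \sum_i W i y) = fun y => 0 *: (jac id y - (jac id y)^T).
    by apply: funext => y; rewrite big_ord0 scale0r.
  apply: has_curlZ; split=> //; exact: smooth_id.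
have -> : (fun y => \sum_i a i y) = fun y => a ord0 y + \sum_i a (lift ord0 i) y.
  by apply: funext => y; rewrite big_ord_recl.
have -> : (fun y => \sum_i W i y) = fun y => W ord0 y + \sum_i W (lift ord0 i) y.
  by apply: funext => y; rewrite big_ord_recl.
by apply: has_curlD => //; apply: IHN.
Qed.

(** The second derivatives of X contribute a symmetric matrix to the Jacobian,
    which disappears from the curl. *)
Lemma has_curl_pullback X X' : smooth X -> smooth X' ->
  has_curl (fun y => (jac X y)^T *m J *m X' y)
    (fun y => (jac X y)^T *m J *m jac X' y + (jac X' y)^T *m J *m jac X y).
Proof.
move=> sX sX'; have sT : smooth (fun y => (jac X y)^T *m J).
  by move=> k; apply: Ck_mulmx (Ck_cst _ _); apply: Ck_trmx; apply: smooth_jac.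
split=> [k|y]; first exact: Ck_mulmx (sT k) (sX' k).
have dJ := smooth_differentiable y (smooth_jac sX).
have dT := smooth_differentiable y sT.
have dJT : differentiable (fun y => (jac X y)^T) y.
  by apply: smooth_differentiable => k; apply: Ck_trmx; apply: smooth_jac.
have dX' := smooth_differentiable y sX'.
pose e j : 'cV[R]_d := delta_mx j 0.
pose T i j := (('D_(e j) (jac X) y *m e i)^T *m (J *m X' y)) 0 0.
have E i j : jac (fun y => (jac X y)^T *m J *m X' y) y i j =
    T i j + ((jac X y)^T *m J *m jac X' y) i j.
  rewrite mxE derive_mulmx // [LHS]mxE; congr (_ + _).
    rewrite derive_mulmx // derive_cst mulmx0 addr0 derive_trmx //.
    by rewrite /T trmx_mul trmx_delta -[in RHS]mulmxA -rowE [RHS]mxE mulmxA.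
  by rewrite -jacE // mulmxA -colE [LHS]mxE.
apply/matrixP => i j; rewrite [LHS]mxE [in X in _ + X]mxE [in X in _ + X]mxE !E.
have -> : T j i = T i j by exact:
  (congr1 (fun w : 'cV[R]_d => (w^T *m (J *m X' y)) 0 0) (derive_jac_sym y (e j) (e i) sX)).
rewrite opprD addrACA subrr add0r [RHS]mxE; congr (_ + _).
have Pt : ((jac X y)^T *m J *m jac X' y)^T = - ((jac X' y)^T *m J *m jac X y).
  by rewrite !trmx_mul trmxK trJ mulNmx mulmxN mulmxA.
have := congr1 (fun M : 'M[R]_d => M i j) Pt; rewrite [LHS]mxE [RHS]mxE => ->.
by rewrite opprK.
Qed.

End InvariantForm.

(** * The modified symplectic form *)

Section ModifiedForm.
Context {R : realType} {d s : nat}.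
Hypothesis s1 : (1 <= s)%N.
Variables (J : 'M[R]_d) (f : 'cV[R]_d -> 'cV[R]_d).
Hypothesis trJ : J^T = - J.
Hypothesis JJ : J *m J = - 1%:M.
Hypothesis sf : smooth f.
Hypothesis fJ : forall y, (jac f y)^T *m J + J *m jac f y = 0.

Let F := tangent f.
Let Y j := iter j (lie f) id.

Let B j (Z : 'M[R]_(d, 1 + d)) := rsubmx (iter j (lie F) id Z).

Let sF : smooth F. Proof. exact: smooth_tangent. Qed.

Let sY j : smooth (Y j). Proof. exact: smooth_lie_iter sf (@smooth_id R d 1). Qed.

Let sG j : smooth (iter j (lie F) id).
Proof. exact: smooth_lie_iter sF (@smooth_id R d (1 + d)). Qed.

Let sB j : smooth (B j).
Proof. by move=> k; apply: (Ck_comp (sG j k) (smooth_rsubmx k)). Qed.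

Let BE j Z : B j Z = jac (Y j) (lsubmx Z) *m rsubmx Z.
Proof. by rewrite /B iter_lie_tangent // /tangent row_mxKr. Qed.

Let DB j : lie F (B j) = B j.+1.
Proof.
apply: funext => Z; rewrite /lie /B.
have dG := smooth_differentiable Z (sG j).
have dR := @differentiable_rsubmx R d 1 d (iter j (lie F) id Z).
rewrite deriveE; last exact: (@differentiable_comp _ _ _ _ _ (@rsubmx R d 1 d)).
rewrite (@diff_comp _ _ _ _ _ (@rsubmx R d 1 d)) //=.
by rewrite -(deriveE _ dR) derive_rsubmx -(deriveE _ dG).
Qed.

Let B0 w : lie w (B 0) = fun Z => rsubmx (w Z).
Proof. by apply: funext => Z; rewrite /lie derive_rsubmx. Qed.

(* J itself, as a quadratic form on frames, and its correction. *)
Let Q0 := pairing J B 0 0.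
Let Q1 Z := bernR (2 * s) *: pairing_primitive (s := s) J B Z.

Let DQ0 : lie F Q0 = fun=> 0.
Proof.
rewrite /Q0 lie_pairing // DB; apply: funext => Z; rewrite !BE.
rewrite /Y /= lie_id jac_id mul1mx !trmx_mul -[X in X + _]mulmxA.
rewrite -!mulmxA -mulmxDr !mulmxA -mulmxDl fJ mul0mx mulmx0 //.
Qed.

Let EQ0 : (fun Z => bernR (2 * s) *: lie (leading_defect (s := s) F) Q0 Z) = lie F Q1.
Proof.
rewrite /Q1 lieZ; last exact: smooth_pairing_primitive.
rewrite lie_pairing_primitive // /Q0 lie_pairing // B0.
have EB Z : rsubmx (leading_defect (s := s) F Z) = B (2 * s + 1) Z by [].
by apply: funext => Z; rewrite EB; congr (_ *: _); apply: addrC.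
Qed.

(** The 1-form alpha_(j,k) = (Y_j')^T J Y_k, with Y_j the j-th time derivative of
    the solution, has the symmetrized pairing of Y_j' and Y_k' as its curl. This
    combination is made after [pairing_primitive]. *)
Definition potential (y : 'cV[R]_d) : 'cV[R]_d :=
  bernR (2 * s) *: (
    \sum_(i < s) (-1) ^+ i *: ((jac (Y i) y)^T *m J *m Y (2 * s - i) y)
    + ((-1) ^+ s / 2) *: ((jac (Y s) y)^T *m J *m Y s y)).

(** The field g with J g = [potential], since J^2 = -1. Then g'^T J + J g' is the
    curl of the potential. *)
Definition conjugacy_field y := - (J *m potential y).

Let W j k y := (jac (Y j) y)^T *m J *m jac (Y k) y + (jac (Y k) y)^T *m J *m jac (Y j) y.

Let potential_curl : has_curl potential (fun y =>
  bernR (2 * s) *: (\sum_(i < s) (-1) ^+ i *: W i (2 * s - i) y + ((-1) ^+ s / 2) *: W s s y)).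
Proof.
have curlW j k : has_curl (fun y => (jac (Y j) y)^T *m J *m Y k y) (W j k).
  by apply: has_curl_pullback.
apply: has_curlZ; apply: has_curlD; last exact: has_curlZ.
by apply: (@has_curl_sum _ _ s) => i; apply: has_curlZ.
Qed.

Lemma smooth_conjugacy_field : smooth conjugacy_field.
Proof.
have [sp _] := potential_curl.
move=> k; rewrite /conjugacy_field; under eq_fun do rewrite -scaleN1r.
by apply: CkZ; apply: Ck_mulmx (Ck_cst _ _) (sp k).
Qed.

Let jac_field y : jac conjugacy_field y = - (J *m jac potential y).
Proof.
have [sp _] := potential_curl; have dp := smooth_differentiable y sp.
apply: eq_jac => [|v]; first by apply: smooth_differentiable smooth_conjugacy_field.
have dJp : differentiable (fun y => J *m potential y) y by exact: differentiable_mulmx.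
rewrite /conjugacy_field deriveN; last exact: diff_derivable.
by rewrite derive_mulmx // derive_cst mul0mx add0r -jacE // mulNmx mulmxA.
Qed.

(** The pull-back of J by the change of coordinates y - h^(2s) g(y), evaluated on a
    frame of tangent vectors. *)
Definition modified_form (h : R) (Z : 'M[R]_(d, 1 + d)) : 'M[R]_d :=
  let N := 1%:M - h ^+ (2 * s) *: jac conjugacy_field (lsubmx Z) in
  (N *m rsubmx Z)^T *m J *m (N *m rsubmx Z).

Let Q2 (Z : 'M[R]_(d, 1 + d)) := (jac conjugacy_field (lsubmx Z) *m rsubmx Z)^T *m J *m
  (jac conjugacy_field (lsubmx Z) *m rsubmx Z).

Let modified_formE h Z :
  modified_form h Z = Q0 Z - h ^+ (2 * s) *: Q1 Z + h ^+ (4 * s) *: Q2 Z.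
Proof.
set A := rsubmx Z; set G := jac conjugacy_field (lsubmx Z).
have Q1E : Q1 Z = A^T *m (G^T *m J + J *m G) *m A.
  have [_ curl] := potential_curl.
  have -> : G^T *m J + J *m G = jac potential (lsubmx Z) - (jac potential (lsubmx Z))^T.
    rewrite /G jac_field linearN /= mulNmx mulmxN trmx_mul trJ mulmxN mulNmx -mulmxA JJ.
    by rewrite mulmxN mulmx1 mulmxA JJ mulNmx mul1mx !opprK addrC.
  have AWA j k : A^T *m W j k (lsubmx Z) *m A = sym_pairing J B j k Z.
    have pE i l : pairing J B i l Z = A^T *m ((jac (Y i) (lsubmx Z))^T *m J *m jac (Y l) (lsubmx Z)) *m A.
      by rewrite /pairing (BE i Z) (BE l Z) trmx_mul !mulmxA.
    by rewrite /sym_pairing !pE -mulmxDl -mulmxDr.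
  rewrite curl -scalemxAr -scalemxAl; congr (_ *: _).
  rewrite mulmxDr mulmxDl -scalemxAr -scalemxAl AWA mulmx_sumr mulmx_suml; congr (_ + _).
  by apply: eq_bigr => i _; rewrite -scalemxAr -scalemxAl AWA.
have Q0E : Q0 Z = A^T *m J *m A by [].
have Q2E : Q2 Z = A^T *m (G^T *m J *m G) *m A by rewrite /Q2 trmx_mul !mulmxA.
rewrite Q0E Q1E Q2E /modified_form -/A -/G (_ : (4 * s = 2 * s + 2 * s)%N); last by lia.
rewrite exprD; move: (h ^+ (2 * s)) => c.
have NE : (1%:M - c *: G)^T *m J *m (1%:M - c *: G) =
    J - c *: (G^T *m J + J *m G) + (c * c) *: (G^T *m J *m G).
  rewrite [_^T]linearB linearZ /= trmx1 mulmxBl mul1mx mulmxBr mulmx1 !mulmxBl.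
  rewrite -!scalemxAl -!scalemxAr scalerA.
  move: (G^T *m J) (J *m G) (G^T *m J *m G) => a b e.
  by apply/matrixP => i j; rewrite !mxE; ring.
have -> : ((1%:M - c *: G) *m A)^T *m J *m ((1%:M - c *: G) *m A) =
    A^T *m ((1%:M - c *: G)^T *m J *m (1%:M - c *: G)) *m A.
  by rewrite trmx_mul !mulmxA.
have D (X1 X2 X3 : 'M[R]_d) (e : R) : A^T *m (X1 - c *: X2 + e *: X3) *m A =
    A^T *m X1 *m A - c *: (A^T *m X2 *m A) + e *: (A^T *m X3 *m A).
  by rewrite mulmxDr mulmxBr -!scalemxAr mulmxDl mulmxBl -!scalemxAl.
by rewrite NE D.
Qed.

(** The pull-back (1 - h^(2s) g')^T J (1 - h^(2s) g') is J minus h^(2s) times the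
    curl of the potential plus O(h^(4s)): on the solutions of the variational
    equation this is the almost conserved form given by [pairing_primitive]. *)
Lemma modified_form_conserved (Psi : R -> 'cV[R]_d -> 'cV[R]_d) :
  is_EulerMaclaurin s f Psi ->
  bigO (fun h Z => modified_form h (tangent (Psi h) Z) - modified_form h Z) (2 * s + 3).
Proof.
move=> Psi_EM.
have sQ2 : smooth Q2.
  have sGA : smooth (fun Z : 'M[R]_(d, 1 + d) => jac conjugacy_field (lsubmx Z) *m rsubmx Z).
    move=> k; apply: (Ck_mulmx _ (smooth_rsubmx k)).
    exact: (Ck_comp (smooth_lsubmx k) (smooth_jac smooth_conjugacy_field k)).
  move=> k; apply: Ck_mulmx (sGA k); apply: Ck_mulmx (Ck_cst _ _).
  by apply: Ck_trmx; apply: sGA.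
have sQ0 : smooth Q0 by exact: smooth_pairing.
have sQ1 : smooth Q1 by apply: smooth_scale; apply: smooth_pairing_primitive.
have := almost_conserved s1 sF (em_tangent_bigO0 s1 sf Psi_EM) (em_tangent s1 sf Psi_EM) sQ0 sQ1 sQ2 DQ0 EQ0.
by apply: eq_bigO => h Z; rewrite !modified_formE.
Qed.

End ModifiedForm.

(** * Conjugation to a nearly symplectic map *)

Section HamiltonianField.
Context {R : realType} {m : nat}.

Lemma Jmx_tr : (Jmx m : 'M[R]_(m + m))^T = - Jmx m.
Proof. by rewrite /Jmx tr_block_mx opp_block_mx linearN /= trmx1 trmx0 opprK oppr0. Qed.

Lemma Jmx_sq : (Jmx m : 'M[R]_(m + m)) *m Jmx m = - 1%:M.
Proof.
rewrite /Jmx mulmx_block !mul0mx !mulmx0 mulmx1 mulmxN mulmx1 !add0r addr0.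
by rewrite [in RHS]scalar_mx_block opp_block_mx oppr0.
Qed.

Variable H : 'cV[R]_(m + m) -> R.
Hypothesis sH : smooth H.

Lemma smooth_gradient : smooth (gradient H).
Proof.
move=> k; apply/Ck_mxP => i j; under eq_fun do rewrite mxE.
by apply: smooth_derive.
Qed.

Lemma jac_gradient_sym y : (jac (gradient H) y)^T = jac (gradient H) y.
Proof.
have dg := smooth_differentiable y smooth_gradient.
have E i j : jac (gradient H) y i j = 'D_(delta_mx j 0) ('D_(delta_mx i 0) H) y.
  rewrite mxE (derive_coord _ _ _ dg).
  have -> : (fun z => gradient H z i 0) = 'D_(delta_mx i 0) H by apply: funext => z; rewrite mxE.
  by [].
apply/matrixP => i j; rewrite mxE.
apply: etrans (E _ _) _; apply: etrans _ (esym (E _ _)).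
exact: schwarz_real (sH 2).
Qed.

Lemma smooth_hamiltonian_field : smooth (hamiltonian_field H).
Proof. by move=> k; apply: Ck_mulmx (Ck_cst _ _) (smooth_gradient k). Qed.

Lemma hamiltonian_field_infinitesimally_symplectic y :
  (jac (hamiltonian_field H) y)^T *m Jmx m + Jmx m *m jac (hamiltonian_field H) y = 0.
Proof.
have dg := smooth_differentiable y smooth_gradient.
have -> : jac (hamiltonian_field H) y = Jmx m *m jac (gradient H) y.
  apply: eq_jac => [|v]; first exact: smooth_differentiable smooth_hamiltonian_field.
  by rewrite derive_mulmx // derive_cst mul0mx add0r -jacE // mulmxA.
rewrite trmx_mul jac_gradient_sym Jmx_tr mulmxA Jmx_sq mulmxN !mulNmx mul1mx.
by rewrite -mulmxA Jmx_sq mulmxN mulmx1 opprK subrr.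
Qed.

End HamiltonianField.

Section Conjugation.
Context {R : realType} {d s : nat}.
Hypothesis s1 : (1 <= s)%N.
Variables (J : 'M[R]_d) (f : 'cV[R]_d -> 'cV[R]_d).
Hypothesis trJ : J^T = - J.
Hypothesis JJ : J *m J = - 1%:M.
Hypothesis sf : smooth f.
Hypothesis fJ : forall y, (jac f y)^T *m J + J *m jac f y = 0.
Variable Psi : R -> 'cV[R]_d -> 'cV[R]_d.
Hypothesis Psi_EM : is_EulerMaclaurin s f Psi.

(** Let N = 1 - h^(2s) g' be the derivative of chi'. The defect of symplecticity of
    chi' o Psi o chi at x is the change of the modified form from y = chi x to Psi y,
    transported by N^-1, which is bounded. *)
Theorem conjugate_near_symplectic :
  exists chi chi' Psihat : R -> 'cV[R]_d -> 'cV[R]_d,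
    [/\ forall h, diffeomorphism (chi h) (chi' h),
        is_bigO (fun h y => chi h y - y) (2 * s),
        forall h, Psi h = chi h \o Psihat h \o chi' h,
        for_small_h (fun h y => differentiable (Psihat h) y) &
        is_bigO (fun h y =>
          (jac (Psihat h) y)^T *m J *m jac (Psihat h) y - J) (2 * s + 3)].
Proof.
set g := conjugacy_field (s := s) J f.
have sg : smooth g by exact: smooth_conjugacy_field.
have p0 : (0 < 2 * s)%N by rewrite muln_gt0.
have [U [sU Ub Ug]] := small_representative p0 sg.
pose chi' h y := y - U h y.
have [chi chiP] := choice (fun h => global_inverse (sU h) (Ub h)).
have diffeo h : diffeomorphism (chi h) (chi' h) by have [] := chiP h.
have chiK h : cancel (chi h) (chi' h) by have [] := diffeo h.
have chi'K h : cancel (chi' h) (chi h) by have [] := diffeo h.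
have schi h : smooth (chi h) by have [] := diffeo h.
have schi' h : smooth (chi' h) by have [] := diffeo h.
pose Psihat h := chi' h \o Psi h \o chi h.
have chi_bounded (r : R) : \forall h \near (0 : R), forall x, `|x| <= r ->
    `|chi h x| <= 2 * (r + `|g 0|).
  move: (Ug 0) (@near0_le1 R); apply: filterS2 => h Ugh h1 x xr.
  have [_ cb _] := chiP h; apply: le_trans (cb x) _.
  rewrite ler_pM2l // lerD // Ugh ?normr0 // normrZ normrX ler_piMl //.
  by rewrite exprn_ile1.
have jac_chi' (r : R) : \forall h \near (0 : R), forall y, `|y| <= r ->
    jac (chi' h) y = 1%:M - h ^+ (2 * s) *: jac g y.
  apply: filterS (Ug (r + 1)) => h Ugh y yr.
  have dg := smooth_differentiable y sg.
  have dU := smooth_differentiable y (sU h).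
  apply: eq_jac => [|v]; first exact: smooth_differentiable (schi' h).
  rewrite /chi' deriveB ?derive_id //; last exact: diff_derivable.
  rewrite mulmxBl mul1mx -scalemxAl jacE //; congr (_ - _).
  rewrite -(@deriveZ _ _ _ g) //; last exact: diff_derivable.
  apply: near_eq_derive; apply/nbhs_normP; exists 1 => //= z /=.
  rewrite distrC => zy; apply: Ugh; rewrite -[z](subrK y) addrC.
  by rewrite (le_trans (ler_normD _ _)) // lerD // ltW.
have jac_chiK h x : jac (chi' h) (chi h x) *m jac (chi h) x = 1%:M.
  rewrite -jac_comp; [|exact: smooth_differentiable|exact: smooth_differentiable].
  by rewrite (_ : chi' h \o chi h = id) ?jac_id //; apply: funext => z /=; rewrite chiK.
exists chi, chi', Psihat; split=> //.
- move=> r; set r1 := 2 * (r + `|g 0|).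
  have [C C0 CP] := continuous_locally_bounded r1 (smooth_continuous sg).
  exists C; move: (chi_bounded r) (Ug r1); apply: filterS2 => h cb Ugh x xr.
  have -> : chi h x - x = U h (chi h x) by rewrite -{2}(chiK h x) /chi' subKr.
  rewrite Ugh ?cb // normrZ normrX mulrC ler_wpM2r ?exprn_ge0 //.
  exact: CP (cb x xr).
- by move=> h; apply: funext => y /=; rewrite /Psihat /= chi'K chi'K.
- move=> r; move: (chi_bounded r) (em_regular s1 sf Psi_EM (2 * (r + `|g 0|))).
  apply: filterS2 => h cb reg x xr; have [dPsi _ _] := reg _ (cb x xr).
  apply: differentiable_comp; first exact: smooth_differentiable (schi h).
  by apply: differentiable_comp => //; apply: smooth_differentiable (schi' h).
move=> r; set r1 := 2 * (r + `|g 0|).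
have [C C0 CP] := bigO_pos (em_bigO0 Psi_EM) r1.
have [D D0 DP] := bigO_pos (modified_form_conserved s1 trJ JJ sf fJ Psi_EM) (r1 + 1).
exists (d%:R * (d%:R * 2 * D) * 2).
have jac_near : \forall h \near (0 : R),
    (forall y, `|y| <= r1 -> jac (chi' h) y = 1%:M - h ^+ (2 * s) *: jac g y) /\
    (forall y, `|y| <= C -> jac (chi' h) y = 1%:M - h ^+ (2 * s) *: jac g y).
  by move: (jac_chi' r1) (jac_chi' C); apply: filterS2 => h ? ?; split.
have reg_near : \forall h \near (0 : R),
    (forall x, `|x| <= r -> `|chi h x| <= r1) /\
    (forall y, `|y| <= r1 -> differentiable (Psi h) y).
  move: (chi_bounded r) (em_regular s1 sf Psi_EM r1); apply: filterS2 => h cb reg.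
  by split=> // y /reg[].
have est_near : \forall h \near (0 : R),
    (forall y : 'cV[R]_d, `|y| <= r1 -> `|Psi h y| <= C * `|h| ^+ 0) /\
    (forall Z : 'M[R]_(d, 1 + d), `|Z| <= r1 + 1 ->
      `|modified_form (s := s) J f h (tangent (Psi h) Z) - modified_form (s := s) J f h Z|
        <= D * `|h| ^+ (2 * s + 3)).
  by move: CP DP; apply: filterS2.
move: jac_near reg_near est_near; apply: filterS3 => h [jr1 jC] [cb dPsi] [CPh DPh] x xr.
pose y := chi h x; pose Z := row_mx y 1%:M : 'M[R]_(d, 1 + d); pose K := jac (chi h) x.
have yr : `|y| <= r1 := cb x xr.
have PsiC : `|Psi h y| <= C by have := CPh y yr; rewrite expr0 mulr1.
have Zr : `|Z| <= r1 + 1.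
  apply: le_trans (norm_row_mx _ _) _; apply: lerD => //.
  by apply: norm_le_coord => // i j; rewrite mxE; case: (_ == _); rewrite ?normr1 ?normr0.
have jPsihat : jac (Psihat h) x = jac (chi' h) (Psi h y) *m jac (Psi h) y *m K.
  have dchi : differentiable (chi h) x := smooth_differentiable x (schi h).
  have dchi' : differentiable (chi' h) (Psi h y) := smooth_differentiable _ (schi' h).
  have dPy : differentiable (Psi h) y := dPsi y yr.
  have dc : differentiable (chi' h \o Psi h) y by exact: differentiable_comp.
  apply: etrans (jac_comp dchi dc) _.
  exact: (congr1 (mulmx^~ K) (jac_comp dPy dchi')).
have NK : jac (chi' h) y *m K = 1%:M by apply: jac_chiK.
set N1 := jac (chi' h) (Psi h y) in jPsihat; set N0 := jac (chi' h) y in NK.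
have form1 : modified_form (s := s) J f h (tangent (Psi h) Z) =
    (N1 *m jac (Psi h) y)^T *m J *m (N1 *m jac (Psi h) y).
  by rewrite /modified_form /tangent !row_mxKl !row_mxKr mulmx1 /N1 (jC _ PsiC).
have form0 : modified_form (s := s) J f h Z = N0^T *m J *m N0.
  by rewrite /modified_form row_mxKl row_mxKr mulmx1 /N0 (jr1 _ yr).
have -> : (jac (Psihat h) x)^T *m J *m jac (Psihat h) x - J =
    K^T *m (modified_form (s := s) J f h (tangent (Psi h) Z) - modified_form (s := s) J f h Z) *m K.
  rewrite mulmxBr mulmxBl form1 form0 jPsihat; congr (_ - _).
    by move: (N1 *m _) => M; rewrite trmx_mul !mulmxA.
  by rewrite !mulmxA -trmx_mul NK trmx1 mul1mx -mulmxA NK mulmx1.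
have [_ _ /(_ x) K2] := chiP h.
apply: le_trans (norm_mulmx _ _) _; set q := (2 * s + 3)%N.
have -> : d%:R * (d%:R * 2 * D) * 2 * `|h| ^+ q = d%:R * (d%:R * 2 * (D * `|h| ^+ q)) * 2.
  by ring.
apply: ler_pM; [by rewrite mulr_ge0|by []| |exact: K2].
rewrite ler_wpM2l //; apply: le_trans (norm_mulmx _ _) _.
apply: ler_pM; [by rewrite mulr_ge0|by []| |exact: DPh].
by rewrite norm_trmx ler_wpM2l.
Qed.

End Conjugation.

Theorem theorem1 (R : realType) (s : nat) (s_ge1 : (1 <= s)%N) :
  (exists (a_empty : R) (a : ptree -> R),
     forall (d : nat) (f : 'cV[R]_d -> 'cV[R]_d)
            (Psi : R -> 'cV[R]_d -> 'cV[R]_d),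
       smooth f -> is_EulerMaclaurin s f Psi -> is_Bseries f Psi a_empty a)
  /\
  (forall (m : nat) (H : 'cV[R]_(m + m) -> R)
          (Psi : R -> 'cV[R]_(m + m) -> 'cV[R]_(m + m)),
     smooth H -> is_EulerMaclaurin s (hamiltonian_field H) Psi ->
     conjugate_symplectic (2 * s) (2 * s + 2) Psi).
Proof.
split; first exact: EulerMaclaurin_Bseries.
move=> m H Psi sH Psi_EM; rewrite /conjugate_symplectic -addnS.
exact: (conjugate_near_symplectic s_ge1 Jmx_tr Jmx_sq (smooth_hamiltonian_field sH)
  (hamiltonian_field_infinitesimally_symplectic sH) Psi_EM).
Qed.
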